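(* Let $k$ be an infinite field of characteristic $p>0$, let $n\geq 1$ be an integer, put $m=\min(n-1,p-1)$, and for $0\leq i\leq m$ let $\lambda^i=(p-i,1^i)$. Then for all $0\leq i\leq m$ the formal characters of $\mathrm{GL}_n(k)$-modules satisfy $$\mathrm{ch}\,L(\lambda^i)=\sum_{j=i}^{m}(-1)^{j-i}\,\mathrm{ch}\,\Delta(\lambda^j).$$
   Context: $k$ is an infinite field of characteristic $p>0$ and $G=\mathrm{GL}_n(k)$, regarded as an algebraic group (all modules are rational). $T\subset G$ is the subgroup of diagonal matrices; its character group $X=X(T)$ is identified with $\mathbb{Z}^n$ via $\lambda=\sum_i\lambda_i\varepsilon_i\leftrightarrow(\lambda_1,\dots,\lambda_n)$, where $\varepsilon_i$ is the $i$-th diagonal coordinate function. The positive roots are $\varepsilon_i-\varepsilon_j$ ($i<j$), so $\lambda$ is dominant iff $\lambda_1\geq\cdots\geq\lambda_n$. $B$ is the Borel subgroup corresponding to the negative roots. For dominant $\lambda$: $\nabla(\lambda)=\mathrm{ind}_B^G k_\lambda$, where $k_\lambda$ is the one-dimensional $B$-module on which $T$ acts via $\lambda$ and the unipotent radical of $B$ acts trivially; $\Delta(\lambda)$ is the Weyl module, $\Delta(\lambda)\simeq\nabla(-w_0\lambda)^*$ with $w_0$ the longest element of the Weyl group $\Sigma_n$; $L(\lambda)$ is the simple $G$-module of highest weight $\lambda$. For a finite-dimensional $G$-module $M$ with weight spaces $M_\lambda=\{v\in M: tv=\lambda(t)v\ \text{for all}\ t\in T\}$, the formal character is $\mathrm{ch}\,M=\sum_{\lambda\in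 X}(\dim M_\lambda)\,e(\lambda)\in\mathbb{Z}[X]$, where $\mathbb{Z}[X]$ is the group ring with $\mathbb{Z}$-basis $\{e(\lambda)\}$ and $e(\lambda)e(\mu)=e(\lambda+\mu)$. The $p$-hook partitions are $\lambda^i=(p-i,1^i)$, $0\leq i\leq p-1$, a partition of $p$ with $i+1$ parts; a partition with at most $n$ parts is regarded as a dominant weight by appending zeros. *)

(* Defs.v *)
From HB Require Import structures.
From mathcomp Require Import all_boot all_order all_algebra.
From mathcomp Require Import freeg.
From mathcomp Require Import mpoly.
From mathcomp Require Import boolp classical_sets functions cardinality fsbigop.

Set Implicit Arguments.
Unset Strict Implicit.
Unset Printing Implicit Defensive.

Import GRing.Theory.

Local Open Scope classical_set_scope.
Local Open Scope ring_scope.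

(* All algebraic-group notions below are phrased on the group GL_n(k) of
   k-points: they are used over an infinite field k only, for which GL_n(k),
   T(k) and B(k) are Zariski dense in GL_n, T and B.  *)

Section GeneralLinearGroup.
Variables (k : fieldType) (n : nat).

Definition GL := {g : 'M[k]_n | g \in unitmx}.

HB.instance Definition _ := Choice.on GL.

Definition GL1 : GL := exist (fun g : 'M_n => g \in unitmx) 1%:M (unitmx1 k n).

Lemma GLM_subproof (g h : GL) : val g *m val h \in unitmx.
Proof. by rewrite unitmx_mul !(valP g, valP h). Qed.
Definition GLM (g h : GL) : GL :=
  exist (fun g : 'M_n => g \in unitmx) _ (GLM_subproof g h).

Lemma GLV_subproof (g : GL) : invmx (val g) \in unitmx.
Proof. by rewrite unitmx_inv (valP g). Qed.
Definition GLV (g : GL) : GL :=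
  exist (fun g : 'M_n => g \in unitmx) _ (GLV_subproof g).

Lemma GLMA : associative GLM.
Proof. by move=> f g h; apply: val_inj; rewrite /= mulmxA. Qed.
Lemma GL1M : left_id GL1 GLM.
Proof. by move=> g; apply: val_inj; rewrite /= mul1mx. Qed.
Lemma GLM1 : right_id GL1 GLM.
Proof. by move=> g; apply: val_inj; rewrite /= mulmx1. Qed.
Lemma GLVM : left_inverse GL1 GLV GLM.
Proof. by move=> g; apply: val_inj; rewrite /= mulVmx ?(valP g). Qed.
Lemma GLMV : right_inverse GL1 GLV GLM.
Proof. by move=> g; apply: val_inj; rewrite /= mulmxV ?(valP g). Qed.

HB.instance Definition _ := isGroup.Build GL GLMA GL1M GLM1 GLVM GLMV.

(* Elements of k[G] = k[x_ij, 1/det]; the variable of index [mxvec_index i j]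
   stands for x_ij. *)
Definition regular_fun (f : GL -> k) : Prop :=
  exists (P : {mpoly k[n * n]}) (N : nat),
    forall g : GL, f g = P.@[mxvec (val g) 0] / \det (val g) ^+ N.

(* The character b |-> \prod_i b_ii ^ lam_i of T, and its inflation to the
   lower triangular Borel subgroup B, i.e. the action of B on k_lam. *)
Definition wchar (lam : 'rV[int]_n) (b : GL) : k :=
  \prod_(i < n) val b i i ^ lam 0 i.

End GeneralLinearGroup.

Section Weights.
Variable n : nat.
Implicit Types lam mu : 'rV[int]_n.

Definition eps (i : 'I_n) : 'rV[int]_n := delta_mx 0 i.

(* mu <= lam: the difference is a sum of positive roots eps_i - eps_j, i < j. *)
Definition dominance mu lam : Prop :=
  exists c : 'I_n -> 'I_n -> nat,
    lam - mu = \sum_(i < n) \sum_(j < n | (i < j)%N) (eps i - eps j) *+ c i j.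

(* The longest element of the symmetric group is the order reversal. *)
Definition w0 lam : 'rV[int]_n := \row_(i < n) lam 0 (rev_ord i).

(* lambda^i = (p - i, 1^i), followed by zeros; meant for i < p and i < n. *)
Definition hook (p i : nat) : 'rV[int]_n :=
  \row_(j < n) (if j == 0 :> nat then p%:Z - i%:Z else (j <= i)%N%:Z).

End Weights.

Section Modules.
Variables (k : fieldType) (n : nat).
Local Notation G := (GL k n).

Record gmodule := GModule {
  gcar :> lmodType k;
  gact : G -> gcar -> gcar;
  gact_linear : forall g, linear (gact g);
  gact1 : forall v, gact 1%g v = v;
  gactM : forall g h v, gact (g * h)%g v = gact g (gact h v)
}.

(* V is a comodule over k[G]: each orbit map g |-> g v has the form
   \sum_i f_i(g) w_i with finitely many w_i in V and f_i in k[G]. *)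
Definition rational (V : gmodule) : Prop :=
  forall v : V, exists (r : nat) (f : 'I_r -> G -> k) (w : 'I_r -> V),
    (forall i, regular_fun (f i)) /\
    (forall g, gact g v = \sum_(i < r) f i g *: w i).

Definition gsubmodule (V : gmodule) (U : set V) : Prop :=
  [/\ U 0, forall (a : k) u v, U u -> U v -> U (a *: u + v)
         & forall g u, U u -> U (gact g u)].

Definition gsimple (V : gmodule) : Prop :=
  (exists v : V, v != 0) /\
  forall U : set V, gsubmodule U -> U = [set 0] \/ U = setT.

Definition weight_space (V : gmodule) (mu : 'rV[int]_n) : set V :=
  [set v | forall t : G, is_diag_mx (val t) -> gact t v = wchar mu t *: v].

Definition is_weight (V : gmodule) (mu : 'rV[int]_n) : Prop :=
  exists2 v : V, weight_space mu v & v != 0.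

Definition highest_weight (V : gmodule) (lam : 'rV[int]_n) : Prop :=
  is_weight V lam /\ forall mu, is_weight V mu -> dominance mu lam.

(* V is a copy of L(lam). *)
Definition is_L (lam : 'rV[int]_n) (V : gmodule) : Prop :=
  [/\ rational V, gsimple V & highest_weight V lam].

Definition is_basis (V : lmodType k) (S : set V) (d : nat) (e : 'I_d -> V) :=
  (forall i, S (e i)) /\
  (forall v, S v -> exists! c : 'rV[k]_d, v = \sum_(i < d) c 0 i *: e i).

(* The dimension of a linear subspace S; 0 by convention if it is infinite. *)
Definition subspace_dim (V : lmodType k) (S : set V) : nat :=
  xget 0%N [set d | exists e : 'I_d -> V, is_basis S e].

(* The additive group of Z[X] is the free abelian group {freeg X}, with basis
   << mu >> = e(mu).  The sum is over the set of mu with a nonzero summand,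
   which is finite when V is finite dimensional. *)
Definition ch (V : gmodule) : {freeg 'rV[int]_n} :=
  \sum_(mu \in [set: 'rV[int]_n])
    << (subspace_dim (weight_space (V := V) mu))%:Z *g mu >>.

End Modules.

Section Induced.
Variables (k : fieldType) (n : nat) (lam : 'rV[int]_n).
Local Notation G := (GL k n).

(* ind_B^G k_lam = {f in k[G] | f(g b) = lam(b)^-1 f(g) for all b in B}, with G
   acting by (x f)(g) = f(x^-1 g). *)
Definition nabla_pred : {pred G -> k^o} := fun f =>
  `[< regular_fun f /\
      forall g b : G, is_trig_mx (val b) ->
        f (g * b)%g = (wchar lam b)^-1 * f g >].

Lemma nabla_submod : submod_closed nabla_pred.
Proof.
split=> [|a f h /asboolP[[P [M PM]] fB] /asboolP[[Q [N QN]] hB]]; apply/asboolP.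
  split=> [|g b _]; last by rewrite mulr0.
  by exists 0, 0%N => g; rewrite mevalC mul0r.
split=> [|g b Bb].
  pose D : {mpoly k[n * n]} :=
    \det (\matrix_(i, j) 'X_(mxvec_index i j) : 'M[{mpoly k[n * n]}]_n).
  have DE (g : G) : D.@[mxvec (val g) 0] = \det (val g).
    rewrite -det_map_mx; congr (\det _); apply/matrixP=> i j.
    by rewrite mxE /= mxE mevalXU mxvecE.
  exists (a *: (P * D ^+ N) + Q * D ^+ M), (M + N)%N => g.
  rewrite mevalD mevalZ !mevalM !rmorphXn /= DE.
  have d0 : \det (val g) != 0 by rewrite -unitfE; exact: (valP g).
  have -> : (a *: f + h) g = a * f g + h g by [].
  rewrite PM QN exprD invfM mulrDl; congr (_ + _).
    rewrite -!mulrA; congr (_ * (_ * _)).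
    by rewrite mulrCA mulfV ?expf_neq0 // mulr1.
  by rewrite -!mulrA mulVKf ?expf_neq0.
have E x : (a *: f + h) x = a * f x + h x by [].
by rewrite !E fB // hB // mulrDr mulrCA.
Qed.

HB.instance Definition _ := GRing.isSubmodClosed.Build k _ nabla_pred nabla_submod.

Record nabla_car := NablaCar {nabla_val :> G -> k^o; _ : nabla_pred nabla_val}.

HB.instance Definition _ := [isSub for nabla_val].
HB.instance Definition _ := [Choice of nabla_car by <:].
HB.instance Definition _ := [SubChoice_isSubLmodule of nabla_car by <:].

Lemma regular_lshift (x : G) (f : G -> k) :
  regular_fun f -> regular_fun (fun g => f (x * g)%g).
Proof.
move=> [P [N PN]].
pose X : 'M[{mpoly k[n * n]}]_n := \matrix_(i, j) 'X_(mxvec_index i j).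
pose Y := map_mx (@mpolyC (n * n) k) (val x) *m X.
pose Q := P \mPo [tuple mxvec Y 0 l | l < n * n].
exists ((\det (val x) ^- N)%:MP * Q), N => g.
rewrite mevalM mevalC comp_mpoly_meval PN.
have -> : val (x * g)%g = val x *m val g by [].
rewrite det_mulmx exprMn invfM mulrCA -!mulrA; congr (_ * (_ * _)).
apply: meval_eq => l; rewrite tnth_mktuple.
case/mxvec_indexP: l => i j; rewrite !mxvecE !mxE raddf_sum /=.
apply: eq_bigr => h _; rewrite mevalM !mxE mevalC mevalXU mxvecE.
by [].
Qed.

Lemma nabla_act_subproof (x : G) (f : nabla_car) :
  nabla_pred (fun g => f (x^-1 * g)%g).
Proof.
case: f => f /= /asboolP[fR fB]; apply/asboolP; split.
  exact: regular_lshift.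
by move=> g b Bb; rewrite mulgA fB.
Qed.

Definition nabla_act (x : G) (f : nabla_car) : nabla_car :=
  NablaCar (nabla_act_subproof x f).

Lemma nabla_act_linear x : linear (nabla_act x).
Proof. by move=> a u v; apply: val_inj. Qed.

Lemma nabla_act1 f : nabla_act 1%g f = f.
Proof.
apply: val_inj; apply/funext => g /=.
by rewrite invg1 mul1g.
Qed.

Lemma nabla_actM x y f : nabla_act (x * y)%g f = nabla_act x (nabla_act y f).
Proof.
by apply: val_inj; apply/funext => g /=; rewrite invgM -mulgA.
Qed.

Definition nabla : gmodule k n :=
  GModule nabla_act_linear nabla_act1 nabla_actM.

End Induced.

Section Dual.
Variables (k : fieldType) (n : nat) (V : gmodule k n).

Definition dual_pred : {pred V -> k^o} := fun phi => `[< linear phi >].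

Lemma dual_submod : submod_closed dual_pred.
Proof.
split=> [|a f h /asboolP fL /asboolP hL]; apply/asboolP => b u v.
  by rewrite scaler0 addr0.
have E x : (a *: f + h) x = a *: f x + h x by [].
by rewrite !E fL hL !scalerDr !scalerA mulrC addrACA.
Qed.

HB.instance Definition _ := GRing.isSubmodClosed.Build k _ dual_pred dual_submod.

Record dual_car := DualCar {dual_val :> V -> k^o; _ : dual_pred dual_val}.

HB.instance Definition _ := [isSub for dual_val].
HB.instance Definition _ := [Choice of dual_car by <:].
HB.instance Definition _ := [SubChoice_isSubLmodule of dual_car by <:].

Lemma dual_act_subproof (x : GL k n) (phi : dual_car) :
  dual_pred (fun v => phi (gact x^-1%g v)).
Proof.
case: phi => phi /= /asboolP phiL; apply/asboolP => a u v.
by rewrite gact_linear phiL.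
Qed.

Definition dual_act (x : GL k n) (phi : dual_car) : dual_car :=
  DualCar (dual_act_subproof x phi).

Lemma dual_act_linear x : linear (dual_act x).
Proof. by move=> a u v; apply: val_inj. Qed.

Lemma dual_act1 phi : dual_act 1%g phi = phi.
Proof. by apply: val_inj; apply/funext => v /=; rewrite invg1 gact1. Qed.

Lemma dual_actM x y phi : dual_act (x * y)%g phi = dual_act x (dual_act y phi).
Proof. by apply: val_inj; apply/funext => v /=; rewrite invgM gactM. Qed.

Definition gdual : gmodule k n := GModule dual_act_linear dual_act1 dual_actM.

End Dual.

(* -w0 is the involution on dominant weights with Delta(lam) = nabla(-w0 lam)^*;
   nabla(-w0 lam) is finite dimensional, so its full linear dual is meant. *)
Definition Delta (k : fieldType) (n : nat) (lam : 'rV[int]_n) : gmodule k n :=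
  gdual (nabla k (- w0 lam)).

(* Main.v *)
(* Let mu be a composition of p with s nonzero entries, one of them mu_{r0}.
   A vector of weight -mu in nabla(-w0 lambda^i) amounts to a regular function on
   GL_n that is semi-invariant under diagonal matrices on the left and triangular
   ones on the right.  Such a function is determined by its values at the
   matrices whose first column is all ones and whose other columns are distinct
   unit vectors.  The monomials in the first column times a minor of the first
   i + 1 columns, with row set T such that r0 \in T and T lies in the support of
   mu, realize all admissible values, so that
   dim Delta(lambda^i)_mu = (s - 1 choose i).

   In L(lambda^i), with highest weight vector v, the same expansion shows that
   the mu-components of the vectors g v, for one such g per set T, span the
   weight space.  Comparing coefficients of t^mu in the highest-weight matrix
   coefficient of x t g (t diagonal) gives, for suitably normalized x and g and
   up to invertible factorials, the determinant of the leading block of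
   x diag(mu) g.  As \sum_r mu_r = p = 0 in k, this yields linear relations that
   eliminate all T not containing a second fixed element of the support, and the
   remaining ones are independent: dim L(lambda^i)_mu = (s - 2 choose i - 1).
   The theorem is then the identity
   (s - 2 choose i - 1) = \sum_(j >= i) (-1)^(j - i) (s - 1 choose j). *)
Require Import Defs.
From HB Require Import structures.
From mathcomp Require Import all_boot all_order all_algebra.
From mathcomp Require Import zify ring.
From mathcomp Require Import freeg.
From mathcomp Require Import mpoly.
From mathcomp Require Import boolp classical_sets functions cardinality fsbigop.
From mathcomp Require Import finmap fingroup perm.

Set Implicit Arguments.
Unset Strict Implicit.
Unset Printing Implicit Defensive.

Import GRing.Theory.

Local Open Scope classical_set_scope.
Local Open Scope ring_scope.

(** No structure theory of reductive groups enters: everything comes from semi-invariant functions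
    restricted to curves in GL_n. On two columns other than the first, the entries of a hook weight
    differ by 0 or 1, so along a lower root subgroup such a function is a polynomial of degree at
    most 1, determined by its values at 0 and at the swap of the two columns. This is why
    permutations of the later columns suffice as test points, and what makes hooks special. The same
    functions serve L: the coordinate along the highest weight vector is a linear form whose
    translates separate the vectors of a simple module, so a question about L becomes one about
    matrix coefficients. The factorials in the coefficient formula are invertible once mu has two
    nonzero entries, since each entry is then smaller than p. For mu = p eps_r the formula says
    nothing; that weight is conjugate to lambda^0 and is reached by a permutation matrix. Neither
    nabla nor L is known to be finite dimensional at the start, so weight components are obtained
    from the independence of characters. *)

(** * Polynomials over an infinite field and regular functions along curves *)

Section InfiniteField.
Variable k : fieldType.
Hypothesis k_infinite : infinite_set [set: k].

(** [p * q] has every element of the infinite field as a root. *)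
Lemma poly_eq0_cofinite (p q : {poly k}) :
  q != 0 -> (forall x, q.[x] != 0 -> p.[x] = 0) -> p = 0.
Proof.
move=> q0 pq; apply/eqP; apply: contraT => p0.
have pq0 : p * q != 0 by rewrite mulf_neq0.
have [B _ sB] := infinite_set_fset (size (p * q)) k_infinite.
have: (size B < size (p * q)%R)%N.
  apply: max_poly_roots => //; last exact: fset_uniq.
  apply/allP => x _.
  rewrite rootE hornerM mulf_eq0 orbC; have [//|/pq ->] := boolP (q.[x] == 0).
  by rewrite eqxx.
by rewrite ltnNge sB.
Qed.

Lemma poly_eq0_units (p : {poly k}) : (forall x, x != 0 -> p.[x] = 0) -> p = 0.
Proof.
move=> p0; apply: (@poly_eq0_cofinite p 'X); first by rewrite polyX_eq0.
by move=> x; rewrite hornerX; exact: p0.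
Qed.

Lemma poly_eq_units (p q : {poly k}) :
  (forall x, x != 0 -> p.[x] = q.[x]) -> p = q.
Proof.
move=> pq; apply/eqP; rewrite -subr_eq0; apply/eqP/poly_eq0_units => x x0.
by rewrite hornerD hornerN pq ?subrr.
Qed.

Lemma nonroot (q : {poly k}) : q != 0 -> exists x, q.[x] != 0.
Proof.
move=> q0; apply: contrapT => /forallNP nr.
suff /eqP: (1 : {poly k}) = 0 by rewrite oner_eq0.
by apply: (poly_eq0_cofinite q0) => x /nr.
Qed.

(** These are the sections of O(d) on the projective line: polynomials glued by [c ^+ d] along
    [c -> c^-1] have degree at most [d] and are reversals of each other. *)
Lemma horner_inv_coef (p q : {poly k}) (d : nat) :
  (forall c, c != 0 -> p.[c] = c ^+ d * q.[c^-1]) ->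
  forall m, p`_m = if (m <= d)%N then q`_(d - m) else 0.
Proof.
move=> pq; pose N := size q.
(* [r] is [q] reversed within [N] places; the factors ['X^N] and ['X^d] remove all inverse
   powers. *)
pose r : {poly k} := \poly_(j < N.+1) q`_(N - j).
have E : 'X^N * p = 'X^d * r.
  apply: poly_eq_units => c c0; rewrite !hornerM !hornerXn pq // mulrCA.
  congr (_ * _); rewrite (@horner_coef_wide _ N.+1) //.
  rewrite mulr_sumr horner_poly (reindex_inj rev_ord_inj) /=.
  apply: eq_bigr => j _; rewrite subSS mulrCA; congr (_ * _).
  have jN : (j <= N)%N by rewrite -ltnS.
  by rewrite exprVn -{1}(subnK jN) exprD mulrAC mulfV ?mul1r ?expf_neq0.
move=> m; have := congr1 (fun s : {poly k} => s`_(N + m)) E.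
rewrite !coefXnM ltnNge leq_addr /= addKn => ->.
case: ltnP => h.
  by rewrite ifT ?nth_default // -/N; lia.
rewrite coef_poly; case: ifP => h2; last by rewrite ifF //; lia.
rewrite ifT; last lia.
by congr (q`_ _); lia.
Qed.

(** Multiplying by the opposite power of [z] gives an equality of polynomials, which at [z = 0]
    reads [c = 0]. *)
Lemma expz_neg_horner (c : k) (e : int) (p : {poly k}) :
  (e < 0) -> (forall z, z != 0 -> z ^ e * c = p.[z]) -> c = 0.
Proof.
case: e => // e _ pz.
suff E : c%:P = 'X^(e.+1) * p.
  by move/(congr1 (horner^~ 0)): E; rewrite hornerC hornerM hornerXn expr0n /= mul0r.
apply: poly_eq_units => z z0; rewrite hornerC hornerM hornerXn -pz //.
by rewrite NegzE -exprnN mulrA mulfV ?mul1r ?expf_neq0.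
Qed.

Lemma expz_neq1 (e : int) : e != 0 -> exists2 z : k, z != 0 & z ^ e != 1.
Proof.
move=> e0.
have [|z] := @nonroot ('X * ('X^(`|e|%N) - 1)).
  rewrite mulf_neq0 ?polyX_eq0 // -size_poly_gt0.
  by rewrite -polyC1 size_XnsubC // lt0n absz_eq0.
rewrite hornerM hornerX hornerD hornerN hornerXn hornerC mulf_eq0 negb_or.
case/andP=> z0; rewrite subr_eq0 => ze; exists z => //.
case: e e0 ze => e e0 ze; first by rewrite -exprnP.
by rewrite NegzE -exprnN invr_eq1.
Qed.

Section RegularFunctions.
Variable n : nat.
Implicit Types (F : 'M[k]_n -> k) (g b t : 'M[k]_n).

(** Functions are taken on all matrices, so that products need no membership proofs; only the values
    on invertible matrices are constrained. *)
Definition regmx F := exists (P : {mpoly k[n * n]}) (N : nat),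
  forall g, g \in unitmx -> F g = P.@[mxvec g 0] / \det g ^+ N.

Definition evalmx (C : 'M[{poly k}]_n) (z : k) : 'M[k]_n :=
  map_mx (horner_eval z) C.

Lemma evalmxE C z i j : evalmx C z i j = (C i j).[z].
Proof. by rewrite mxE. Qed.

Lemma det_evalmx C z : \det (evalmx C z) = (\det C).[z].
Proof. by rewrite /evalmx det_map_mx. Qed.

Lemma regmx_curve F (C : 'M[{poly k}]_n) : regmx F ->
  exists (p : {poly k}) (N : nat), forall z, evalmx C z \in unitmx ->
    F (evalmx C z) = p.[z] / (\det C).[z] ^+ N.
Proof.
move=> [P [N PN]].
exists (\sum_(m <- msupp P) P@_m *: \prod_i mxvec C 0 i ^+ m i), N => z u.
rewrite PN // det_evalmx mevalE; congr (_ / _); rewrite horner_sum.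
apply: eq_bigr => m _; rewrite hornerZ horner_prod; congr (_ * _).
by apply: eq_bigr => l _; rewrite horner_exp -map_mxvec mxE.
Qed.

End RegularFunctions.
End InfiniteField.

(** * Semi-invariant functions on GL_n *)

Section Embed2.
Variables (R : comNzRingType) (n : nat) (l l' : 'I_n).
Hypothesis ll' : l != l'.

Definition embed2 (a b c d : R) : 'M[R]_n :=
  \matrix_(i, j) if i == l then (if j == l then a else if j == l' then b else 0)
    else if i == l' then (if j == l then c else if j == l' then d else 0)
    else (i == j)%:R.

Lemma mul_embed2E (g : 'M[R]_n) a b c d i j :
  (g *m embed2 a b c d) i j =
    if j == l then g i l * a + g i l' * c
    else if j == l' then g i l * b + g i l' * d else g i j.
Proof.
rewrite mxE (bigD1 l) //= (bigD1 l') 1?eq_sym //=.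
have E : \sum_(r | (r != l) && (r != l')) g i r * embed2 a b c d r j =
         if (j == l) || (j == l') then 0 else g i j.
  under eq_bigr => r /andP[/negbTE rl /negbTE rl'] do rewrite mxE rl rl'.
  have [/orP jl|] := ifPn.
    rewrite big1 // => r /andP[rl rl']; case: eqP => [rj|]; rewrite ?mulr0 //.
    by move: jl rl rl'; rewrite rj => -[] ->.
  rewrite negb_or => jl; rewrite (bigD1 j) //= eqxx mulr1 big1 ?addr0 // => r.
  by case/andP=> _ /negbTE ->; rewrite mulr0.
rewrite E !mxE !eqxx (eq_sym l' l) (negbTE ll').
case: (eqVneq j l) => [->|jl] /=; first by rewrite addr0.
by case: (eqVneq j l') => /=; rewrite ?addr0 // !mulr0 !add0r.
Qed.

Lemma embed2M a b c d a' b' c' d' :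
  embed2 a b c d *m embed2 a' b' c' d' =
  embed2 (a * a' + b * c') (a * b' + b * d') (c * a' + d * c') (c * b' + d * d').
Proof.
have l'l : l' == l = false by rewrite eq_sym (negbTE ll').
apply/matrixP => i j; rewrite mul_embed2E !mxE !eqxx l'l.
have [_|il] := eqVneq i l.
  by case: (eqVneq j l) => // jl; case: (eqVneq j l').
have [_|il'] := eqVneq i l'.
  by case: (eqVneq j l) => // jl; case: (eqVneq j l').
have [->|jl] := eqVneq j l; first by rewrite (negbTE il) !mul0r addr0.
by have [->|//] := eqVneq j l'; rewrite (negbTE il') !mul0r addr0.
Qed.

Lemma embed2_1 : embed2 1 0 0 1 = 1%:M.
Proof.
apply/matrixP => i j; rewrite !mxE ![_ == j]eq_sym.
have [->|il] := eqVneq i l; first by case: ifP => // _; case: ifP.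
have [->|il'] := eqVneq i l'; last by [].
case: (eqVneq j l) => [->|_]; first by rewrite (negbTE ll').
by case: eqP.
Qed.

Lemma det_embed2_upper x : \det (embed2 1 x 0 1) = 1.
Proof.
have D (y : R) i : embed2 1 y 0 1 i i = 1.
  by rewrite mxE eqxx; case: eqP => // _; case: eqP.
have [lt|le] := ltnP l l'.
  rewrite -det_tr det_trig; last first.
    apply/is_trig_mxP => i j ij; rewrite !mxE.
    case: (eqVneq j l) => [jl|_].
      move: ij; rewrite jl => il; rewrite !ifF //; apply/negbTE.
        by apply: contraTneq (ltn_trans il lt) => ->; rewrite ltnn.
      by apply: contraTneq il => ->; rewrite ltnn.
    case: (eqVneq j l') => [jl'|_].
      case: (eqVneq i l) => // _; rewrite ifF //; apply/negbTE.
      by move: ij; rewrite jl'; apply: contraTneq => ->; rewrite ltnn.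
    by case: eqP ij => // ->; rewrite ltnn.
  by rewrite big1 // => i _; rewrite mxE D.
rewrite det_trig; first by rewrite big1.
apply/is_trig_mxP => i j ij; rewrite !mxE.
case: (eqVneq i l) => [il|_].
  move: ij; rewrite il => lj; rewrite !ifF //; apply/negbTE.
    by apply: contraTneq (leq_ltn_trans le lj) => ->; rewrite ltnn.
  by apply: contraTneq lj => ->; rewrite ltnn.
case: (eqVneq i l') => [il'|_].
  case: (eqVneq j l) => // _; rewrite ifF //; apply/negbTE.
  by move: ij; rewrite il'; apply: contraTneq => ->; rewrite ltnn.
by case: eqP ij => // ->; rewrite ltnn.
Qed.

Lemma embed2_tperm : embed2 0 1 1 0 = perm_mx (tperm l l').
Proof.
apply/matrixP => i j; rewrite !mxE; case: tpermP => [->|->|/eqP il /eqP il'].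
- rewrite eqxx (eq_sym l' j); case: (eqVneq j l) => [->|_].
    by rewrite (negbTE ll').
  by case: eqP.
- by rewrite (eq_sym l' l) (negbTE ll') eqxx (eq_sym l j); case: eqP => // _; case: eqP.
- by rewrite (negbTE il) (negbTE il').
Qed.

End Embed2.

Section SemiInvariants.
Variable k : fieldType.
Hypothesis k_infinite : infinite_set [set: k].
Variable n : nat.
Implicit Types (F : 'M[k]_n -> k) (g b t : 'M[k]_n) (lam mu : 'rV[int]_n).

Definition tchar lam g : k := \prod_i g i i ^ lam 0 i.

(** [is_trig_mx b^T] makes [b] upper triangular, whereas [nabla] is defined through lower triangular
    matrices. On this side minors of the first columns are semi-invariant; [rev_mx] will
    translate. *)
Definition right_semi lam F := forall g b,
  g \in unitmx -> b \in unitmx -> is_trig_mx b^T -> F (g *m b) = tchar lam b * F g.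

Definition left_semi mu F := forall t g,
  t \in unitmx -> is_diag_mx t -> g \in unitmx -> F (t *m g) = tchar mu t * F g.

Lemma regmx_curve1 F (C : 'M[{poly k}]_n) d : regmx F -> d != 0 ->
  (forall z, \det (evalmx C z) = d) -> exists p, forall z, F (evalmx C z) = p.[z].
Proof.
move=> /(regmx_curve C)[p [N pN]] d0 dC.
exists (d ^- N *: p) => z; rewrite hornerZ pN ?unitmxE ?dC ?unitfE //.
by rewrite -det_evalmx dC mulrC.
Qed.

Lemma embed2_unit (l l' : 'I_n) (a b c d : k) : l != l' ->
  a * d - b * c != 0 -> embed2 l l' a b c d \in unitmx.
Proof.
move=> ll' D0; pose D := a * d - b * c.
suff /mulmx1_unit[] : embed2 l l' a b c d *m
    embed2 l l' (d / D) (- b / D) (- c / D) (a / D) = 1%:M by [].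
by rewrite embed2M // -(embed2_1 _ ll'); congr embed2; rewrite /D; field.
Qed.

(* In GL_2 one has [1 0; c 1] = [c^-1 -1; 1 0] [c 1; 0 c^-1]. *)
Lemma right_semi_pair lam F (l l' : 'I_n) (d : nat) g :
  regmx F -> right_semi lam F -> (l < l')%N -> lam 0 l = lam 0 l' + d%:Z ->
  g \in unitmx ->
  exists p q : {poly k}, [/\ forall c, F (g *m embed2 l l' 1 0 c 1) = p.[c],
    forall c, F (g *m embed2 l l' c (-1) 1 0) = q.[c]
    & forall m, p`_m = if (m <= d)%N then q`_(d - m) else 0].
Proof.
move=> Freg Fsemi lt lam_d gu.
have ll' : l != l' by apply: contraTneq lt => ->; rewrite ltnn.
have l'l : l' != l by rewrite eq_sym.
pose C (x : 'M[{poly k}]_n) := map_mx polyC g *m x.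
have evC x z : evalmx (C x) z = g *m evalmx x z.
  rewrite /C /evalmx map_mxM; congr (_ *m _).
  by apply/matrixP => i j; rewrite !mxE /= /horner_eval hornerC.
have evE (a b c e : {poly k}) z :
    evalmx (embed2 l l' a b c e) z = embed2 l l' a.[z] b.[z] c.[z] e.[z].
  apply/matrixP => i j; rewrite evalmxE !mxE.
  by do ![case: ifP => _]; rewrite ?hornerC // hornerMn hornerC.
have swapE c : embed2 l l' 1 0 c 1 = embed2 l' l 1 c 0 1.
  apply/matrixP => i j; rewrite !mxE.
  case: (eqVneq i l) => [->|_].
    rewrite (negbTE ll'); case: (eqVneq j l) => [->|_]; last by case: ifP.
    by rewrite (negbTE ll').
  case: ifP => // _; case: (eqVneq j l) => [->|_]; last by [].
  by rewrite (negbTE ll').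
have [||p pE] := @regmx_curve1 F (C (embed2 l l' 1 0 'X 1)) (\det g) Freg.
- by rewrite -unitfE -unitmxE.
- move=> z; rewrite evC evE !hornerE det_mulmx swapE det_embed2_upper //.
  by rewrite mulr1.
have sE c : embed2 l l' c (-1) 1 0 =
            embed2 l l' 1 c 0 1 *m embed2 l l' 0 (-1) 1 (0 : k).
  by rewrite embed2M //; congr embed2; ring.
have su : embed2 l l' 0 (-1) 1 (0 : k) \in unitmx.
  by apply: embed2_unit => //; rewrite mul0r mulr1 sub0r opprK oner_eq0.
have [||q qE] := @regmx_curve1 F (C (embed2 l l' 'X (-1) 1 0))
   (\det g * \det (embed2 l l' 0 (-1) 1 (0 : k))) Freg.
- by rewrite mulf_neq0 // -unitfE -unitmxE.
- move=> z; rewrite evC evE !hornerE det_mulmx sE det_mulmx.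
  by rewrite det_embed2_upper // mul1r.
exists p, q; split => [c|c|m].
- by rewrite -pE evC evE !hornerE.
- by rewrite -qE evC evE !hornerE.
apply: horner_inv_coef => // c c0.
rewrite -pE -qE !evC !evE !hornerE.
have -> : embed2 l l' 1 0 c 1 =
    embed2 l l' c^-1 (-1) 1 0 *m embed2 l l' c 1 0 c^-1.
  by rewrite embed2M //; congr embed2; field.
(* The upper triangular factor contributes [c ^ (lam_l - lam_l')], that is [c ^+ d]. *)
rewrite mulmxA Fsemi.
- congr (_ * _); rewrite /tchar (bigD1 l) //= (bigD1 l') //= big1 => [|r].
    rewrite !mxE !eqxx (eq_sym l' l) (negbTE ll') mulr1 lam_d.
    by rewrite expfzDr // exprz_inv mulrC mulrA -expfzDr // addNr expr0z mul1r.
  by case/andP=> /negbTE rl /negbTE rl'; rewrite mxE rl rl' eqxx exp1rz.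
- rewrite unitmx_mul gu embed2_unit //.
  by rewrite mulr0 sub0r mulN1r opprK oner_eq0.
- by rewrite embed2_unit // mulfV // mul1r subr0 oner_eq0.
- apply/is_trig_mxP => i j ij; rewrite !mxE.
  case: (eqVneq j l) => [jl|_].
    move: ij; rewrite jl => il; rewrite !ifF //; apply/negbTE.
      by apply: contraTneq (ltn_trans il lt) => ->; rewrite ltnn.
    by apply: contraTneq il => ->; rewrite ltnn.
  case: (eqVneq j l') => [jl'|_].
    case: (eqVneq i l) => // _; rewrite ifF //; apply/negbTE.
    by move: ij; rewrite jl'; apply: contraTneq => ->; rewrite ltnn.
  by case: eqP ij => // ->; rewrite ltnn.
Qed.

End SemiInvariants.

(** * Propagation of zeros under column operations *)

Section Vanishing.
Variable k : fieldType.
Hypothesis k_infinite : infinite_set [set: k].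
Variable m : nat.
Local Notation n := m.+1.
Implicit Types (F : 'M[k]_n -> k) (g b t : 'M[k]_n) (lam mu : 'rV[int]_n).

(** On the line obtained by adding ['X] to every entry of [g], all but finitely many points are
    invertible without zero entries, so the numerator of [F] vanishes identically along it. *)
Lemma regmx_dense F : regmx F ->
  (forall g, g \in unitmx -> (forall i j, g i j != 0) -> F g = 0) ->
  forall g, g \in unitmx -> F g = 0.
Proof.
move=> Freg F0 g gu.
pose C : 'M[{poly k}]_n := \matrix_(i, j) ('X + (g i j)%:P).
have [p [N pE]] := regmx_curve C Freg.
have C0 : evalmx C 0 = g.
  by apply/matrixP => i j; rewrite evalmxE mxE !hornerE.
have dC : \det C != 0.
  apply: contraTneq gu => d0.
  by rewrite unitmxE -C0 det_evalmx d0 horner0 unitr0.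
suff p0 : p = 0 by rewrite -C0 pE ?C0 // p0 horner0 mul0r.
apply: (@poly_eq0_cofinite _ k_infinite p (\det C * \prod_i \prod_j C i j)).
  rewrite mulf_neq0 //; apply/prodf_neq0 => i _; apply/prodf_neq0 => j _.
  by rewrite mxE -size_poly_gt0 size_XaddC.
move=> x; rewrite hornerM mulf_eq0 negb_or => /andP[dx].
rewrite horner_prod => /prodf_neq0 nz.
have xu : evalmx C x \in unitmx by rewrite unitmxE det_evalmx unitfE.
have := F0 _ xu; rewrite pE // => /(_ _)/eqP; rewrite mulf_eq0 invr_eq0.
rewrite (negbTE (expf_neq0 _ dx)) orbF => /(_ _)/eqP; apply => i j.
have := nz i isT; rewrite horner_prod => /prodf_neq0/(_ j isT).
by rewrite evalmxE.
Qed.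

Lemma regmxE F : regmx F <-> regular_fun (fun g : GL k n => F (val g)).
Proof.
split=> -[P [N PN]]; exists P, N; first by move=> g; exact: PN (valP g).
by move=> g gu; exact: PN (exist _ g gu).
Qed.

Lemma regmx_lmul F a : a \in unitmx -> regmx F -> regmx (fun g => F (a *m g)).
Proof.
move=> au /regmxE Freg; apply/regmxE.
exact: (@regular_lshift _ _ (exist _ a au) _ Freg).
Qed.

Lemma right_semi_eq0 lam F g b : right_semi lam F -> g \in unitmx ->
  b \in unitmx -> is_trig_mx b^T -> F g = 0 -> F (g *m b) = 0.
Proof. by move=> Fs gu bu bt F0; rewrite Fs // F0 mulr0. Qed.

(** The first entry is left free: zeros are propagated only through the columns after the first. *)
Definition hook_like (i : nat) lam :=
  forall l : 'I_n, l != ord0 -> lam 0 l = (l <= i)%N%:Z.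

Section Hook.
Variables (i : nat) (lam : 'rV[int]_n) (F : 'M[k]_n -> k).
Hypotheses (lamE : hook_like i lam) (Freg : regmx F) (Fsemi : right_semi lam F).

Lemma embed2_diag_semi (l l' : 'I_n) (a d : k) g : l != l' -> a != 0 -> d != 0 ->
  g \in unitmx -> F g = 0 -> F (g *m embed2 l l' a 0 0 d) = 0.
Proof.
move=> ll' a0 d0 gu; apply: right_semi_eq0 Fsemi gu _ _.
  by apply: embed2_unit; rewrite // mul0r subr0 mulf_neq0.
apply/is_trig_mxP => r c rc; rewrite !mxE.
have cr : (c == r) = false by apply: contraTF rc => /eqP ->; rewrite ltnn.
case: (eqVneq c l) => [cl|_]; last case: (eqVneq c l') => [cl'|_]; last by rewrite cr.
  by case: (eqVneq r l) => [rl|_]; [rewrite cl rl eqxx in cr|case: ifP].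
case: (eqVneq r l) => // _; case: (eqVneq r l') => // rl'.
by rewrite cl' rl' eqxx in cr.
Qed.

(** For [l < l'] the left side is a polynomial in [c] of degree at most [lam_l - lam_l' <= 1], with
    constant term [F g]; when the difference is 1, its linear coefficient is the value after the
    swap, up to sign. For [l > l'] the matrix is upper triangular. *)
Lemma hook_transvection (l l' : 'I_n) c g : l != l' -> l != ord0 -> l' != ord0 ->
  g \in unitmx -> F g = 0 -> F (g *m perm_mx (tperm l l')) = 0 ->
  F (g *m embed2 l l' 1 0 c 1) = 0.
Proof.
move=> ll' l0 l'0 gu F0 F1.
have tu : (perm_mx (tperm l l') : 'M[k]_n) \in unitmx by exact: unitmx_perm.
have N1 : (-1 : k) != 0 by rewrite oppr_eq0 oner_eq0.
case: (ltngtP l l') => [lt|lt|/ord_inj eq_l]; last by rewrite eq_l eqxx in ll'.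
  have Fs : F (g *m embed2 l l' 0 (-1) 1 0) = 0.
    have -> : embed2 l l' 0 (-1) 1 0 =
        perm_mx (tperm l l') *m embed2 l l' 1 0 0 (-1 : k).
      by rewrite -embed2_tperm // embed2M //; congr embed2; ring.
    by rewrite mulmxA; apply: embed2_diag_semi; rewrite ?oner_eq0 ?unitmx_mul ?gu.
  have [d d1 dE] : exists2 d : nat, (d <= 1)%N & lam 0 l = lam 0 l' + d%:Z.
    rewrite !lamE //; case: (leqP l' i) => h.
      by exists 0%N; rewrite // (leq_trans (ltnW lt) h) addr0.
    by exists (l <= i)%N; [case: (l <= i)%N|rewrite add0r].
  have [p [q [pE qE pq]]] := right_semi_pair k_infinite Freg Fsemi lt dE gu.
  have p0 : p`_0 = 0.
    by rewrite -horner_coef0 -pE embed2_1 // mulmx1.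
  have q0 : q`_0 = 0 by rewrite -horner_coef0 -qE.
  rewrite pE; suff -> : p = 0 by rewrite horner0.
  apply/polyP => j; rewrite coef0; case: j => [//|j].
  rewrite pq; case: ifP => // jd; rewrite -[RHS]q0; congr (q`_ _).
  by move: jd d1; case: d {dE pq} => [|[|]] //; case: j.
apply: right_semi_eq0 Fsemi gu _ _ F0.
  by apply: embed2_unit; rewrite // mul0r mulr1 subr0 oner_eq0.
apply/is_trig_mxP => r s rs; rewrite !mxE.
case: (eqVneq s l) => [sl|_].
  move: rs; rewrite sl => rl; rewrite ifF; last first.
    by apply: contraTF rl => /eqP ->; rewrite ltnn.
  by case: ifP.
case: (eqVneq s l') => [sl'|_].
  move: rs; rewrite sl' => rl'; rewrite !ifF //; apply: contraTF rl' => /eqP ->.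
    by rewrite ltnn.
  by rewrite -leqNgt ltnW.
by case: eqP rs => // ->; rewrite ltnn.
Qed.

(** Equal entries give [d = 0], so the polynomials of [right_semi_pair] share their constant term,
    and the swap preserves the value of [F] up to sign. *)
Lemma hook_tperm (l l' : 'I_n) g : l != ord0 -> l' != ord0 ->
  (l <= i)%N = (l' <= i)%N -> g \in unitmx -> F g = 0 ->
  F (g *m perm_mx (tperm l l')) = 0.
Proof.
wlog lt : l l' / (l < l')%N => [H|] l0 l'0 ll'i gu F0.
  case: (ltngtP l l') => [lt|lt|/ord_inj ->]; first exact: H.
    by rewrite tpermC; apply: H.
  by rewrite tperm1 perm_mx1 mulmx1.
have ll' : l != l' by apply: contraTneq lt => ->; rewrite ltnn.
have N1 : (-1 : k) != 0 by rewrite oppr_eq0 oner_eq0.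
have dE : lam 0 l = lam 0 l' + 0%N%:Z by rewrite !lamE // ll'i addr0.
have [p [q [pE qE pq]]] := right_semi_pair k_infinite Freg Fsemi lt dE gu.
have -> : perm_mx (tperm l l') =
    embed2 l l' 0 (-1) 1 0 *m embed2 l l' 1 0 0 (-1 : k).
  by rewrite -embed2_tperm // embed2M //; congr embed2; ring.
rewrite mulmxA; apply: embed2_diag_semi; rewrite ?oner_eq0 //.
  rewrite unitmx_mul gu embed2_unit //.
  by rewrite mul0r mulr1 sub0r opprK oner_eq0.
have := pq 0%N; rewrite /= qE horner_coef0 => <-.
by rewrite -horner_coef0 -pE embed2_1 // mulmx1.
Qed.

Lemma hook_perm (s : 'S_n) g : s ord0 = ord0 ->
  (forall l, l != ord0 -> (s l <= i)%N = (l <= i)%N) -> g \in unitmx ->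
  F g = 0 -> F (g *m perm_mx s) = 0.
Proof.
move=> s0 si gu F0.
have [N] := ubnP #|[pred l | s l != l]|; elim: N => // N IH in s s0 si *.
rewrite ltnS => sN.
have [/existsP[l sl]|/existsPn s1] := boolP [exists l, s l != l]; last first.
  have -> : s = 1%g.
    by apply/permP => l; rewrite perm1; apply/eqP; rewrite -[_ == _]negbK s1.
  by rewrite perm_mx1 mulmx1.
have l0 : l != ord0 by apply: contraNneq sl => ->; rewrite s0.
have sl0 : s l != ord0 by rewrite -s0 (inj_eq perm_inj).
pose s' := (s * tperm l (s l))%g.
have s'E x : s' x = tperm l (s l) (s x) by rewrite permM.
have -> : s = (s' * tperm l (s l))%g.
  by rewrite -mulgA tperm2 mulg1.
have bl : (l <= i)%N = (s l <= i)%N by rewrite si.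
rewrite perm_mxM mulmxA; apply: hook_tperm => //.
  by rewrite unitmx_mul gu unitmx_perm.
apply: IH => [|x x0|].
- by rewrite s'E s0 tpermD // eq_sym.
- rewrite s'E -(si x x0); case: tpermP => [->|->|//]; by rewrite bl.
apply: leq_trans sN; apply: proper_card; apply/fintype.properP; split.
  apply/fintype.subsetP => x; rewrite !inE s'E; apply: contra => /eqP sx.
  rewrite sx; case: tpermP => [xl|xsl|//].
    by move: sl; rewrite -xl sx eqxx.
  by move: sl; rewrite -(inj_eq (@perm_inj _ s)) -xsl sx eqxx.
by exists l; rewrite !inE // s'E tpermR eqxx.
Qed.

(** [hook_transvection] needs a zero both at a point and at its column swap; closing under all
    permutations that fix the first column makes the condition hereditary. *)
Definition perm_null g :=
  g \in unitmx /\ forall w : 'S_n, w ord0 = ord0 -> F (g *m perm_mx w) = 0.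

Lemma perm_null_perm (w : 'S_n) g : w ord0 = ord0 -> perm_null g ->
  perm_null (g *m perm_mx w).
Proof.
move=> w0 [gu g0]; split; first by rewrite unitmx_mul gu unitmx_perm.
by move=> v v0; rewrite -mulmxA -perm_mxM g0 // permM w0.
Qed.

(** A permutation moves past a transvection by relabelling its indices to [w l] and [w l']. *)
Lemma perm_null_transvection (l l' : 'I_n) c g :
  l != l' -> l != ord0 -> l' != ord0 ->
  perm_null g -> perm_null (g *m embed2 l l' 1 0 c 1).
Proof.
move=> ll' l0 l'0 [gu g0]; split.
  by rewrite unitmx_mul gu embed2_unit // mul0r mulr1 subr0 oner_eq0.
move=> w w0.
have wll' : w l != w l' by rewrite (inj_eq perm_inj).
have -> : g *m embed2 l l' 1 0 c 1 *m perm_mx w =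
    g *m perm_mx w *m embed2 (w l) (w l') 1 0 c 1.
  have pE (x : 'M[k]_n) r s : (x *m perm_mx w) r s = x r (w^-1 s)%g.
    by rewrite -[w in LHS]invgK -col_permE mxE.
  apply/matrixP => r s; rewrite mul_embed2E // !pE mul_embed2E // !permK.
  have pV x : (w^-1%g s == x) = (s == w x).
    by rewrite -(inj_eq (@perm_inj _ w)) permKV.
  by rewrite !pV.
have w'0 x : x != ord0 -> w x != ord0 by rewrite -{2}w0 (inj_eq perm_inj).
apply: hook_transvection; rewrite ?w'0 ?g0 ?unitmx_mul ?gu ?unitmx_perm //.
by rewrite -mulmxA -perm_mxM g0 // permM w0 tpermD ?w'0.
Qed.

Lemma perm_null_column (c : 'I_n) (y : 'I_n -> k) (rs : seq 'I_n) g : c != ord0 ->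
  c \notin rs -> ord0 \notin rs -> perm_null g ->
  perm_null (g *m (1%:M + \sum_(r <- rs) y r *: delta_mx r c)).
Proof.
move=> c0; elim: rs g => [|r rs IH] g.
  by rewrite big_nil addr0 mulmx1.
rewrite !inE !negb_or => /andP[cr crs] /andP[r0 rs0] gn.
have -> : 1%:M + \sum_(j <- r :: rs) y j *: delta_mx j c =
  embed2 c r 1 0 (y r) 1 *m (1%:M + \sum_(j <- rs) y j *: delta_mx j c).
  have -> : embed2 c r 1 0 (y r) 1 = 1%:M + y r *: delta_mx r c.
    apply/matrixP => a b; rewrite !mxE.
    case: (eqVneq a c) => [->|ac].
      rewrite (negbTE cr) /= mulr0 addr0 eq_sym.
      by case: (eqVneq b c) => // _; case: ifP.
    case: (eqVneq a r) => [->|ar] /=; last by rewrite mulr0 addr0.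
    case: (eqVneq b c) => [->|bc]; first by rewrite eq_sym (negbTE cr) mulr1 add0r.
    by rewrite mulr0 addr0 eq_sym; case: ifP.
  rewrite big_cons mulmxDl mul1mx mulmxDr mulmx1 mulmx_sumr.
  rewrite [X in _ = _ + (_ + X)]big1_seq ?addr0 => [|j /andP[_ jrs]].
    by rewrite -addrA [in RHS](addrC (\sum_(_ <- _) _)).
  rewrite -scalemxAr -scalemxAl mul_delta_mx_cond.
  by case: eqP jrs crs => [->->|_ _ _] //; rewrite mulr0n !scaler0.
rewrite mulmxA; apply: IH => //; apply: perm_null_transvection => //.
by rewrite eq_sym.
Qed.

(** A lower unitriangular matrix is a product of matrices that differ from the identity in one
    column; [X q] keeps the columns of [L] from [q] on. *)
Lemma perm_null_lower (L : 'M[k]_n) g :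
  (forall r c : 'I_n, (r <= c)%N -> L r c = (r == c)%:R) ->
  (forall r, L r ord0 = (r == ord0)%:R) ->
  perm_null g -> perm_null (g *m L).
Proof.
move=> Llow L0.
pose X q : 'M[k]_n := \matrix_(r, c) if (q <= c)%N then L r c else (r == c)%:R.
suff H d q : (q + d = n)%N -> (0 < q)%N -> forall g, perm_null g -> perm_null (g *m X q).
  move=> gn; have -> : L = X 1%N.
    by apply/matrixP => r c; rewrite mxE lt0n; case: eqP => // c0;
       rewrite (_ : c = ord0) ?L0 //; apply: val_inj.
  by apply: (H m) => //; rewrite add1n.
elim: d q => [|d IH] q qd q0 h hn.
  have -> : X q = 1%:M; last by rewrite mulmx1.
  by apply/matrixP => r c; rewrite !mxE leqNgt (leq_trans (ltn_ord c)) // -qd addn0.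
have qn : (q < n)%N by rewrite -qd addnS ltnS leq_addr.
pose c := Ordinal qn.
pose rs := [seq r : 'I_n <- enum 'I_n | (q < r)%N].
(* Row [c] of [X q.+1] is that of the identity, so the left factor adds column [q] and nothing
   else. *)
have -> : X q = (1%:M + \sum_(r <- rs) L r c *: delta_mx r c) *m X q.+1.
  apply/matrixP => r s; rewrite mulmxDl mul1mx mulmx_suml [RHS]mxE summxE.
  have E x : (L x c *: delta_mx x c *m X q.+1) r s =
             (if r == x then L x c * (c == s)%:R else 0).
    rewrite -scalemxAl mxE mxE (bigD1 c) //= big1 => [|y yc]; last first.
      by rewrite mxE (negbTE yc) andbF mul0r.
    rewrite addr0 !mxE eqxx andbT; case: (eqVneq r x) => _; last by rewrite mul0r mulr0.
    rewrite mul1r; congr (_ * _); case: ifP => // qs.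
    by rewrite Llow // ltnW.
  rewrite (eq_bigr _ (fun x _ => E x)) /rs big_filter big_enum_cond /= -big_mkcondr /=.
  rewrite !mxE; case: (eqVneq c s) => [<-|cs].
    rewrite /= leqnn ltnn; case: (ltnP q r) => qr.
      rewrite (big_pred1 r) => [|x]; last first.
        by rewrite /= (eq_sym r x); case: (eqVneq x r) => [->|_]; rewrite ?qr ?andbF.
      rewrite mulr1 -[LHS]add0r; congr (_ + _).
      by case: eqP qr => // ->; rewrite ltnn.
    rewrite big_pred0 ?addr0 ?Llow // => x.
    by case: (eqVneq r x) => [<-|_]; rewrite ?andbF // ltnNge qr.
  rewrite big1 ?addr0; last by move=> *; rewrite mulr0.
  case: (ltngtP q s) => // qs; first by case/eqP: cs; apply: val_inj.
rewrite mulmxA; apply: IH => //; first by rewrite addSnnS.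
apply: perm_null_column => //.
- by apply: contraTneq q0 => /(congr1 val) /= ->.
- by rewrite mem_filter /= ltnn.
- by rewrite mem_filter.
Qed.

End Hook.
End Vanishing.

(** * Semi-invariants are determined by their values at the hook points *)

Section Expansion.
Variable k : fieldType.
Hypothesis k_infinite : infinite_set [set: k].
Variable m : nat.
Local Notation n := m.+1.
Implicit Types (F : 'M[k]_n -> k) (g b t : 'M[k]_n) (lam mu : 'rV[int]_n) (w v : 'S_n).

Definition hook_point w : 'M[k]_n :=
  \matrix_(r, l) if l == ord0 then 1 else (r == w l)%:R.

Lemma hook_point_lmul s w : perm_mx s *m hook_point w = hook_point (w * s^-1)%g.
Proof.
rewrite -row_permE; apply/matrixP => r l; rewrite !mxE; case: ifP => // _.
by rewrite permM -(inj_eq (@perm_inj _ s^-1%g)) permK.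
Qed.

Lemma hook_point_rmul (s w : 'S_n) : s ord0 = ord0 ->
  hook_point w *m perm_mx s = hook_point (s^-1 * w)%g.
Proof.
move=> s0; rewrite -[s in LHS]invgK -col_permE; apply/matrixP => r l.
rewrite !mxE permM; congr (if _ then _ else _).
by rewrite -(inj_eq (@perm_inj _ s)) permKV s0.
Qed.

Lemma hook_point1 : hook_point 1 = block_mx 1%:M 0 (const_mx 1) 1%:M :> 'M_(1 + m).
Proof.
apply/matrixP => r l; rewrite [RHS]mxE [LHS]mxE perm1.
case: (splitP r) => r' rE; rewrite [RHS]mxE; case: (splitP l) => l' lE;
  rewrite [RHS]mxE.
- by rewrite ifT ?ord1 ?eqxx //; apply/eqP/val_inj; rewrite /= lE ord1.
- rewrite ifF; last by apply/eqP => /(congr1 val) /=; rewrite lE.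
  by rewrite -val_eqE /= rE lE ord1.
- by rewrite ifT //; apply/eqP/val_inj; rewrite /= lE ord1.
- rewrite ifF; last by apply/eqP => /(congr1 val) /=; rewrite lE.
  by rewrite -!val_eqE /= rE lE eqn_add2l.
Qed.

Lemma lift0E (A : 'M[k]_m) : lift0_mx A = block_mx 1%:M 0 0 A.
Proof. by []. Qed.

Lemma det_hook_point1 : \det (hook_point 1) = 1.
Proof. by rewrite hook_point1 (@det_lblock _ 1 m) !det1 mulr1. Qed.

Lemma hook_point_unit w : hook_point w \in unitmx.
Proof.
have -> : hook_point w = perm_mx w^-1 *m hook_point 1.
  by rewrite hook_point_lmul mul1g invgK.
by rewrite unitmx_mul unitmx_perm unitmxE det_hook_point1 unitr1.
Qed.

Lemma lup_unit q (h : 'M[k]_q) : h \in unitmx ->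
  exists (s : 'S_q) (L U : 'M[k]_q), [/\ h = perm_mx s *m L *m U,
    forall r c : 'I_q, (r <= c)%N -> L r c = (r == c)%:R,
    U \in unitmx & is_trig_mx U^T].
Proof.
case: q h => [|q] h hu.
  exists 1%g, 1%:M, 1%:M; rewrite unitmx1 trmx1; split=> //.
  - by rewrite [h]flatmx0 [RHS]flatmx0.
  - by case.
have /is_perm_mxP[s sE] := cormen_lup_perm h.
have := cormen_lup_correct h; have dL := cormen_lup_detL h.
have Ll := @cormen_lup_lower _ _ h; have Uu := @cormen_lup_upper _ _ h.
move: sE dL Ll Uu; case: (cormen_lup h) => [[P L] U] /= -> dL Ll Uu E.
have hE : h = perm_mx s^-1 *m L *m U.
  by rewrite -mulmxA -[L *m U]E -mulmxE mulmxA -perm_mxM mulVg perm_mx1 mul1mx.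
exists s^-1%g, L, U; split=> //.
  by move: hu; rewrite hE !unitmx_mul => /andP[].
by apply/is_trig_mxP => r c rc; rewrite mxE Uu.
Qed.

Section Hook.
Variables (i : nat) (lam : 'rV[int]_n).
Hypothesis lamE : hook_like i lam.

(** By density the first column has no zero. Dividing each row by its first entry is a left diagonal
    factor, and clearing the first row is a right unitriangular factor [V]. What remains is
    [hook_point 1] times a block [h], whose LUP factors are a column permutation, a lower
    unitriangular matrix and an upper triangular one. *)
Lemma vanish_base mu F : regmx F -> right_semi lam F -> left_semi mu F ->
  (forall w, w ord0 = ord0 -> F (hook_point w) = 0) ->
  forall g, g \in unitmx -> F g = 0.
Proof.
move=> Freg Fsemi Fleft F0; apply: regmx_dense => // g gu g0.
pose d : 'rV[k]_n := \row_r g r ord0.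
pose g' : 'M[k]_n := \matrix_(r, c) (g r c / g r ord0).
have gE : g = diag_mx d *m g'.
  by apply/matrixP => r c; rewrite mul_diag_mx !mxE mulrC divfK.
move: gu; rewrite gE unitmx_mul => /andP[du g'u].
rewrite Fleft ?diag_mx_is_diag //; suff -> : F g' = 0 by rewrite mulr0.
have nullG : perm_null F (hook_point 1).
  split=> [|w w0]; first exact: hook_point_unit.
  rewrite hook_point_rmul // F0 // permM perm1.
  by apply: (@perm_inj _ w); rewrite permKV w0.
pose a : 'rV[k]_m := @ursubmx _ 1 m 1 m g'.
pose h : 'M[k]_m := @drsubmx _ 1 m 1 m g' - const_mx 1 *m a.
pose V : 'M[k]_(1 + m) := block_mx 1%:M a 0 1%:M.
have e1 : @ulsubmx _ 1 m 1 m g' = 1%:M.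
  by apply/matrixP => r c; rewrite !ord1 !mxE /= lshift0 divff.
have e2 : @dlsubmx _ 1 m 1 m g' = const_mx 1.
  by apply/matrixP => r c; rewrite !ord1 !mxE /= lshift0 divff.
have g'E : g' = hook_point 1 *m lift0_mx h *m V.
  rewrite hook_point1 lift0E !(@mulmx_block _ 1 m 1 m 1 m).
  rewrite !mul1mx !mulmx1 !mulmx0 !mul0mx !addr0 !add0r.
  rewrite [const_mx 1 *m a + _]addrC subrK -[LHS](@submxK _ 1 m 1 m) e1 e2.
  by rewrite -/a mul1mx.
have Vu : V \in unitmx by rewrite unitmxE (@det_ublock _ 1 m) !det1 mulr1 unitr1.
have hu : h \in unitmx.
  move: g'u; rewrite g'E !unitmx_mul => /andP[/andP[_]].
  by rewrite unitmxE lift0E (@det_lblock _ 1 m) det1 mul1r -unitmxE.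
rewrite g'E; apply: (right_semi_eq0 Fsemi _ Vu).
- by rewrite unitmx_mul hook_point_unit unitmxE lift0E (@det_lblock _ 1 m) det1 mul1r -unitmxE.
- rewrite /V (@tr_block_mx _ 1 m 1 m) (@is_trig_block_mx _ 1 m 1 m) // trmx0 eqxx /= !trmx1.
  by rewrite !scalar_mx_is_trig /=.
have [s [L [U [hE Ll Uu Ut]]]] := lup_unit hu.
have -> : lift0_mx h = perm_mx (lift0_perm s) *m lift0_mx L *m lift0_mx U.
  rewrite -lift0_mx_perm !lift0E !(@mulmx_block _ 1 m 1 m 1 m) !mul1mx !mulmx0 !mul0mx.
  by rewrite ?addr0 ?add0r ?mul1mx ?mulmx0 ?mul0mx ?addr0 ?add0r hE.
have nL : perm_null F (hook_point 1 *m perm_mx (lift0_perm s) *m lift0_mx L).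
  apply: (perm_null_lower k_infinite lamE Freg Fsemi).
  - move=> r c rc; rewrite lift0E mxE; move: rc.
    case: (@splitP 1 m r) => r' rE; rewrite mxE;
      case: (@splitP 1 m c) => c' cE; rewrite ?mxE => rc.
    + by rewrite !ord1 eqxx -val_eqE /= rE cE !ord1.
    + by rewrite -val_eqE /= rE cE ord1.
    + by move: rc; rewrite rE cE ord1.
    + by rewrite Ll -?val_eqE /= ?rE ?cE ?eqn_add2l // -(leq_add2l 1) -rE -cE.
  - move=> r; rewrite lift0E mxE; case: (@splitP 1 m r) => r' rE; rewrite mxE.
      case: (@splitP 1 m ord0) => c' cE; last by [].
      by rewrite !ord1 mxE eqxx -val_eqE /= rE ord1.
    case: (@splitP 1 m ord0) => c' cE; last by [].
    by rewrite mxE -val_eqE /= rE.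
  - by apply: perm_null_perm => //; rewrite lift0_perm0.
case: nL => nLu nL0; rewrite !mulmxA; apply: (right_semi_eq0 Fsemi nLu).
- by rewrite unitmxE lift0E (@det_lblock _ 1 m) det1 mul1r -unitmxE.
- rewrite lift0E (@tr_block_mx _ 1 m 1 m) (@is_trig_block_mx _ 1 m 1 m) // !trmx0 eqxx Ut.
  by rewrite trmx1 scalar_mx_is_trig /=.
- by have := nL0 1%g; rewrite perm1 perm_mx1 mulmx1; apply.
Qed.

(** Left translation by the transposition of [ord0] and [r0] reduces to [vanish_base], with [mu]
    permuted accordingly. The row missed by the unit columns can thus be chosen to suit [mu]. *)
Lemma vanish mu F (r0 : 'I_n) : regmx F -> right_semi lam F -> left_semi mu F ->
  (forall w, w ord0 = r0 -> F (hook_point w) = 0) ->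
  forall g, g \in unitmx -> F g = 0.
Proof.
move=> Freg Fsemi Fleft F0; pose s := tperm ord0 r0.
have su : (perm_mx s : 'M[k]_n) \in unitmx by exact: unitmx_perm.
have ss : perm_mx s *m perm_mx s = 1%:M :> 'M[k]_n.
  by rewrite -perm_mxM tperm2 perm_mx1.
move=> g gu; rewrite -[g]mul1mx -ss -mulmxA.
have guu : perm_mx s *m g \in unitmx by rewrite unitmx_mul su.
move: (perm_mx s *m g) guu => {gu}.
apply: (@vanish_base (\row_r mu 0 (s r)) (fun g => F (perm_mx s *m g))).
- exact: regmx_lmul.
- by move=> h b hu bu bt; rewrite mulmxA Fsemi // unitmx_mul su.
- move=> t h tu /is_diag_mxP td hu.
  have -> : perm_mx s *m (t *m h) = perm_mx s *m t *m perm_mx s *m (perm_mx s *m h).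
    by rewrite -!mulmxA; congr (_ *m (_ *m _)); rewrite mulmxA ss mul1mx.
  have tE r c : (perm_mx s *m t *m perm_mx s) r c = t (s r) (s c).
    rewrite -row_permE; have -> : perm_mx s = perm_mx s^-1 :> 'M[k]_n by rewrite tpermV.
    by rewrite -col_permE !mxE.
  rewrite Fleft ?unitmx_mul ?su ?tu //.
    congr (_ * _); rewrite /tchar [RHS](reindex_inj (@perm_inj _ s)) /=.
    by apply: eq_bigr => r _; rewrite mxE tE tpermK.
  by apply/is_diag_mxP => r c rc; rewrite tE td // val_eqE (inj_eq perm_inj).
- by move=> w w0; rewrite hook_point_lmul F0 // permM w0 tpermV tpermL.
Qed.

End Hook.
End Expansion.

(** * Constraints on the left weight of a semi-invariant *)

Section HookFunctions.
Variable k : fieldType.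
Hypothesis k_infinite : infinite_set [set: k].
Variable m : nat.
Local Notation n := m.+1.
Implicit Types (F : 'M[k]_n -> k) (g b t : 'M[k]_n) (lam mu : 'rV[int]_n) (w v : 'S_n).

Definition generic_mx : 'M[{mpoly k[n * n]}]_n :=
  \matrix_(i, j) 'X_(mxvec_index i j).

Lemma meval_generic_mx g i j : (generic_mx i j).@[mxvec g 0] = g i j.
Proof. by rewrite mxE mevalXU mxvecE. Qed.

Lemma meval_det_generic q (f f' : 'I_q -> 'I_n) g :
  (\det (\matrix_(i, j) generic_mx (f i) (f' j))).@[mxvec g 0] =
  \det (\matrix_(i, j) g (f i) (f' j)).
Proof.
rewrite -det_map_mx; congr (\det _); apply/matrixP => i j.
by rewrite [RHS]mxE -meval_generic_mx [LHS]mxE; congr meval; rewrite mxE.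
Qed.

Lemma regmx_lin (a : k) F H : regmx F -> regmx H -> regmx (fun g => a * F g + H g).
Proof.
move=> [P [N PN]] [Q [M QM]].
pose D : {mpoly k[n * n]} := \det (\matrix_(i, j) generic_mx i j).
have DE g : D.@[mxvec g 0] = \det g.
  by rewrite (meval_det_generic id id); congr (\det _); apply/matrixP => i j; rewrite mxE.
exists (a *: (P * D ^+ M) + Q * D ^+ N), (N + M)%N => g gu.
have d0 : \det g != 0 by rewrite -unitfE -unitmxE.
rewrite mevalD mevalZ !mevalM !rmorphXn /= !DE PN // QM // exprD.
by field; rewrite !expf_neq0.
Qed.

Lemma regmx0 : regmx (fun _ : 'M[k]_n => 0).
Proof. by exists 0, 0%N => g _; rewrite meval0 mul0r. Qed.

Lemma regmx_sum (I : Type) (r : seq I) (P : pred I) (c : I -> k) (f : I -> 'M[k]_n -> k) :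
  (forall j, P j -> regmx (f j)) -> regmx (fun g => \sum_(j <- r | P j) c j * f j g).
Proof.
move=> fr; elim: r => [|j r IH].
  by rewrite (_ : (fun _ => _) = fun=> 0); [exact: regmx0|apply/funext => g; rewrite big_nil].
have [Pj|Pj] := boolP (P j); last first.
  by rewrite (_ : (fun _ => _) = fun g => \sum_(j <- r | P j) c j * f j g) //;
    apply/funext => g; rewrite big_cons (negbTE Pj).
rewrite (_ : (fun _ => _) = fun g => c j * f j g + \sum_(j <- r | P j) c j * f j g).
  by apply: regmx_lin IH; exact: fr.
by apply/funext => g; rewrite big_cons Pj.
Qed.

Definition diag1 (s : 'I_n) (z : k) : 'M[k]_n :=
  diag_mx (\row_r if r == s then z else 1).

Lemma tchar_diag1 mu s z : tchar mu (diag1 s z) = z ^ mu 0 s.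
Proof.
rewrite /tchar (bigD1 s) //= big1 ?mulr1 => [|r rs].
  by rewrite !mxE !eqxx mulr1n.
by rewrite !mxE !eqxx (negbTE rs) mulr1n exp1rz.
Qed.

Lemma det_diag1 s z : \det (diag1 s z) = z.
Proof.
rewrite det_diag (bigD1 s) //= big1 ?mulr1 => [|r rs]; first by rewrite mxE eqxx.
by rewrite mxE (negbTE rs).
Qed.

Lemma diag1_unit s z : z != 0 -> diag1 s z \in unitmx.
Proof. by move=> z0; rewrite unitmxE det_diag1 unitfE. Qed.

Variables (i : nat) (lam : 'rV[int]_n).
Hypothesis lamE : hook_like i lam.

(** Scaling row [w l] by [z] and column [l] by [z^-1] changes a single entry of the point, in the
    first column, to [z]. The curve extends over [z = 0] with constant determinant, while [F] gets
    multiplied by the negative power [z ^ (mu_(w l) - lam_l)]. *)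
Lemma weight_bound mu F w (l : 'I_n) : regmx F -> right_semi lam F ->
  left_semi mu F -> l != ord0 -> mu 0 (w l) < lam 0 l -> F (hook_point k w) = 0.
Proof.
move=> Freg Fsemi Fleft l0 lt.
pose C : 'M[{poly k}]_n := \matrix_(r, c)
  if c == ord0 then if r == w l then 'X else 1 else (r == w c)%:R.
have CE z : z != 0 -> evalmx C z = diag1 (w l) z *m hook_point k w *m diag1 l z^-1.
  move=> z0; apply/matrixP => r c; rewrite evalmxE mul_mx_diag mul_diag_mx !mxE.
  case: (eqVneq c ord0) => [->|c0].
    rewrite (eq_sym ord0 l) (negbTE l0) !mulr1; case: ifP => _; first by rewrite hornerX.
    by rewrite hornerC.
  rewrite hornerMn hornerC; case: (eqVneq c l) => [->|cl].
    by case: (eqVneq r (w l)) => _; rewrite ?mulr1 ?mulr0 ?mul0r ?mulfV.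
  case: (eqVneq r (w l)) => [->|_]; last by rewrite mul1r mulr1.
  by rewrite (inj_eq perm_inj) (eq_sym l c) (negbTE cl) mulr0 mul0r.
have [p [N pN]] := regmx_curve C Freg.
have dC z : z != 0 -> \det (evalmx C z) = \det (hook_point k w).
  by move=> z0; rewrite CE // !det_mulmx !det_diag1 mulrAC mulfV // mul1r.
have du := hook_point_unit k w; have d0 : \det (hook_point k w) != 0.
  by rewrite -unitfE -unitmxE.
suff /eqP : F (hook_point k w) * \det (hook_point k w) ^+ N = 0.
  by rewrite mulf_eq0 (negbTE (expf_neq0 _ d0)) orbF => /eqP.
apply: (@expz_neg_horner _ k_infinite _ (mu 0 (w l) - lam 0 l) p).
  by rewrite Num.Theory.subr_lt0.
move=> z z0; have Cu : evalmx C z \in unitmx by rewrite unitmxE dC // -unitmxE.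
have := pN z Cu; rewrite -det_evalmx dC // => E.
have <- : F (evalmx C z) * \det (hook_point k w) ^+ N = p.[z].
  by rewrite E divfK // expf_neq0.
have bt : is_trig_mx (diag1 l z^-1)^T by rewrite tr_diag_mx diag_mx_is_trig.
rewrite CE // Fsemi ?unitmx_mul ?diag1_unit ?invr_neq0 //.
rewrite Fleft ?diag1_unit ?diag_mx_is_diag // !tchar_diag1 exprz_inv expfzDr //.
by rewrite !mulrA (mulrC (z ^ mu 0 (w l))).
Qed.

(** A scalar matrix acts alike on the left and on the right, so the two total degrees must agree. *)
Lemma weight_sum mu F g : regmx F -> right_semi lam F -> left_semi mu F ->
  \sum_r mu 0 r != \sum_r lam 0 r -> g \in unitmx -> F g = 0.
Proof.
move=> Freg Fsemi Fleft ne gu.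
have [|z z0 zne] := @expz_neq1 _ k_infinite (\sum_r mu 0 r - \sum_r lam 0 r).
  by rewrite subr_eq0.
have zu : (z%:M : 'M[k]_n) \in unitmx by rewrite unitmxE det_scalar unitfE expf_neq0.
have tz (nu : 'rV[int]_n) : tchar nu z%:M = z ^ (\sum_r nu 0 r).
  rewrite /tchar (eq_bigr (fun r => z ^ nu 0 r)); last first.
    by move=> r _; rewrite mxE eqxx mulr1n.
  by elim/big_rec2: _ => [|r y1 y2 _ ->]; rewrite ?expr0z // expfzDr.
have : F (z%:M *m g) = F (g *m z%:M) by rewrite -scalar_mxC.
rewrite Fleft ?scalar_mx_is_diag // Fsemi // ?tr_scalar_mx ?scalar_mx_is_trig //.
rewrite !tz => /eqP; rewrite -subr_eq0 -mulrBl mulf_eq0 => /orP[|/eqP //].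
rewrite subr_eq0 => /eqP E; move: zne.
by rewrite expfzDr // E -expfzDr // subrr expr0z eqxx.
Qed.

(** For [r0 != s], every point with [w ord0 = r0] has [s = w l] with [l != ord0], and [weight_bound]
    applies since [lam_l >= 0 > mu_s]. *)
Lemma weight_ge0 mu F (s : 'I_n) g : regmx F -> right_semi lam F ->
  left_semi mu F -> 0 <= lam 0 ord0 -> mu 0 s < 0 -> g \in unitmx -> F g = 0.
Proof.
move=> Freg Fsemi Fleft lam0 mus gu.
have [E|ne] := eqVneq (\sum_r mu 0 r) (\sum_r lam 0 r); last exact: weight_sum ne gu.
have lam_ge0 l : 0 <= lam 0 l.
  by have [->//|/lamE ->] := eqVneq l ord0; case: (l <= i)%N.
(* Otherwise [mu_s] would be the whole total degree, which is nonnegative. *)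
have [r0 r0s] : exists r0, r0 != s.
  apply: contrapT => /forallNP H.
  move: mus; have -> : mu 0 s = \sum_r mu 0 r.
    rewrite (bigD1 s) //= big1 ?addr0 // => r rs.
    by have := H r; rewrite rs.
  rewrite E; have : 0 <= \sum_r lam 0 r by apply: Num.Theory.sumr_ge0.
  lia.
apply: (vanish k_infinite lamE (r0 := r0) Freg Fsemi Fleft) => // w w0.
have wls : w (w^-1 s)%g = s by rewrite permKV.
apply: (weight_bound (l := (w^-1 s)%g) Freg Fsemi Fleft).
  by apply: contraNneq r0s => s0; rewrite -w0 -s0 permKV.
by rewrite wls; have := lam_ge0 (w^-1 s)%g; lia.
Qed.

End HookFunctions.

(** * The basis of semi-invariants built from minors *)

Section HookExpansion.
Variable k : fieldType.
Hypothesis k_infinite : infinite_set [set: k].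
Variables (m i : nat).
Local Notation n := m.+1.
Hypothesis i_lt : (i.+1 <= n)%N.
Implicit Types (F : 'M[k]_n -> k) (g b t : 'M[k]_n) (mu : 'rV[int]_n) (w v : 'S_n).
Local Notation wd := (widen_ord i_lt).

Lemma head_set_sum (f : 'I_n -> nat) w :
  (\sum_(a < i.+1) f (w (wd a)) = \sum_r (w^-1%g r <= i)%N * f r)%N.
Proof.
rewrite [RHS](reindex_inj (@perm_inj _ w)) /=.
rewrite -(big_ord_narrow (F := fun r => f (w r)) i_lt) big_mkcond.
by apply: eq_bigr => r _; rewrite permK ltnS; case: (r <= i)%N; rewrite ?mul1n.
Qed.

Lemma head_set_prod (f : 'I_n -> k) w :
  \prod_(a < i.+1) f (w (wd a)) = \prod_r f r ^+ (w^-1%g r <= i)%N.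
Proof.
rewrite [RHS](reindex_inj (@perm_inj _ w)) /=.
rewrite -(big_ord_narrow (F := fun r => f (w r)) i_lt) big_mkcond.
by apply: eq_bigr => r _; rewrite permK ltnS; case: (r <= i)%N.
Qed.

Definition hook_minor w g : k :=
  \det (\matrix_(a < i.+1, b < i.+1) g (w (wd a)) (wd b)).

(** The minor already supplies one unit of weight in each of its rows, hence the subtraction in the
    exponent; [admissible] keeps it from being truncated. *)
Definition hook_fun (c : 'I_n -> nat) w g : k :=
  (\prod_r g r ord0 ^+ (c r - (w^-1%g r <= i))) * hook_minor w g.

Lemma wd_eq0 (a : 'I_i.+1) : (wd a == ord0) = (a == ord0).
Proof. by rewrite -!val_eqE. Qed.

Lemma hook_fun_point c w v : hook_fun c w (hook_point k v) = hook_minor w (hook_point k v).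
Proof. by rewrite /hook_fun big1 ?mul1r // => r _; rewrite mxE eqxx expr1n. Qed.

(** Within the first [i + 1] columns, rows [w l] and [v ord0] of the point both have their only 1 in
    the first column, so two rows of the minor coincide. *)
Lemma hook_minor_point_eq0 w v (l : 'I_n) : w ord0 = v ord0 -> (l <= i)%N ->
  ~~ (v^-1%g (w l) <= i)%N -> hook_minor w (hook_point k v) = 0.
Proof.
move=> wv0 li vl.
have li' : (l < i.+1)%N by rewrite ltnS.
have wdl : wd (Ordinal li') = l by apply: val_inj.
have l0 : Ordinal li' != ord0.
  apply: contraNneq vl => l0.
  by rewrite -wdl l0 (_ : wd ord0 = ord0) ?wv0 ?permK //; apply: val_inj.
apply: (determinant_alternate l0) => b; rewrite !mxE wd_eq0; case: ifPn => // b0.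
rewrite wdl (_ : wd ord0 = ord0); last exact: val_inj.
rewrite wv0 (inj_eq perm_inj) [ord0 == _]eq_sym wd_eq0 (negbTE b0).
case: eqP vl => // ->; rewrite permK /=.
by rewrite -ltnS ltn_ord.
Qed.

Lemma hook_minor_point1 w : hook_minor w (hook_point k w) = 1.
Proof.
rewrite /hook_minor det_trig; last first.
  apply/is_trig_mxP => a b ab; rewrite !mxE wd_eq0 ifF; last first.
    by apply: contraTF ab => /eqP ->.
  rewrite (inj_eq perm_inj) -val_eqE /=.
  by case: eqP ab => // ->; rewrite ltnn.
by rewrite big1 // => a _; rewrite !mxE eqxx; case: ifP.
Qed.

Lemma hook_fun_reg c w : regmx (hook_fun c w).
Proof.
exists ((\prod_r generic_mx k m r ord0 ^+ (c r - (w^-1%g r <= i))) *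
   \det (\matrix_(a < i.+1, b < i.+1) generic_mx k m (w (wd a)) (wd b))), 0%N => g _.
rewrite expr0 divr1 mevalM (meval_det_generic (w \o wd) wd) rmorph_prod /=.
congr (_ * _); apply: eq_bigr => r _.
by rewrite rmorphXn /= meval_generic_mx.
Qed.

Definition admissible (c : 'I_n -> nat) w := forall l : 'I_n, (l <= i)%N -> (0 < c (w l))%N.

Lemma hook_fun_left mu (c : 'I_n -> nat) w : (forall r, mu 0 r = (c r)%:Z) ->
  admissible c w -> left_semi mu (hook_fun c w).
Proof.
move=> muE adm t g tu /is_diag_mxP td gu.
have tg r s : (t *m g) r s = t r r * g r s.
  by rewrite mxE (bigD1 r) //= big1 ?addr0 // => x xr; rewrite td ?mul0r // val_eqE eq_sym.
have minE : hook_minor w (t *m g) =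
    (\prod_(a < i.+1) t (w (wd a)) (w (wd a))) * hook_minor w g.
  rewrite /hook_minor.
  have -> : \matrix_(a < i.+1, b < i.+1) (t *m g) (w (wd a)) (wd b) =
     diag_mx (\row_a t (w (wd a)) (w (wd a))) *m \matrix_(a, b) g (w (wd a)) (wd b).
    by apply/matrixP => a b; rewrite mul_diag_mx [LHS]mxE tg !mxE.
  by rewrite det_mulmx det_diag; congr (_ * _); apply: eq_bigr => a _; rewrite mxE.
rewrite /hook_fun minE (head_set_prod (fun r => t r r)) !mulrA; congr (_ * _).
rewrite /tchar -!big_split /=; apply: eq_bigr => r _ /=.
rewrite tg exprMn muE -exprnP mulrAC -exprD subnK //.
by case h: (w^-1%g r <= i)%N => //; have := adm _ h; rewrite permKV.
Qed.

Definition wsupport mu : {set 'I_n} := [set r | mu 0 r != 0]%SET.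

Definition hook_index mu (r0 : 'I_n) : pred {set 'I_n} :=
  [pred T : {set 'I_n} | [&& r0 \in T, T \subset wsupport mu & #|T| == i.+1]].

(** The default [1] is not reached when [r0 \in T] and [#|T| = i.+1]. The same ordering of [T]
    serves points and minors, so that they pair to exactly 0 or 1. *)
Definition enum_perm (r0 : 'I_n) (T : {set 'I_n}) : 'S_n :=
  odflt 1%g [pick w : 'S_n | (w ord0 == r0) && [forall l, (w l \in T) == (l <= i)%N]].

Lemma enum_permP r0 (T : {set 'I_n}) : r0 \in T -> #|T| = i.+1 ->
  enum_perm r0 T ord0 = r0 /\ forall l, (enum_perm r0 T l \in T) = (l <= i)%N.
Proof.
move=> r0T Ti; rewrite /enum_perm; case: pickP => [w /andP[/eqP w0 /forallP wT]|none].
  by split=> // l; apply/eqP.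
pose s := r0 :: enum (T :\ r0) ++ enum (~: T).
have sT1 : size (enum (T :\ r0)) = i.
  by rewrite -cardE; have := cardsD1 r0 T; rewrite r0T Ti => -[].
have ssz : size s = n.
  rewrite /= size_cat sT1 -cardE -addSn -Ti cardsC card_ord //.
have us : uniq s.
  rewrite /= mem_cat !mem_enum !inE eqxx r0T /= cat_uniq !enum_uniq andbT /=.
  by apply/hasPn => x; rewrite !mem_enum !inE => /negbTE ->; rewrite andbF.
pose f (l : 'I_n) := nth r0 s l.
have finj : injective f.
  move=> l l' /eqP; rewrite /f nth_uniq ?ssz ?ltn_ord // => /eqP; exact: val_inj.
have := none (perm finj); rewrite permE /= eqxx /= => /negbT/forallPn[l].
rewrite permE /f; case: l => [[|l] lt] /=; first by rewrite r0T.
rewrite nth_cat sT1; case: ltnP => li.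
  have : nth r0 (enum (T :\ r0)) l \in enum (T :\ r0) by rewrite mem_nth ?sT1.
  by rewrite mem_enum inE => /andP[_ ->].
have : nth r0 (enum (~: T)) (l - i) \in enum (~: T).
  by rewrite mem_nth // -(ltn_add2l i) subnKC //; move: ssz; rewrite /= size_cat sT1; lia.
by rewrite mem_enum inE => /negbTE ->.
Qed.

Lemma hook_minor_enum r0 (T T' : {set 'I_n}) :
  r0 \in T -> #|T| = i.+1 -> r0 \in T' -> #|T'| = i.+1 ->
  hook_minor (enum_perm r0 T) (hook_point k (enum_perm r0 T')) = (T == T')%:R.
Proof.
move=> rT Tc rT' Tc'; have [e0 eT] := enum_permP rT Tc.
have [e0' eT'] := enum_permP rT' Tc'.
case: eqVneq => [->|TT']; first exact: hook_minor_point1.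
have [x xT xT'] : exists2 x, x \in T & x \notin T'.
  apply/subsetPn; apply: contra TT' => sT.
  by rewrite eqEcard sT Tc Tc' /=.
apply: (hook_minor_point_eq0 (l := ((enum_perm r0 T)^-1)%g x)).
- by rewrite e0 e0'.
- by rewrite -eT permKV.
- by rewrite permKV -eT' permKV.
Qed.

Variables (q : nat) (lam : 'rV[int]_n).
Hypotheses (lamE : hook_like i lam) (lam0 : lam 0 ord0 = q.+1%:Z).

(** The monomial has degree [q] in the first column, and the minor contributes one diagonal entry of
    [b] for each of the first [i + 1] columns: in all the weight [(q + 1, 1^i)]. *)
Lemma hook_fun_semi (c : 'I_n -> nat) w : (\sum_r c r = q.+1 + i)%N ->
  admissible c w -> right_semi lam (hook_fun c w).
Proof.
move=> csum adm g b gu bu /is_trig_mxP bt.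
have b0 (r c' : 'I_n) : (c' < r)%N -> b r c' = 0 by move=> h; have := bt _ _ h; rewrite mxE.
have gb0 r : (g *m b) r ord0 = g r ord0 * b ord0 ord0.
  rewrite mxE (bigD1 ord0) //= big1 ?addr0 // => x x0.
  by rewrite b0 ?mulr0 // lt0n; exact: x0.
have minE : hook_minor w (g *m b) = hook_minor w g * \prod_(a < i.+1) b (wd a) (wd a).
  rewrite /hook_minor.
  have -> : \matrix_(a < i.+1, a' < i.+1) (g *m b) (w (wd a)) (wd a') =
     (\matrix_(a, a') g (w (wd a)) (wd a')) *m (\matrix_(a, a') b (wd a) (wd a')).
    apply/matrixP => a a'; rewrite !mxE (bigID (fun r : 'I_n => (r < i.+1)%N)) /=.
    rewrite [X in _ + X]big1 ?addr0 => [|r]; last first.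
      by rewrite -leqNgt => h; rewrite b0 ?mulr0 //=; apply: leq_trans h.
    rewrite (big_ord_narrow (F := fun r => g (w (wd a)) r * b r (wd a')) i_lt).
    by apply: eq_bigr => r _; rewrite !mxE.
  rewrite det_mulmx; congr (_ * _); rewrite -det_tr det_trig.
    by apply: eq_bigr => a _; rewrite !mxE.
  by apply/is_trig_mxP => a a' h; rewrite !mxE b0.
have esum : (\sum_r (c r - (w^-1%g r <= i)) = q)%N.
  rewrite sumnB => [|r _].
    have := head_set_sum (fun=> 1%N) w; rewrite sum1_card card_ord.
    under [in RHS]eq_bigr do rewrite muln1.
    by move <-; rewrite csum; lia.
  by case h: (w^-1%g r <= i)%N => //; have := adm _ h; rewrite permKV.
have bb : tchar lam b = b ord0 ord0 ^+ q * \prod_(a < i.+1) b (wd a) (wd a).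
  rewrite big_ord_recl (_ : wd ord0 = ord0); last exact: val_inj.
  rewrite mulrA -exprSr /tchar (bigD1 ord0) //= lam0; congr (_ * _).
  transitivity (\prod_(r < n | (r != ord0) && (r < i.+1)%N) b r r).
    rewrite [LHS](bigID (fun r : 'I_n => (r < i.+1)%N)) /= [X in _ * X]big1 ?mulr1.
      by apply: eq_bigr => r /andP[r0]; rewrite ltnS lamE // => ->.
    by move=> r /andP[r0]; rewrite ltnS lamE // => /negbTE ->.
  rewrite (big_ord_narrow_cond (P := fun r => r != ord0) (F := fun r => b r r) i_lt) /=.
  rewrite big_mkcond big_ord_recl /= mul1r.
  by apply: eq_bigr.
rewrite /hook_fun minE bb.
under eq_bigr do rewrite gb0 exprMn.
by rewrite big_split /= prodrXr esum; ring.
Qed.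

Theorem hook_expansion mu (c : 'I_n -> nat) F (r0 : 'I_n) :
  (forall r, mu 0 r = (c r)%:Z) -> (\sum_r c r = q.+1 + i)%N -> (0 < c r0)%N ->
  regmx F -> right_semi lam F -> left_semi mu F -> forall g, g \in unitmx ->
  F g = \sum_(T in hook_index mu r0)
          F (hook_point k (enum_perm r0 T)) * hook_fun c (enum_perm r0 T) g.
Proof.
move=> muE csum cr0 Freg Fsemi Fleft g gu.
pose H g := -1 * (\sum_(T in hook_index mu r0)
   F (hook_point k (enum_perm r0 T)) * hook_fun c (enum_perm r0 T) g) + F g.
suff : H g = 0 by rewrite /H mulN1r addrC => /eqP; rewrite subr_eq0 => /eqP.
have TP T : T \in hook_index mu r0 ->
  [/\ enum_perm r0 T ord0 = r0, forall l, (enum_perm r0 T l \in T) = (l <= i)%N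
    & admissible c (enum_perm r0 T)].
  rewrite inE => /and3P[rT Ts /eqP Tc]; have [e0 eT] := enum_permP rT Tc.
  split=> // l; rewrite -eT => /(fintype.subsetP Ts).
  by rewrite inE muE eqz_nat lt0n.
have Hreg : regmx H.
  by apply: regmx_lin Freg; apply: regmx_sum => T _; exact: hook_fun_reg.
have Hsemi : right_semi lam H.
  move=> h b hu bu bt; rewrite /H Fsemi // mulrDr mulrCA; congr (-1 * _ + _).
  rewrite mulr_sumr; apply: eq_bigr => T /TP[_ _ adm].
  by rewrite (hook_fun_semi csum adm) // mulrCA.
have Hleft : left_semi mu H.
  move=> t h tu td hu; rewrite /H Fleft // mulrDr mulrCA; congr (-1 * _ + _).
  rewrite mulr_sumr; apply: eq_bigr => T /TP[_ _ adm].
  by rewrite (hook_fun_left muE adm) // mulrCA.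
apply: (vanish k_infinite lamE (r0 := r0) Hreg Hsemi Hleft) => // v v0.
(* [T0] is the image of [0, .., i] under [v]; no other index contributes to the sum at this
   point. *)
pose T0 := [set r | (v^-1%g r <= i)%N]%SET.
have T0c : #|T0| = i.+1.
  rewrite -sum1_card big_mkcond /=.
  have := head_set_sum (fun=> 1%N) v; rewrite sum1_card card_ord => ->.
  by apply: eq_bigr => r _; rewrite inE muln1; case: ifP.
have other (u : 'S_n) T : u ord0 = r0 -> (forall l, (u l \in T0) = (l <= i)%N) ->
    T \in hook_index mu r0 -> T != T0 ->
    hook_fun c (enum_perm r0 T) (hook_point k u) = 0.
  move=> u0 uT0 Tin TT0; have [e0 eT _] := TP T Tin.
  have [x xT xT0] : exists2 x, x \in T & x \notin T0.
    apply/subsetPn; apply: contra TT0 => sT.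
    by rewrite eqEcard sT T0c /=; move: Tin; rewrite inE => /and3P[_ _ /eqP ->].
  rewrite hook_fun_point.
  apply: (hook_minor_point_eq0 (l := ((enum_perm r0 T)^-1)%g x)).
  - by rewrite e0 u0.
  - by rewrite -eT permKV.
  - by rewrite permKV -uT0 permKV.
have vT0 l : (v l \in T0) = (l <= i)%N by rewrite inE permK.
have [T0in|T0out] := boolP (T0 \in hook_index mu r0); last first.
  rewrite /H big1 ?mulr0 ?add0r => [|T Tin]; last first.
    by rewrite other ?mulr0 //; apply: contraNneq T0out => <-.
  (* [T0] contains [r0] and has the right size, so it can only fail by leaving the support of [mu];
     there [weight_bound] applies. *)
  have /subsetPn[x xT0 xs] : ~~ (T0 \subset wsupport mu).
    apply: contra T0out => sT; rewrite inE sT T0c eqxx andbT andbT.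
    by rewrite -v0 vT0.
  apply: (weight_bound k_infinite (l := (v^-1)%g x) Freg Fsemi Fleft).
    apply: contraNneq xs => x0.
    by rewrite -[x](permKV v) x0 v0 inE muE eqz_nat -lt0n.
  rewrite permKV; move: (xs); rewrite inE negbK => /eqP ->.
  rewrite lamE; first by move: xT0; rewrite inE => ->.
  apply: contraTneq cr0 => x0.
  by move: xs; rewrite -[x](permKV v) x0 v0 inE muE eqz_nat negbK => /eqP ->.
have [e0 eT _] := TP _ T0in.
set w := enum_perm r0 T0 in e0 eT.
have Hw : H (hook_point k w) = 0.
  rewrite /H (bigD1 T0) //= -/w hook_fun_point hook_minor_point1 mulr1 big1 ?addr0.
    by rewrite mulN1r addNr.
  by move=> T /andP[Tin TT0]; rewrite other ?mulr0.
(* [v] and [w] map the first [i + 1] indices onto the same set, so they differ by a column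
   permutation through which [hook_perm] carries the zero. *)
have -> : hook_point k v = hook_point k w *m perm_mx (w * v^-1)%g.
  rewrite hook_point_rmul; first by rewrite invMg invgK mulgKV.
  by rewrite permM e0 -v0 permK.
apply: (hook_perm k_infinite lamE Hreg Hsemi) => //.
- by rewrite permM e0 -v0 permK.
- by move=> l l0; rewrite permM -(eT l) inE.
- exact: hook_point_unit.
Qed.

End HookExpansion.

HB.instance Definition _ (k : fieldType) (n : nat) (V : gmodule k n) (g : GL k n) :=
  GRing.isLinear.Build k V V *:%R (@gact k n V g) (@gact_linear k n V g).

(** * Weight spaces *)

Section Torus.
Variable k : fieldType.
Hypothesis k_infinite : infinite_set [set: k].
Variable m : nat.
Local Notation n := m.+1.
Local Notation G := (GL k n).
Local Notation wt := 'rV[int]_n.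
Implicit Types (t : G) (mu nu : wt).

Lemma torus_mulE (t : 'M[k]_n) (g : 'M[k]_n) r c : is_diag_mx t ->
  (t *m g) r c = t r r * g r c.
Proof.
move/is_diag_mxP=> td; rewrite mxE (bigD1 r) //= big1 ?addr0 // => x xr.
by rewrite td ?mul0r // val_eqE eq_sym.
Qed.

Lemma torusM t t' : is_diag_mx (val t) -> is_diag_mx (val t') ->
  is_diag_mx (val (t * t')%g).
Proof.
move=> td /is_diag_mxP td'; apply/is_diag_mxP => r c rc.
by rewrite [LHS](torus_mulE _ _ _ td) td' ?mulr0.
Qed.

Lemma torus1 : is_diag_mx (val (1%g : G)).
Proof. exact: scalar_mx_is_diag. Qed.

Lemma wcharM mu t t' : is_diag_mx (val t) ->
  wchar mu (t * t')%g = wchar mu t * wchar mu t'.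
Proof.
move=> td; rewrite /wchar -big_split /=; apply: eq_bigr => r _.
by rewrite -expfzMl -(torus_mulE _ _ _ td).
Qed.

Lemma wchar1 mu : wchar mu (1%g : G) = 1.
Proof. by rewrite /wchar big1 // => r _; rewrite mxE eqxx exp1rz. Qed.

Lemma torus_neq0 t r : is_diag_mx (val t) -> val t r r != 0.
Proof.
move=> td; have := valP t; rewrite unitmxE unitfE det_trig ?is_diag_mx_is_trig //.
by move/prodf_neq0/(_ r); apply.
Qed.

Lemma wchar_neq0 mu t : is_diag_mx (val t) -> wchar mu t != 0.
Proof.
by move=> td; apply/prodf_neq0 => r _; apply: expfz_neq0; exact: torus_neq0.
Qed.

Lemma wcharD mu nu t : is_diag_mx (val t) ->
  wchar (mu + nu) t = wchar mu t * wchar nu t.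
Proof.
move=> td; rewrite /wchar -big_split /=; apply: eq_bigr => r _.
by rewrite mxE expfzDr ?torus_neq0.
Qed.

Lemma wchar0 t : wchar 0 t = 1.
Proof. by rewrite /wchar big1 // => r _; rewrite mxE expr0z. Qed.

Lemma wcharN mu t : is_diag_mx (val t) -> wchar (- mu) t = (wchar mu t)^-1.
Proof.
move=> td; apply: (mulfI (wchar_neq0 mu td)).
by rewrite mulfV ?wchar_neq0 // -wcharD // subrr wchar0.
Qed.

Lemma torusV t : is_diag_mx (val t) -> is_diag_mx (val t^-1%g).
Proof.
move=> td; apply/is_diag_mxP => r c rc.
have := congr1 (fun x : G => val x r c) (mulgV t).
rewrite [LHS](torus_mulE _ _ _ td) mxE -val_eqE (negbTE rc) => /eqP.
by rewrite mulf_eq0 (negbTE (torus_neq0 _ td)) => /eqP.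
Qed.

Lemma wcharV mu t : is_diag_mx (val t) -> wchar mu t^-1%g = (wchar mu t)^-1.
Proof.
move=> td; apply: (mulfI (wchar_neq0 mu td)).
by rewrite mulfV ?wchar_neq0 // -wcharM // mulgV wchar1.
Qed.

Lemma wchar_neq mu nu : mu != nu ->
  exists2 t : G, is_diag_mx (val t) & wchar mu t != wchar nu t.
Proof.
move=> ne; have [r ner] : exists r, mu 0 r != nu 0 r.
  apply: contrapT => /forallNP H; case/eqP: ne; apply/rowP => r.
  by apply/eqP; have /negP := H r; rewrite negbK.
have [|z z0 ze] := @expz_neq1 _ k_infinite (mu 0 r - nu 0 r); first by rewrite subr_eq0.
exists (exist _ (diag1 r z) (diag1_unit r z0)); first exact: diag_mx_is_diag.
rewrite [wchar mu _](tchar_diag1 mu r z) [wchar nu _](tchar_diag1 nu r z).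
apply: contra ze => /eqP E.
by rewrite expfzDr // E -expfzDr // subrr expr0z.
Qed.

(** Independence of characters, made explicit as an element of the group algebra of the torus; it
    projects to one weight without leaving the span of an orbit. *)
Lemma artin_dual (s : seq wt) nu : nu \notin s ->
  exists l : seq (k * G), [/\ forall x, x \in l -> is_diag_mx (val x.2),
    \sum_(x <- l) x.1 * wchar nu x.2 = 1
    & forall mu, mu \in s -> \sum_(x <- l) x.1 * wchar mu x.2 = 0].
Proof.
elim: s => [|mu s IH].
  exists [:: (1, 1%g)]; split=> [x| |//]; last by rewrite big_seq1 wchar1 mulr1.
  by rewrite inE => /eqP ->; exact: torus1.
rewrite inE negb_or => /andP[numu /IH[l [ld l1 l0]]].
have [t0 t0d t0ne] := wchar_neq numu.
pose D := wchar nu t0 - wchar mu t0.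
have D0 : D != 0 by rewrite subr_eq0.
(* Product with [(t0 - mu(t0)) / D], which is 0 on [mu] and 1 on [nu]. *)
pose l' := [seq (x.1 / D, (t0 * x.2)%g) | x <- l] ++
           [seq (- (wchar mu t0 * x.1) / D, x.2) | x <- l].
have sumE rho : \sum_(x <- l') x.1 * wchar rho x.2 =
    (wchar rho t0 - wchar mu t0) / D * \sum_(x <- l) x.1 * wchar rho x.2.
  rewrite big_cat !big_map /= -big_split /= mulr_sumr; apply: eq_bigr => x _ /=.
  by rewrite wcharM //; field.
exists l'; split.
- move=> x; rewrite mem_cat => /orP[] /mapP[y yl ->] /=; last exact: ld.
  by apply: torusM => //; exact: ld.
- by rewrite sumE l1 mulr1 mulfV.
- move=> rho; rewrite inE sumE => /orP[/eqP ->|/l0 ->]; last by rewrite mulr0.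
  by rewrite subrr !mul0r.
Qed.

Section WeightProjection.
Variable V : gmodule k n.

Definition weighted (l : seq (wt * V)) :=
  forall x, x \in l -> weight_space (V := V) x.1 x.2.

Definition torus_semisimple := forall v : V,
  exists2 l, weighted l & v = \sum_(x <- l) x.2.

Lemma weight_space_lin mu a (u v : V) : weight_space (V := V) mu u ->
  weight_space (V := V) mu v -> weight_space (V := V) mu (a *: u + v).
Proof.
move=> uw vw t td; rewrite linearP /= uw // vw // scalerDr !scalerA.
by rewrite mulrC.
Qed.

Lemma weight_space0 mu : weight_space (V := V) mu 0.
Proof. by move=> t _; rewrite linear0 scaler0. Qed.

Lemma weight_space_sum (I : Type) (r : seq I) (P : pred I) (f : I -> V) mu :
  (forall j, P j -> weight_space (V := V) mu (f j)) ->
  weight_space (V := V) mu (\sum_(j <- r | P j) f j).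
Proof.
move=> fw; elim/big_rec: _ => [|j x Pj xw]; first exact: weight_space0.
by rewrite -[f j]scale1r; apply: weight_space_lin => //; exact: fw.
Qed.

Definition is_wpart mu (v u : V) := weight_space (V := V) mu u /\
  exists2 l : seq (wt * V), weighted l /\ (forall x, x \in l -> x.1 != mu)
    & v = u + \sum_(x <- l) x.2.

Lemma is_wpart_lin mu a (v u v' u' : V) : is_wpart mu v u -> is_wpart mu v' u' ->
  is_wpart mu (a *: v + v') (a *: u + u').
Proof.
move=> [uw [l [lw ln] vE]] [u'w [l' [lw' ln'] vE']].
split; first exact: weight_space_lin.
exists ([seq (x.1, a *: x.2) | x <- l] ++ l'); last first.
  by rewrite vE vE' big_cat big_map /= scalerDr addrACA scaler_sumr.
split=> x; rewrite mem_cat => /orP[/mapP[y yl ->]|xl] /=; [|exact: lw'|exact: ln|exact: ln'].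
by rewrite -[a *: _]addr0; apply: weight_space_lin; [exact: lw|exact: weight_space0].
Qed.

Lemma artin_apply (l : seq (k * G)) mu (u : V) :
  (forall x, x \in l -> is_diag_mx (val x.2)) -> weight_space (V := V) mu u ->
  \sum_(x <- l) x.1 *: gact x.2 u = (\sum_(x <- l) x.1 * wchar mu x.2) *: u.
Proof.
move=> ld uw; rewrite scaler_suml; apply: eq_big_seq => x /ld xd.
by rewrite uw // scalerA.
Qed.

Lemma is_wpart_uniq mu (v u u' : V) : is_wpart mu v u -> is_wpart mu v u' -> u = u'.
Proof.
move=> vu vu'; have := is_wpart_lin (-1) vu vu'.
rewrite scaleN1r addNr scaleN1r => -[dw [l [lw ln] E]].
have mul : mu \notin [seq x.1 | x <- l].
  by apply/negP => /mapP[x /ln/eqP xmu muE]; exact: xmu.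
have [a [ad a1 a0]] := artin_dual mul.
have : \sum_(x <- a) x.1 *: gact x.2 (- u + u' + \sum_(y <- l) y.2) = 0.
  by rewrite -E big1 // => x _; rewrite linear0 scaler0.
under eq_bigr do rewrite linearD scalerDr /=.
rewrite big_split /= (artin_apply ad dw) a1 scale1r.
under [X in _ + X]eq_bigr do rewrite linear_sum scaler_sumr /=.
rewrite exchange_big big1_seq /= ?addr0 => [/eqP|y yl].
  by rewrite addrC subr_eq0 => /eqP.
by rewrite (artin_apply ad (lw y yl)) a0 ?scale0r // map_f.
Qed.

Definition wpart mu v : V := xget 0 [set u | is_wpart mu v u].

Hypothesis Vss : torus_semisimple.

Lemma wpartP mu v : is_wpart mu v (wpart mu v).
Proof.
apply: xgetPex; have [l lw ->] := Vss v.
exists (\sum_(x <- l | x.1 == mu) x.2); split.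
  by rewrite big_seq_cond; apply: weight_space_sum => x /andP[/lw xw /eqP <-].
exists [seq x <- l | x.1 != mu]; last by rewrite big_filter [LHS](bigID (fun x => x.1 == mu)).
by split=> x; rewrite mem_filter => /andP[xm xl]; [exact: lw|exact: xm].
Qed.

Lemma wpart_eq mu v u : is_wpart mu v u -> wpart mu v = u.
Proof. exact: is_wpart_uniq (wpartP mu v). Qed.

Lemma wpart_weight mu v : weight_space (V := V) mu (wpart mu v).
Proof. by case: (wpartP mu v). Qed.

Lemma wpart_is_linear mu : linear (wpart mu).
Proof. by move=> a u v; apply: wpart_eq; apply: is_wpart_lin; exact: wpartP. Qed.

HB.instance Definition _ mu := GRing.isLinear.Build k V V *:%R (wpart mu) (wpart_is_linear mu).

Lemma wpart_id mu nu v : weight_space (V := V) nu v ->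
  wpart mu v = if mu == nu then v else 0.
Proof.
move=> vw; apply: wpart_eq; case: eqVneq => [->|ne].
  by split=> //; exists [::]; [split|rewrite big_nil addr0].
split; first exact: weight_space0.
exists [:: (nu, v)]; last by rewrite big_seq1 add0r.
by split=> x; rewrite inE => /eqP ->; rewrite // eq_sym.
Qed.

Lemma wpart_act mu t v : is_diag_mx (val t) ->
  wpart mu (gact t v) = wchar mu t *: wpart mu v.
Proof.
move=> td; have [l lw ->] := Vss v.
rewrite !linear_sum /= ?scaler_sumr; apply: eq_big_seq => x /lw xw.
rewrite xw // linearZ /= (wpart_id mu xw); case: eqVneq => [->//|_].
by rewrite !scaler0.
Qed.

Lemma wpart_sum v : exists2 s : seq wt, uniq s &
  v = \sum_(mu <- s) wpart mu v /\ forall mu, mu \notin s -> wpart mu v = 0.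
Proof.
have [l lw ->] := Vss v; exists (undup [seq x.1 | x <- l]); first exact: undup_uniq.
have pE mu : wpart mu (\sum_(x <- l) x.2) = \sum_(x <- l) (if mu == x.1 then x.2 else 0).
  by rewrite linear_sum /=; apply: eq_big_seq => x /lw/wpart_id ->.
split=> [|mu mul]; last first.
  rewrite pE big1_seq // => x /andP[_ xl]; case: eqP => // E; case/negP: mul.
  by rewrite mem_undup E map_f.
under [RHS]eq_bigr do rewrite pE.
rewrite exchange_big /=; apply: eq_big_seq => x xl.
rewrite (bigD1_seq x.1) ?undup_uniq ?mem_undup ?map_f //= eqxx big1 ?addr0 //.
by move=> mu /negbTE ->.
Qed.

End WeightProjection.

(** The coefficients of the characters lie a priori in the larger space [E]; by [artin_dual] each is
    a combination of vectors [t v], hence comes from [V]. For [nabla], [E] consists of all functions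
    on G, where a regular function splits before its pieces are known to be equivariant. *)
Lemma torus_semisimpleP (V : gmodule k n) (E : lmodType k) (iota : {linear V -> E}) :
  injective iota ->
  (forall v, exists h : seq (wt * E), forall t, is_diag_mx (val t) ->
     iota (gact t v) = \sum_(x <- h) wchar x.1 t *: x.2) ->
  torus_semisimple V.
Proof.
move=> iota_inj H v; have [h hE] := H v.
pose s := undup [seq x.1 | x <- h].
pose e mu := \sum_(x <- h | x.1 == mu) x.2.
have U mu : mu \in s -> exists u : V, iota u = e mu /\
    forall t, is_diag_mx (val t) -> iota (gact t u) = wchar mu t *: e mu.
  move=> mus; have us : uniq s by exact: undup_uniq.
  have nrem : mu \notin rem mu s by rewrite mem_rem_uniqF.
  have [a [ad a1 a0]] := artin_dual nrem.
  have key t : is_diag_mx (val t) ->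
      iota (gact t (\sum_(x <- a) x.1 *: gact x.2 v)) = wchar mu t *: e mu.
    move=> td; rewrite !linear_sum /=.
    under eq_big_seq => x xa.
      rewrite !linearZ /= -gactM hE ?torusM ?ad // scaler_sumr.
      under eq_bigr do rewrite wcharM // scalerA.
    over.
    rewrite exchange_big /= /e [in RHS]big_mkcond; apply: eq_big_seq => y yh.
    rewrite -scaler_suml.
    under eq_bigr do rewrite mulrCA.
    rewrite -mulr_sumr; case: eqVneq => [->|ne]; first by rewrite a1 mulr1.
    by rewrite a0 ?mulr0 ?scaler0 ?scale0r // mem_rem_uniq // inE ne mem_undup map_f.
  exists (\sum_(x <- a) x.1 *: gact x.2 v); split=> //.
  have := key _ torus1; rewrite gact1 wchar1 scale1r //.
have /choice[u uP] mu : exists x : V, mu \in s -> iota x = e mu /\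
    forall t, is_diag_mx (val t) -> iota (gact t x) = wchar mu t *: e mu.
  by have [/U[x xP]|_] := boolP (mu \in s); [exists x|exists 0].
exists [seq (mu, u mu) | mu <- s].
  move=> x /mapP[mu mus ->] t td /=; apply: iota_inj.
  by have [uE ->] := uP mu mus; rewrite // linearZ /= uE.
apply: iota_inj; rewrite big_map /= linear_sum /=.
have := hE 1%g torus1; rewrite gact1 => ->.
under [LHS]eq_bigr do rewrite wchar1 scale1r.
under [RHS]eq_big_seq => mu mus do rewrite (uP mu mus).1 /e big_mkcond.
rewrite exchange_big /=; apply: eq_big_seq => x xh.
rewrite (bigD1_seq x.1) ?undup_uniq ?mem_undup ?map_f //= eqxx big1 ?addr0 //.
by move=> mu; rewrite eq_sym => /negbTE ->.
Qed.

Lemma regular_torus (f : G -> k) : regular_fun f ->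
  exists h : seq (wt * (G -> k^o)), forall t, is_diag_mx (val t) ->
    forall g, f (t * g)%g = \sum_(x <- h) wchar x.1 t * x.2 g.
Proof.
move=> [P [N PN]].
(* A monomial scales with [t_r] by its degree in row [r], and the denominator [\det ^+ N] lowers
   every exponent by [N]. *)
pose wm (e : 'X_{1..n * n}) : wt := \row_r ((\sum_c e (mxvec_index r c))%N%:Z - N%:Z).
pose hm (e : 'X_{1..n * n}) : G -> k^o := fun g =>
  P@_e * (\prod_l mxvec (val g) 0 l ^+ e l) / \det (val g) ^+ N.
exists [seq (wm e, hm e) | e <- msupp P] => t td g.
rewrite PN big_map mevalE mulr_suml; apply: eq_bigr => e _ /=.
rewrite -[sval t]/(val t) -[sval g]/(val g).
have split_idx (F : 'I_(n * n) -> k) : \prod_l F l = \prod_r \prod_c F (mxvec_index r c).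
  rewrite pair_big /= (reindex _ (curry_mxvec_bij _ _)) /=.
  by apply: eq_bigr => -[].
have -> : hm e g = P@_e * (\prod_r \prod_c val g r c ^+ e (mxvec_index r c)) /
    \det (val g) ^+ N.
  rewrite /hm split_idx; congr (_ * _ / _).
  by apply: eq_bigr => r _; apply: eq_bigr => c _; rewrite mxvecE.
rewrite split_idx; under eq_bigr => r _.
  under eq_bigr do rewrite mxvecE torus_mulE // exprMn.
  rewrite big_split /= prodrXr.
over.
rewrite big_split /= det_mulmx exprMn invfM.
have -> : wchar (wm e) t =
    (\prod_r val t r r ^+ (\sum_c e (mxvec_index r c))%N) / \det (val t) ^+ N.
  rewrite det_trig ?is_diag_mx_is_trig // -prodrXl -prodfV -big_split /wchar.
  apply: eq_bigr => r _ /=; rewrite mxE expfzDr ?torus_neq0 //.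
  by rewrite -exprnP exprnN.
by ring.
Qed.

End Torus.

(** * Dimensions from explicit bases *)

Section SubspaceDimension.
Variables (k : fieldType) (V : lmodType k) (S : set V).

Lemma is_basis_dim d (e : 'I_d -> V) d' (e' : 'I_d' -> V) :
  is_basis S e -> is_basis S e' -> (d <= d')%N.
Proof.
move=> [Se be] [Se' be'].
have /choice[A AE] i : exists c : 'rV[k]_d', e i = \sum_(j < d') c 0 j *: e' j.
  by have [c []] := be' _ (Se i); exists c.
have /choice[B BE] j : exists c : 'rV[k]_d, e' j = \sum_(i < d) c 0 i *: e i.
  by have [c []] := be _ (Se' j); exists c.
pose MA : 'M[k]_(d, d') := \matrix_(i, j) A i 0 j.
pose MB : 'M[k]_(d', d) := \matrix_(j, i) B j 0 i.
apply: (@mulmx1_min _ _ _ MA MB); apply/row_matrixP => i.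
have [c [_ cU]] := be _ (Se i); rewrite -(cU (row i 1%:M)); last first.
  rewrite (bigD1 i) //= !mxE eqxx scale1r big1 ?addr0 // => j ji.
  by rewrite !mxE eq_sym (negbTE ji) scale0r.
rewrite -(cU (row i (MA *m MB))) //.
under eq_bigr do rewrite !mxE scaler_suml.
rewrite exchange_big [LHS]AE; apply: eq_bigr => j _; rewrite [in LHS]BE scaler_sumr.
by apply: eq_bigr => x _; rewrite !mxE scalerA.
Qed.

Lemma subspace_dim_basis d (e : 'I_d -> V) : is_basis S e -> subspace_dim S = d.
Proof.
move=> be; rewrite /subspace_dim.
case: xgetP => [d' -> [e' be']|/(_ d) []]; last by exists e.
by apply/eqP; rewrite eqn_leq (is_basis_dim be' be) (is_basis_dim be be').
Qed.

Lemma subspace_dimE (I : finType) (A : {pred I}) (e : I -> V) :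
  (forall x, x \in A -> S (e x)) ->
  (forall v, S v -> exists c : I -> k, v = \sum_(x in A) c x *: e x) ->
  (forall c : I -> k, \sum_(x in A) c x *: e x = 0 -> forall x, x \in A -> c x = 0) ->
  subspace_dim S = #|A|.
Proof.
move=> Se span indep; apply: (@subspace_dim_basis _ (fun j => e (enum_val j))); split.
  by move=> j; apply: Se; exact: enum_valP.
move=> v /span[c vE]; exists (\row_j c (enum_val j)); split.
  by rewrite vE big_enum_val; apply: eq_bigr => j _; rewrite mxE.
move=> c' vE'; apply/rowP => j; rewrite mxE.
pose d x := \sum_(j < #|A| | enum_val j == x) c' 0 j.
have dE l : d (enum_val l) = c' 0 l.
  by rewrite /d (big_pred1 l) // => y; rewrite /= (inj_eq enum_val_inj).
have := indep (fun x => c x - d x); rewrite big_enum_val /=.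
under eq_bigr do rewrite scalerBl dE.
rewrite sumrB -vE'.
have -> : \sum_(l < #|A|) c (enum_val l) *: e (enum_val l) = v.
  by rewrite vE [RHS]big_enum_val.
rewrite subrr => /(_ erefl _ (enum_valP j)).
by rewrite dE => /eqP; rewrite subr_eq0 => /eqP.
Qed.

End SubspaceDimension.

(** * Weyl modules of hooks *)

Section HookNabla.
Variable k : fieldType.
Hypothesis k_infinite : infinite_set [set: k].
Variable m : nat.
Local Notation n := m.+1.
Local Notation G := (GL k n).
Local Notation wt := 'rV[int]_n.

Lemma rational_semisimple (V : gmodule k n) : rational V -> torus_semisimple V.
Proof.
move=> Vrat; apply: (torus_semisimpleP k_infinite (iota := idfun)) => // v.
have [r [f [w [freg fE]]]] := Vrat v.
have /choice[h hE] j := regular_torus (freg j).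
exists [seq (x.1, x.2 1%g *: w j) | j <- enum 'I_r, x <- h j] => t td /=.
rewrite big_allpairs_dep /= fE big_enum /=; apply: eq_bigr => j _.
rewrite -[t in f j t]mulg1 hE // scaler_suml; apply: eq_bigr => x _.
by rewrite scalerA.
Qed.

(** The functions themselves are expanded by [regular_torus]; the action through [t^-1] negates the
    characters. *)
Lemma nabla_semisimple (lam : wt) : torus_semisimple (nabla k lam).
Proof.
pose iota : {linear nabla k lam -> (G -> k^o)} := \val : nabla_car k lam -> (G -> k^o).
apply: (torus_semisimpleP k_infinite (iota := iota)); first exact: val_inj.
case=> f fP; have /asboolP[freg _] := fP.
have [h hE] := regular_torus freg.
exists [seq (- x.1, x.2) | x <- h] => t td.
apply/funext => g; rewrite big_map /= fct_sumE hE ?torusV //.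
by apply: eq_bigr => x _; rewrite wcharV // -wcharN.
Qed.

Definition toGL (M : 'M[k]_n) : G :=
  insubd (GL1 k n : {g : 'M[k]_n | g \in unitmx}) M.

Lemma toGLK (M : 'M[k]_n) : M \in unitmx -> val (toGL M) = M.
Proof. exact: insubdK. Qed.

Lemma valGLK (g : G) : toGL (val g) = g.
Proof. exact: valKd. Qed.

Lemma toGLM (M N : 'M[k]_n) : M \in unitmx -> N \in unitmx ->
  toGL (M *m N) = (toGL M * toGL N)%g.
Proof.
by move=> Mu Nu; apply: val_inj; rewrite toGLK ?unitmx_mul ?Mu //= !toGLK.
Qed.

Lemma regmx_rmul (F : 'M[k]_n -> k) a : a \in unitmx -> regmx F ->
  regmx (fun g => F (g *m a)).
Proof.
move=> au [P [N PN]].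
pose Y := generic_mx k m *m map_mx (@mpolyC (n * n) k) a.
exists ((\det a ^- N)%:MP * (P \mPo [tuple mxvec Y 0 l | l < n * n])), N => g gu.
rewrite PN ?unitmx_mul ?gu // mevalM mevalC comp_mpoly_meval det_mulmx exprMn.
set p1 := _.@[_]; set p2 := _.@[_]; suff -> : p1 = p2 by rewrite invfM; ring.
apply: meval_eq => l; rewrite tnth_mktuple.
case/mxvec_indexP: l => r c; rewrite !mxvecE !mxE raddf_sum /=.
by apply: eq_bigr => h _; rewrite mevalM meval_generic_mx mxE mevalC.
Qed.

Definition rev_perm : 'S_n := perm (@rev_ord_inj n).
Definition rev_mx : 'M[k]_n := perm_mx rev_perm.

Lemma rev_perm2 : (rev_perm * rev_perm)%g = 1%g.
Proof. by apply/permP => r; rewrite permM !permE rev_ordK. Qed.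

Lemma rev_mx2 : rev_mx *m rev_mx = 1%:M.
Proof. by rewrite -perm_mxM rev_perm2 perm_mx1. Qed.

Lemma rev_mx_unit : rev_mx \in unitmx.
Proof. exact: unitmx_perm. Qed.

Lemma rev_mx_conjE (b : 'M[k]_n) r c :
  (rev_mx *m b *m rev_mx) r c = b (rev_ord r) (rev_ord c).
Proof.
have rV : rev_perm = rev_perm^-1%g.
  by apply: (mulgI rev_perm); rewrite rev_perm2 mulgV.
by rewrite /rev_mx -row_permE rV -col_permE !mxE -rV !permE.
Qed.

Lemma rev_mx_conj_trig (b : 'M[k]_n) : is_trig_mx b^T ->
  is_trig_mx (rev_mx *m b *m rev_mx).
Proof.
move=> /is_trig_mxP bt; apply/is_trig_mxP => r c rc; rewrite rev_mx_conjE.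
have := bt (rev_ord c) (rev_ord r); rewrite mxE; apply.
by have := ltn_ord c; rewrite /=; lia.
Qed.

Lemma trig_rev_mx_conj (b : 'M[k]_n) : is_trig_mx b ->
  is_trig_mx (rev_mx *m b *m rev_mx)^T.
Proof.
move=> /is_trig_mxP bt; apply/is_trig_mxP => r c rc; rewrite mxE rev_mx_conjE.
by apply: bt; have := ltn_ord c; rewrite /=; lia.
Qed.

Variable lam : wt.

Lemma wchar_Nw0 (b : G) (b' : 'M[k]_n) : val b = rev_mx *m b' *m rev_mx ->
  (wchar (- w0 lam) b)^-1 = tchar lam b'.
Proof.
move=> bE; rewrite /wchar -prodfV /tchar (reindex_inj rev_ord_inj) /=.
by apply: eq_bigr => r _; rewrite bE rev_mx_conjE !mxE rev_ordK invr_expz opprK.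
Qed.

(** Translation by the order-reversing permutation matrix exchanges lower and upper triangular
    matrices and turns the inverse of the character [- w0 lam] into [lam]. *)
Definition nabla_mx (f : nabla k (- w0 lam)) : 'M[k]_n -> k :=
  fun M => nabla_val f (toGL (M *m rev_mx)).

Lemma nabla_mx_val (f : nabla k (- w0 lam)) g :
  nabla_val f g = nabla_mx f (val g *m rev_mx).
Proof. by rewrite /nabla_mx -mulmxA rev_mx2 mulmx1 valGLK. Qed.

Lemma nabla_mx_reg f : regmx (nabla_mx f).
Proof.
apply: (@regmx_rmul (fun M => nabla_val f (toGL M))); first exact: rev_mx_unit.
apply/regmxE; case: f => f fP; have /asboolP[freg _] := fP.
by rewrite (_ : (fun _ => _) = f) //; apply/funext => g; rewrite /= valGLK.
Qed.

Lemma nabla_mx_semi f : right_semi lam (nabla_mx f).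
Proof.
move=> g b gu bu bt; case: f => f fP; have /asboolP[_ fB] := fP.
have b'u : rev_mx *m b *m rev_mx \in unitmx by rewrite !unitmx_mul rev_mx_unit bu.
have -> : nabla_mx (NablaCar fP) (g *m b) =
    f (toGL (g *m rev_mx) * toGL (rev_mx *m b *m rev_mx))%g.
  rewrite -toGLM ?unitmx_mul ?gu ?rev_mx_unit ?bu // /nabla_mx /=.
  apply: (congr1 (fun M => f (toGL M))).
  by rewrite -!mulmxA [rev_mx *m (rev_mx *m _)]mulmxA rev_mx2 mul1mx.
rewrite fB; first by rewrite (wchar_Nw0 (b' := b)) ?toGLK.
by rewrite toGLK // rev_mx_conj_trig.
Qed.

Lemma nabla_mx_left mu f : weight_space (V := nabla k (- w0 lam)) (- mu) f ->
  left_semi mu (nabla_mx f).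
Proof.
move=> fw t g tu td gu; have tK := toGLK tu.
have td' : is_diag_mx (val (toGL t)) by rewrite tK.
have guR : g *m rev_mx \in unitmx by rewrite unitmx_mul gu rev_mx_unit.
have := congr1 (fun h : nabla k (- w0 lam) => nabla_val h (toGL t * toGL (g *m rev_mx))%g)
  (fw _ td').
rewrite /= mulgA mulVg mul1g wcharN // /nabla_mx -mulmxA (toGLM tu guR) => ->.
have -> : tchar mu t = wchar mu (toGL t) by rewrite /wchar tK.
by rewrite mulVKf // wchar_neq0.
Qed.

Lemma nabla_mx_eq f h : (forall M, M \in unitmx -> nabla_mx f M = nabla_mx h M) -> f = h.
Proof.
move=> E; apply: val_inj; apply/funext => g.
by rewrite [LHS]nabla_mx_val E -?nabla_mx_val // unitmx_mul (valP g) rev_mx_unit.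
Qed.

Lemma nabla_of_subproof F : regmx F -> right_semi lam F ->
  nabla_pred (- w0 lam) (fun g => F (val g *m rev_mx)).
Proof.
move=> Freg Fsemi; apply/asboolP; split.
  by apply/(regmxE (fun M => F (M *m rev_mx))); apply: regmx_rmul => //; exact: rev_mx_unit.
move=> g b bt; pose b' := rev_mx *m val b *m rev_mx.
have bE : val b = rev_mx *m b' *m rev_mx.
  by rewrite /b' !mulmxA rev_mx2 mul1mx -mulmxA rev_mx2 mulmx1.
rewrite (wchar_Nw0 bE) -Fsemi.
- congr F; rewrite /b' !mulmxA -[_ *m rev_mx *m rev_mx]mulmxA rev_mx2 mulmx1 //.
- by rewrite unitmx_mul (valP g) rev_mx_unit.
- by rewrite !unitmx_mul rev_mx_unit (valP b).
- exact: trig_rev_mx_conj.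
Qed.

Definition nabla_of F (Freg : regmx F) (Fsemi : right_semi lam F) : nabla k (- w0 lam) :=
  NablaCar (nabla_of_subproof Freg Fsemi).

Lemma nabla_of_mx F (Freg : regmx F) (Fsemi : right_semi lam F) M : M \in unitmx ->
  nabla_mx (nabla_of Freg Fsemi) M = F M.
Proof.
move=> Mu; rewrite /nabla_mx /= [val _]toGLK ?unitmx_mul ?Mu ?rev_mx_unit //.
by rewrite -mulmxA rev_mx2 mulmx1.
Qed.

Lemma nabla_of_weight F (Freg : regmx F) (Fsemi : right_semi lam F) mu :
  left_semi mu F -> weight_space (V := nabla k (- w0 lam)) (- mu) (nabla_of Freg Fsemi).
Proof.
move=> Fleft t td; apply: val_inj; apply/funext => g.
transitivity (F (val t^-1%g *m (val g *m rev_mx))); first by rewrite mulmxA.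
rewrite Fleft.
- have -> : tchar mu (val t^-1%g) = wchar (- mu) t by rewrite wcharN // -wcharV.
  by [].
- exact: (valP t^-1%g).
- exact: torusV.
- by rewrite unitmx_mul (valP g) rev_mx_unit.
Qed.

End HookNabla.

(** * Weight spaces of the full linear dual *)

Section DualDimension.
Variable k : fieldType.
Hypothesis k_infinite : infinite_set [set: k].
Variable m : nat.
Local Notation n := m.+1.
Variable V : gmodule k n.
Hypothesis Vss : torus_semisimple V.

Lemma dual_linear (phi : gdual V) : linear (phi : dual_car V).
Proof. by case: phi => phi /= /asboolP. Qed.

(** A functional of weight [mu] kills every weight space but that of [- mu], and each vector is a
    finite sum of weight vectors. *)
Lemma dual_weight_part mu (phi : gdual V) v : weight_space (V := gdual V) mu phi ->
  (phi : dual_car V) v = (phi : dual_car V) (wpart (- mu) v).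
Proof.
move=> phiw; pose f : {linear V -> k^o} := HB.pack (phi : V -> k^o)
  (GRing.isLinear.Build k V k^o *:%R (phi : dual_car V) (dual_linear phi)).
have kill nu u : weight_space (V := V) nu u -> nu != - mu -> f u = 0.
  move=> uw ne; have [|t td tne] := @wchar_neq _ k_infinite _ mu (- nu).
    by rewrite eq_sym eqr_oppLR.
  have := congr1 (fun h : gdual V => (h : dual_car V) u) (phiw t td).
  rewrite /= uw ?torusV // => E.
  have {}E : wchar nu t^-1%g *: f u = wchar mu t *: f u by rewrite -linearZ.
  move: E; rewrite wcharV // -wcharN // => /eqP; rewrite -subr_eq0 -scalerBl.
  by rewrite scaler_eq0 subr_eq0 eq_sym (negbTE tne) => /eqP.
have [s us [vE s0]] := wpart_sum k_infinite Vss v.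
rewrite -[LHS]/(f v) -[RHS]/(f _) [in LHS]vE linear_sum /=.
have K nu : nu != - mu -> f (wpart nu v) = 0.
  by apply: kill; exact: wpart_weight.
have [ins|outs] := boolP (- mu \in s).
  by rewrite (bigD1_seq (- mu)) //= big1 ?addr0 // => nu /K.
rewrite s0 // -[RHS]/(f 0) [RHS]linear0 big1_seq // => nu /andP[_ nus]; apply: K.
by apply: contraNneq outs => <-.
Qed.

(** The forms [psi x], composed with the projection to weight [- mu], are the basis dual to [u];
    finiteness is asked of this weight space alone. *)
Lemma dual_weight_dim mu (I : finType) (A : {pred I}) (u : I -> V) (psi : I -> {linear V -> k^o}) :
  (forall x, x \in A -> weight_space (V := V) (- mu) (u x)) ->
  (forall v, weight_space (V := V) (- mu) v -> v = \sum_(x in A) psi x v *: u x) ->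
  (forall x y, x \in A -> y \in A -> psi x (u y) = (x == y)%:R) ->
  subspace_dim (weight_space (V := gdual V) mu) = #|A|.
Proof.
move=> uw span dual.
have psiP x : dual_pred (fun v => psi x (wpart (- mu) v)).
  apply/asboolP => a v w; rewrite (wpart_is_linear k_infinite Vss).
  by rewrite linearP.
pose e x : gdual V := DualCar (psiP x).
have sumE (c : I -> k) v :
    (\sum_(x in A) c x *: e x : dual_car V) v = \sum_(x in A) c x * psi x (wpart (- mu) v).
  by elim/big_rec2: _ => [//|x y z _ <-].
apply: (@subspace_dimE _ _ _ _ _ e) => [x xA t td|phi phiw|c c0 x xA].
- apply: val_inj; apply/funext => v /=.
  rewrite (wpart_act k_infinite Vss) ?torusV // linearZ /= wcharV // -wcharN //.
  by rewrite opprK.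
- exists (fun x => (phi : dual_car V) (u x)); apply: val_inj; apply/funext => v.
  rewrite [RHS]sumE [LHS](dual_weight_part v phiw).
  rewrite [in LHS](span (wpart (- mu) v)); last exact: wpart_weight.
  pose f : {linear V -> k^o} := HB.pack (phi : V -> k^o)
    (GRing.isLinear.Build k V k^o *:%R (phi : dual_car V) (dual_linear phi)).
  rewrite -[LHS]/(f _) linear_sum; apply: eq_bigr => x xA.
  by rewrite linearZ /= mulrC.
have := congr1 (fun h : gdual V => (h : dual_car V) (u x)) c0; rewrite sumE.
rewrite (wpart_id k_infinite Vss (- mu) (uw x xA)) eqxx (bigD1 x) //= dual // eqxx.
rewrite mulr1 big1 ?addr0 // => y /andP[yA yx].
by rewrite dual // (negbTE yx) mulr0.
Qed.

End DualDimension.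

(** * Weight multiplicities of Delta at a hook *)

Section DeltaDimension.
Variable k : fieldType.
Hypothesis k_infinite : infinite_set [set: k].
Variables (m i q : nat).
Local Notation n := m.+1.
Local Notation wt := 'rV[int]_n.
Hypothesis i_lt : (i.+1 <= n)%N.
Variable lam : wt.
Hypotheses (lamE : hook_like i lam) (lam0 : lam 0 ord0 = q.+1%:Z).

Lemma hook_index_admissible (mu : wt) (c : 'I_n -> nat) r0 T : (forall r, mu 0 r = (c r)%:Z) ->
  T \in hook_index i mu r0 -> admissible i c (enum_perm i r0 T).
Proof.
move=> muE; rewrite inE => /and3P[rT Ts /eqP Tc] l.
have [_ eT] := enum_permP i_lt rT Tc.
by rewrite -eT => /(fintype.subsetP Ts); rewrite inE muE eqz_nat lt0n.
Qed.

(** The functions [hook_fun] and the evaluations at the matching points are dual bases, by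
    [hook_expansion] and [hook_minor_enum]. *)
Lemma delta_dim (mu : wt) (c : 'I_n -> nat) r0 : (forall r, mu 0 r = (c r)%:Z) ->
  (\sum_r c r = q.+1 + i)%N -> (0 < c r0)%N ->
  subspace_dim (weight_space (V := Delta k lam) mu) = #|hook_index i mu r0|.
Proof.
move=> muE csum cr0; pose pt T := hook_point k (enum_perm i r0 T).
have ptu T : pt T \in unitmx by exact: hook_point_unit.
have /choice[u uP] T : exists u : nabla k (- w0 lam), T \in hook_index i mu r0 ->
    weight_space (V := nabla k (- w0 lam)) (- mu) u /\
    forall M, M \in unitmx -> nabla_mx u M = hook_fun i_lt c (enum_perm i r0 T) M.
  have [Tin|_] := boolP (T \in hook_index i mu r0); last by exists 0.
  have adm := hook_index_admissible muE Tin.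
  exists (nabla_of (hook_fun_reg k i_lt c (enum_perm i r0 T))
    (hook_fun_semi i_lt lamE lam0 csum adm)).
  split; last by move=> M Mu; rewrite nabla_of_mx.
  by apply: nabla_of_weight; exact: hook_fun_left.
pose psi T : {linear nabla k (- w0 lam) -> k^o} :=
  HB.pack (fun f : nabla k (- w0 lam) => nabla_mx f (pt T) : k^o)
   (GRing.isLinear.Build k (nabla k (- w0 lam)) k^o *:%R
      (fun f : nabla k (- w0 lam) => nabla_mx f (pt T) : k^o) (fun a f h => erefl)).
apply: (dual_weight_dim k_infinite (nabla_semisimple k_infinite (lam := _)) (u := u) (psi := psi)).
- by move=> T /uP[].
- move=> f fw; apply: nabla_mx_eq => M Mu.
  have -> : nabla_mx (\sum_(T in hook_index i mu r0) psi T f *: u T) M =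
      \sum_(T in hook_index i mu r0) psi T f * nabla_mx (u T) M.
    by elim/big_rec2: _ => [//|x y z _ <-].
  rewrite (hook_expansion k_infinite i_lt lamE lam0 muE csum cr0 (nabla_mx_reg f)
    (nabla_mx_semi f) (nabla_mx_left fw) Mu).
  by apply: eq_bigr => T /uP[_ ->].
move=> T T' Tin Tin'; rewrite /= (uP T' Tin').2 // hook_fun_point.
move: Tin Tin'; rewrite !inE => /and3P[rT _ /eqP Tc] /and3P[rT' _ /eqP Tc'].
by rewrite hook_minor_enum // eq_sym.
Qed.

Lemma delta_dim0 (mu : wt) : (exists s, mu 0 s < 0) \/ \sum_r mu 0 r != \sum_r lam 0 r ->
  subspace_dim (weight_space (V := Delta k lam) mu) = 0%N.
Proof.
move=> bad; rewrite -(@card0 {set 'I_n}).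
pose psi (T : {set 'I_n}) : {linear nabla k (- w0 lam) -> k^o} := \0%R.
apply: (dual_weight_dim k_infinite (nabla_semisimple k_infinite (lam := _))
  (u := fun=> 0) (psi := psi)) => //.
move=> f fw; rewrite big_pred0 //; apply: nabla_mx_eq => M Mu.
transitivity (0 : k); last by [].
have Freg := nabla_mx_reg f; have Fs := nabla_mx_semi f; have Fl := nabla_mx_left fw.
case: bad => [[s s0]|ne]; last exact: (weight_sum k_infinite Freg Fs Fl ne Mu).
by apply: (weight_ge0 k_infinite lamE Freg Fs Fl _ s0 Mu); rewrite lam0.
Qed.

End DeltaDimension.

(** * Counting index sets, and the alternating sum of binomials *)

Section Combinatorics.

Lemma card_between (T : finType) (A S : {set T}) q : A \subset S ->
  #|[pred B : {set T} | [&& A \subset B, B \subset S & #|B| == (#|A| + q)%N]]| =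
  'C(#|S| - #|A|, q).
Proof.
move=> AS; have -> : (#|S| - #|A| = #|S :\: A|)%N.
  by rewrite finset.cardsD (finset.setIidPr AS).
rewrite -cards_draws -(card_in_imset (f := fun B : {set T} => A :|: B)); last first.
  move=> B B'; rewrite !inE => /andP[/finset.subsetDP[_ BA] _] /andP[/finset.subsetDP[_ BA'] _] E.
  have setD (X : {set T}) : [disjoint X & A]%B -> X = (A :|: X) :\: A.
    by move=> XA; rewrite finset.setDUl finset.setDv finset.set0U; apply/esym/finset.setDidPl.
  by rewrite (setD _ BA) E -setD.
apply: eq_card => B; rewrite inE; apply/and3P/imsetP => [[AB BS /eqP Bc]|].
  exists (B :\: A); last first.
    apply/finset.setP => x; rewrite !inE; case: (boolP (x \in A)) => //=.
    by move/(fintype.subsetP AB) ->.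
  by rewrite inE finset.setSD // finset.cardsD (finset.setIidPr AB) Bc addKn /=.
case=> U; rewrite inE => /andP[/finset.subsetDP[US UA] /eqP Uc] ->; split.
- exact: finset.subsetUl.
- by rewrite finset.subUset AS.
- by rewrite finset.cardsU Uc finset.disjoint_setI0 1?disjoint_sym // finset.cards0 subn0.
Qed.

(* The binomial coefficient (s - 2 choose i - 1), where (-1 choose -1) = 1. *)
Definition hook_multiplicity (s i : nat) : nat :=
  if s is s'.+2 then if i is i'.+1 then 'C(s', i') else 0 else (i == 0%N).

(** Induction on [M.+1 - i]: the alternating sums from [i] and from [i.+1] add up to ['C(s.-1, i)],
    as in Pascal's rule. The bound on [s] makes the multiplicity 0 at [i = M.+1], where the sum is
    empty. *)
Lemma alternating_bin (s i M : nat) : (0 < s)%N -> (s <= M.+1)%N -> (i <= M.+1)%N ->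
  \sum_(i <= j < M.+1) (-1) ^+ (j - i) * 'C(s.-1, j)%:Z = (hook_multiplicity s i)%:Z.
Proof.
case: s => // s _ sM; move=> /subnKC; set d := (M.+1 - i)%N; move: d => d.
elim: d i => [|d IH] i idM.
  rewrite big_geq -?idM ?addn0 //; move: idM; rewrite addn0 => ->.
  by case: s sM => [|s] sM //=; rewrite bin_small.
have iM : (i < M.+1)%N by rewrite -idM addnS ltnS leq_addr.
rewrite big_ltn // subnn mul1r.
have -> : \sum_(i.+1 <= j < M.+1) (-1) ^+ (j - i) * 'C(s, j)%:Z =
          - \sum_(i.+1 <= j < M.+1) (-1) ^+ (j - i.+1) * 'C(s, j)%:Z.
  rewrite -sumrN; apply: eq_big_nat => j /andP[ij _].
  by rewrite -(subnSK ij) exprS mulN1r mulNr.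
rewrite [X in - X]IH ?addSnnS //; case: s {IH} sM => [|s] sM /=.
  by rewrite bin0n subr0.
case: i {idM iM} => [|i]; first by rewrite !bin0 subrr.
by rewrite binS PoszD addrC addKr.
Qed.

End Combinatorics.

(** * Simple modules of hooks *)

Section LinearFunctions.
Variables (k : fieldType) (U W : lmodType k) (f : U -> W).
Hypothesis f_lin : linear f.
Let f' : {linear U -> W} := HB.pack f (GRing.isLinear.Build k U W *:%R f f_lin).

Lemma linear_fun_sum (I : Type) (r : seq I) (P : pred I) (F : I -> U) :
  f (\sum_(j <- r | P j) F j) = \sum_(j <- r | P j) f (F j).
Proof. exact: (linear_sum f'). Qed.

Lemma linear_funZ a u : f (a *: u) = a *: f u.
Proof. exact: (linearZZ f'). Qed.

End LinearFunctions.

(** * Free families and polynomials with vector coefficients *)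

Section FreeFamily.
Variables (k : fieldType) (V : lmodType k).

Definition free_fam s (e : 'I_s -> V) :=
  forall c : 'I_s -> k, \sum_(j < s) c j *: e j = 0 -> forall j, c j = 0.

(** A family of least size whose span contains all [w j] is free: a relation with [c j != 0] would
    eliminate [e j]. *)
Lemma free_family r (w : 'I_r -> V) : exists s (e : 'I_s -> V) (A : 'I_r -> 'I_s -> k),
  free_fam e /\ forall j, w j = \sum_(l < s) A j l *: e l.
Proof.
pose P s := exists (e : 'I_s -> V) (A : 'I_r -> 'I_s -> k),
  forall j, w j = \sum_(l < s) A j l *: e l.
have exP : exists s, `[< P s >].
  exists r; apply/asboolP; exists w, (fun j l => (l == j)%:R) => j.
  by rewrite (bigD1 j) //= eqxx scale1r big1 ?addr0 // => l /negbTE ->; rewrite scale0r.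
case: (ex_minnP exP) => s /asboolP[e [A wE]] smin; exists s, e, A; split=> // c c0 j.
apply/eqP; apply: contraT => cj.
case: s e A wE smin c c0 j cj => [|s] e A wE smin c c0 j cj; first by case: (j).
have: (s.+1 <= s)%N; last by rewrite ltnn.
apply: smin; apply/asboolP; exists (fun l => e (fintype.lift j l)).
exists (fun a l => A a (fintype.lift j l) - A a j / c j * c (fintype.lift j l)) => a.
have -> : w a = \sum_(l < s.+1) (A a l - A a j / c j * c l) *: e l.
  under eq_bigr do rewrite scalerBl -scalerA.
  by rewrite sumrB -scaler_sumr c0 scaler0 subr0 -wE.
by rewrite (bigD1_ord j) //= divfK // subrr scale0r add0r.
Qed.

Hypothesis k_infinite : infinite_set [set: k].

(** Coordinates on a free family reduce this to scalar polynomials; [y] is adjoined to the [w j] as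
    index [ord0], so that it has coordinates too. *)
Lemma vpoly_const r (p : 'I_r -> {poly k}) (w : 'I_r -> V) (y : V) :
  (forall z, z != 0 -> \sum_(j < r) (p j).[z] *: w j = y) ->
  \sum_(j < r) (p j).[0] *: w j = y.
Proof.
move=> H; pose w' (j : 'I_r.+1) := if unlift ord0 j is Some j' then w j' else y.
have [s [e [A [efree wE]]]] := free_family w'.
have w'S j : w j = \sum_(l < s) A (fintype.lift ord0 j) l *: e l by rewrite -wE /w' liftK.
have yE : y = \sum_(l < s) A ord0 l *: e l by rewrite -wE /w' unlift_none.
have sumE z : \sum_(j < r) (p j).[z] *: w j - y =
    \sum_(l < s) (\sum_(j < r) A (fintype.lift ord0 j) l *: p j - (A ord0 l)%:P).[z] *: e l.
  under [RHS]eq_bigr do rewrite hornerD hornerN hornerC horner_sum scalerBl scaler_suml.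
  rewrite sumrB -yE exchange_big /=; congr (_ - _); apply: eq_bigr => j _.
  by rewrite w'S scaler_sumr; apply: eq_bigr => l _; rewrite hornerZ scalerA mulrC.
apply/eqP; rewrite -subr_eq0 sumE big1 // => l _.
rewrite (@poly_eq0_units _ k_infinite (_ - _)) ?horner0 ?scale0r // => z z0.
by move: l; apply: efree; rewrite -sumE H // subrr.
Qed.

End FreeFamily.

(** * Highest weight vectors and the linear form they define *)

Section Simple.
Variable k : fieldType.
Hypothesis k_infinite : infinite_set [set: k].
Variable m : nat.
Local Notation n := m.+1.
Local Notation G := (GL k n).
Local Notation wt := 'rV[int]_n.

(** The pairing with the one-parameter subgroup [z -> diag(1, z, z^2, ..)]. It is negative on
    positive roots, so lower weights have larger height. *)
Definition height (mu : wt) : int := \sum_(r < n) r%:Z * mu 0 r.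

Lemma height_lin (mu nu : wt) : height (mu - nu) = height mu - height nu.
Proof.
by rewrite /height -sumrB; apply: eq_bigr => r _; rewrite !mxE mulrBr.
Qed.

Lemma height_eps (r : 'I_n) : height (eps r) = r%:Z.
Proof.
rewrite /height (bigD1 r) //= mxE !eqxx mulr1 big1 ?addr0 // => s sr.
by rewrite mxE (negbTE sr) andbF mulr0.
Qed.

(** The difference of heights is a sum of nonnegative terms, and if it were 0 all coefficients
    [c a b] would vanish. *)
Lemma dominance_height (mu lam : wt) : dominance mu lam -> mu != lam ->
  height lam < height mu.
Proof.
case=> c E ne.
have hsum (I : Type) (rs : seq I) (P : pred I) (f : I -> wt) :
    height (\sum_(x <- rs | P x) f x) = \sum_(x <- rs | P x) height (f x).
  have h0 : height 0 = 0 by rewrite /height big1 // => r _; rewrite mxE mulr0.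
  have hD : {morph height : x y / x + y}.
    move=> x y; rewrite -[y in LHS]opprK height_lin -[- y]sub0r height_lin h0 sub0r.
    by rewrite opprK.
  by rewrite (big_morph _ hD h0).
have hc a b : height ((eps a - eps b) *+ c a b) = (a%:Z - b%:Z) * (c a b)%:Z.
  rewrite -[c a b in LHS]card_ord -sumr_const hsum sumr_const card_ord.
  by rewrite height_lin !height_eps -mulr_natr natz.
have nonneg (a b : 'I_n) : (a < b)%N -> 0 <= (b%:Z - a%:Z) * (c a b)%:Z.
  by move=> ab; apply: Num.Theory.mulr_ge0 => //; lia.
have hE : height mu - height lam =
    \sum_(a < n) \sum_(b < n | (a < b)%N) (b%:Z - a%:Z) * (c a b)%:Z.
  rewrite -[LHS]opprK opprB -height_lin E hsum -sumrN; apply: eq_bigr => a _.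
  by rewrite hsum -sumrN; apply: eq_bigr => b _; rewrite hc -mulNr opprB.
set S := \sum_(a < n) _ in hE.
have S0 : 0 <= S.
  by apply: Num.Theory.sumr_ge0 => a _; apply: Num.Theory.sumr_ge0 => b; exact: nonneg.
suff : S != 0 by lia.
apply: contra ne => /eqP s0; rewrite eq_sym -subr_eq0 E; apply/eqP.
rewrite big1 // => a _; rewrite big1 // => b ab.
have rowge (x : 'I_n) : true -> 0 <= \sum_(y < n | (x < y)%N) (y%:Z - x%:Z) * (c x y)%:Z.
  by move=> _; apply: Num.Theory.sumr_ge0 => y; exact: nonneg.
have /(_ a isT) row0 : forall x : 'I_n, true -> _ := Num.Theory.psumr_eq0P rowge s0.
have /(_ b ab)/eqP : forall y : 'I_n, (a < y)%N -> _ := Num.Theory.psumr_eq0P (nonneg a) row0.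
rewrite mulf_eq0 subr_eq0 eqz_nat => /orP[/eqP E'|]; first by rewrite E' ltnn in ab.
by rewrite eqz_nat => /eqP ->.
Qed.

Lemma regmx_toGL (f : G -> k) : regular_fun f -> regmx (fun M => f (toGL M)).
Proof.
move=> freg; apply/regmxE.
by rewrite (_ : (fun _ => _) = f) //; apply/funext => g; rewrite valGLK.
Qed.

Lemma toGL1 : toGL 1%:M = 1%g :> G.
Proof. exact: (valGLK 1%g). Qed.

Lemma tcharE mu (M : 'M[k]_n) : M \in unitmx -> wchar mu (toGL M) = tchar mu M.
Proof. by move=> Mu; rewrite /wchar toGLK. Qed.

Section HighestWeight.
Variables (V : gmodule k n) (lam : wt) (v0 : V).
Hypotheses (Vrat : rational V) (v0w : weight_space (V := V) lam v0).
Hypothesis dom : forall mu, is_weight V mu -> dominance mu lam.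
Let Vss : torus_semisimple V := rational_semisimple k_infinite Vrat.

(* Conjugating [u] by diag(1, z^-1, z^-2, ..) gives a polynomial curve through
   1 at z = 0, on whose points the weight components of [u v0] get multiplied
   by nonpositive powers of [z]. *)
Lemma unipotent_fix (u : G) : is_trig_mx (val u)^T -> (forall r, val u r r = 1) ->
  gact u v0 = v0.
Proof.
move=> /is_trig_mxP ut u1; have [r [f [w [freg fE]]]] := Vrat v0.
pose C : 'M[{poly k}]_n := \matrix_(a, b)
  if (a <= b)%N then (val u a b)%:P * 'X^(b - a) else 0.
have CE z a b : evalmx C z a b = if (a <= b)%N then val u a b * z ^+ (b - a) else 0.
  by rewrite evalmxE mxE; case: ifP => _; rewrite ?hornerM ?hornerXn ?hornerC.
have detC z : \det (evalmx C z) = 1.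
  rewrite -det_tr det_trig; last first.
    by apply/is_trig_mxP => a b ab; rewrite mxE CE leqNgt ab.
  by rewrite big1 // => a _; rewrite mxE CE leqnn subnn u1 mulr1.
have Cu z : evalmx C z \in unitmx by rewrite unitmxE detC unitr1.
have /choice[p pE] j := regmx_curve1 (regmx_toGL (freg j)) (oner_neq0 k) detC.
have C0 : evalmx C 0 = 1%:M.
  apply/matrixP => a b; rewrite CE mxE; case: ltngtP => ab.
  - rewrite expr0n subn_eq0 leqNgt ab mulr0 //.
    by case: eqP ab => // ->; rewrite ltnn.
  - by case: eqP ab => // ->; rewrite ltnn.
  - by move/ord_inj: ab => ->; rewrite eqxx subnn u1 mulr1.
have sumE nu z : wpart nu (gact (toGL (evalmx C z)) v0) =
    \sum_(j < r) (p j).[z] *: wpart nu (w j).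
  rewrite fE (linear_sum (wpart nu)) /=; apply: eq_bigr => j _.
  by rewrite linearZ /= pE.
have key nu z : z != 0 -> \sum_(j < r) (p j).[z] *: wpart nu (w j) =
    z ^ (height lam - height nu) *: wpart nu (gact u v0).
  move=> z0; pose d : 'rV[k]_n := \row_a z ^+ a.
  have du : diag_mx d \in unitmx.
    rewrite unitmxE det_diag unitfE; apply/prodf_neq0 => a _.
    by rewrite mxE expf_neq0.
  have dd : is_diag_mx (val (toGL (diag_mx d))) by rewrite toGLK // diag_mx_is_diag.
  have dw (mu : wt) : wchar mu (toGL (diag_mx d)) = z ^ height mu.
    rewrite tcharE // /tchar /height; elim/big_rec2: _ => [|a y1 y2 _ ->].
      by rewrite expr0z.
    by rewrite expfzDr // !mxE eqxx mulr1n exprnP exprz_exp.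
  rewrite -sumE.
  have -> : toGL (evalmx C z) = ((toGL (diag_mx d))^-1 * (u * toGL (diag_mx d)))%g.
    apply: (mulgI (toGL (diag_mx d))).
    rewrite mulKVg -toGLM // -[u in RHS]valGLK -toGLM ?(valP u) //.
    congr toGL; apply/matrixP => a b; rewrite mul_diag_mx mul_mx_diag !mxE /horner_eval.
    have := CE z a b; rewrite evalmxE mxE => ->; case: leqP => ab.
      by rewrite mulrCA -exprD subnKC // mulrC mulrC.
    by have := ut b a ab; rewrite mxE => ->; rewrite mulr0 mul0r.
  rewrite !gactM v0w // linearZ /= linearZ /= linearZ /= (wpart_act k_infinite Vss) ?torusV //.
  by rewrite scalerA wcharV // !dw expfzDr // invr_expz.
suff E nu : wpart nu (gact u v0) = wpart nu v0.
  apply/eqP; rewrite -subr_eq0; apply/eqP.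
  have [s _ [-> _]] := wpart_sum k_infinite Vss (gact u v0 - v0).
  apply: big1 => nu _; rewrite addrC -scaleN1r (wpart_is_linear k_infinite Vss) E.
  by rewrite scaleN1r addNr.
pose y := wpart nu (gact u v0).
have [nulam|nulam] := eqVneq nu lam.
  have := vpoly_const k_infinite (p := p) (w := fun j => wpart nu (w j)) (y := y).
  rewrite -sumE C0 toGL1 gact1 => -> // z z0.
  by rewrite key // /y nulam subrr expr0z scale1r.
rewrite (wpart_id k_infinite Vss nu v0w) (negbTE nulam); apply/eqP.
apply: contraT => y0; have /dom nud : is_weight V nu.
  by exists y => //; exact: wpart_weight.
have := dominance_height nud nulam; rewrite -Num.Theory.subr_gt0.
case eE: (height nu - height lam) => [[|e]|e] // _.
(* Below [lam] the exponent is [- e.+1]; clearing this pole and putting [z = 0] shows that the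
   component is 0. *)
have yE : \sum_(j < r) ('X^(e.+1) * p j).[0] *: wpart nu (w j) = y.
  apply: (vpoly_const k_infinite) => z z0.
  under eq_bigr do rewrite hornerM hornerXn -scalerA.
  rewrite -scaler_sumr key // scalerA [z ^+ _]exprnP -expfzDr // -eE.
  by rewrite addrA subrK subrr expr0z scale1r.
case/eqP: y0; apply: etrans (esym yE) _.
by rewrite big1 // => j _; rewrite hornerM hornerXn expr0n mul0r scale0r.
Qed.

(** [b = u t] with [t] its diagonal and [u] unitriangular, and [u] fixes [v0]. *)
Lemma borel_char (b : G) : is_trig_mx (val b)^T -> gact b v0 = wchar lam b *: v0.
Proof.
move=> bt; have := bt => /is_trig_mxP bt'.
have b0 r : val b r r != 0.
  have := valP b; rewrite unitmxE -det_tr det_trig // unitfE.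
  by move/prodf_neq0/(_ r isT); rewrite mxE.
pose d : 'rV[k]_n := \row_r val b r r.
have du : diag_mx d \in unitmx.
  by rewrite unitmxE det_diag unitfE; apply/prodf_neq0 => a _; rewrite mxE.
pose t := toGL (diag_mx d).
have td : is_diag_mx (val t) by rewrite toGLK // diag_mx_is_diag.
have tE r c : val t r c = val b r r *+ (r == c) by rewrite toGLK // !mxE.
pose u := (b * t^-1)%g.
have bE : b = (u * t)%g by rewrite /u mulgKV.
have uE r c : val b r c = val u r c * val b c c.
  rewrite {1}bE [LHS]mxE (bigD1 c) //= big1 ?addr0 => [|s sc].
    by rewrite [val t _ _]tE eqxx mulr1n.
  by rewrite [val t _ _]tE (negbTE sc) mulr0n mulr0.
rewrite bE gactM v0w // linearZ /= unipotent_fix.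
- congr (_ *: _); rewrite /wchar; apply: eq_bigr => r _.
  by rewrite -bE tE eqxx mulr1n.
- apply/is_trig_mxP => r c rc; rewrite mxE.
  have := bt' _ _ rc; rewrite mxE uE => /eqP; rewrite mulf_eq0 (negbTE (b0 _)) orbF.
  by move/eqP.
- by move=> r; have := uE r r; rewrite -{1}[val b r r]mul1r => /(mulIf (b0 r)).
Qed.

End HighestWeight.

Section HookWeight.
Variables (i q : nat).
Hypothesis i_lt : (i.+1 <= n)%N.
Variable lam : wt.
Hypotheses (lamE : hook_like i lam) (lam0 : lam 0 ord0 = q.+1%:Z).

Definition hook_content (r : 'I_n) : nat := ((r <= i) + q * (r == ord0))%N.

Lemma hook_contentE r : lam 0 r = (hook_content r)%:Z.
Proof.
rewrite /hook_content; have [->|r0] := eqVneq r ord0; first by rewrite lam0 muln1 add1n.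
by rewrite lamE // muln0 addn0.
Qed.

Lemma sum_hook_content : (\sum_r hook_content r = q.+1 + i)%N.
Proof.
have := head_set_sum i_lt (fun=> 1%N) 1%g; rewrite sum1_card card_ord => E.
rewrite big_split /= -big_distrr /=.
have -> : (\sum_(r < n) (r == ord0) = 1)%N.
  by rewrite (bigD1 ord0) //= big1 // => r /negbTE ->.
have -> : (\sum_(r < n) (r <= i) = i.+1)%N.
  by rewrite E; apply: eq_bigr => r _; rewrite invg1 perm1 muln1.
by rewrite muln1; lia.
Qed.

Lemma hook_content_admissible : admissible i hook_content 1.
Proof. by move=> l li; rewrite perm1 /hook_content li. Qed.

(** Among the points with [v ord0 = ord0], [weight_bound] kills those whose [v] does not preserve
    the first [i + 1] indices, and [hook_perm] ties the others to [hook_point 1]. *)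
Lemma highest_unique (F : 'M[k]_n -> k) : regmx F -> right_semi lam F ->
  left_semi lam F -> forall g, g \in unitmx ->
  F g = F (hook_point k 1) * hook_fun i_lt hook_content 1 g.
Proof.
move=> Freg Fsemi Fleft g gu; set a := F (hook_point k 1).
pose H g := - a * hook_fun i_lt hook_content 1 g + F g.
suff : H g = 0 by rewrite /H mulNr addrC => /eqP; rewrite subr_eq0 => /eqP.
have Hreg : regmx H by apply: regmx_lin Freg; exact: hook_fun_reg.
have Hsemi : right_semi lam H.
  move=> h b hu bu bt; rewrite /H Fsemi //.
  rewrite (hook_fun_semi i_lt lamE lam0 sum_hook_content hook_content_admissible) //.
  by move: (hook_fun _ _ _ h) => x; ring.
have Hleft : left_semi lam H.
  move=> t h tu td hu; rewrite /H Fleft //.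
  rewrite (hook_fun_left i_lt hook_contentE hook_content_admissible) //.
  by move: (hook_fun _ _ _ h) => x; ring.
apply: (vanish k_infinite lamE (r0 := ord0) Hreg Hsemi Hleft) => // v v0.
have [/existsP[l /and3P[l0 li vl]]|/existsPn nl] :=
  boolP [exists l, [&& l != ord0, (l <= i)%N & ~~ (v l <= i)%N]].
  apply: (weight_bound k_infinite (l := l) Hreg Hsemi Hleft) => //.
  rewrite !lamE // ?li ?(negbTE vl) //.
  by apply: contraNneq vl => ->.
pose A := [set l : 'I_n | (l <= i)%N]%SET.
have vA : v @: A = A.
  apply/eqP; rewrite eqEcard card_imset ?leqnn ?andbT; last exact: perm_inj.
  apply/fintype.subsetP => x /imsetP[l]; rewrite !inE => li ->.
  have [->|l0] := eqVneq l ord0; first by rewrite v0.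
  by have := nl l; rewrite l0 li negbK.
have vi l : (v l <= i)%N = (l <= i)%N.
  have := mem_imset A l (@perm_inj _ v); rewrite vA !inE; exact.
have -> : hook_point k v = hook_point k 1 *m perm_mx v^-1%g.
  rewrite hook_point_rmul ?invgK ?mulg1 //.
  by apply: (@perm_inj _ v); rewrite permKV v0.
apply: (hook_perm k_infinite lamE Hreg Hsemi).
- by apply: (@perm_inj _ v); rewrite permKV v0.
- by move=> l _; rewrite -[in RHS](permKV v l) vi.
- exact: hook_point_unit.
by rewrite /H hook_fun_point hook_minor_point1 mulr1 addNr.
Qed.

Variables (V : gmodule k n) (v0 : V).
Hypotheses (Vrat : rational V) (Vsimple : gsimple V) (v0_neq0 : v0 != 0).
Hypotheses (v0w : weight_space (V := V) lam v0).
Hypothesis dom : forall mu, is_weight V mu -> dominance mu lam.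
Let Vss : torus_semisimple V := rational_semisimple k_infinite Vrat.

Lemma highest_span (v : V) : exists l : seq (k * G), v = \sum_(x <- l) x.1 *: gact x.2 v0.
Proof.
pose U : set V := [set v | exists l : seq (k * G), v = \sum_(x <- l) x.1 *: gact x.2 v0].
have [|U0|UT] := Vsimple.2 U.
- split.
  + by exists [::]; rewrite big_nil.
  + move=> a _ _ [l ->] [l' ->]; exists ([seq (a * x.1, x.2) | x <- l] ++ l').
    by rewrite big_cat big_map scaler_sumr; congr (_ + _); apply: eq_bigr => x _; rewrite scalerA.
  + move=> g _ [l ->]; exists [seq (x.1, (g * x.2)%g) | x <- l].
    by rewrite big_map linear_sum; apply: eq_bigr => x _; rewrite linearZ /= gactM.
- have : U v0 by exists [:: (1, 1%g)]; rewrite big_seq1 scale1r gact1.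
  by rewrite U0 => /eqP; rewrite (negbTE v0_neq0).
by have : U v by rewrite UT.
Qed.

(** The coordinates of the left side on a free family are semi-invariant of weight [lam] on both
    sides, so [highest_unique] makes it a multiple of one vector; [g = 1] identifies that vector
    with [v0]. *)
Lemma highest_part (g : G) :
  wpart lam (gact g v0) = hook_fun i_lt hook_content 1 (val g) *: v0.
Proof.
have [r [f [w [freg fE]]]] := Vrat v0.
have [s [e [A [efree wE]]]] := free_family (fun j => wpart lam (w j)).
pose F l (M : 'M[k]_n) := \sum_(j < r) A j l * f j (toGL M).
have FE (x : G) : wpart lam (gact x v0) = \sum_(l < s) F l (val x) *: e l.
  rewrite fE (linear_fun_sum (wpart_is_linear k_infinite Vss lam)).
  under eq_bigr do rewrite (linear_funZ (wpart_is_linear k_infinite Vss lam)) wE scaler_sumr.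
  rewrite exchange_big; apply: eq_bigr => l _; rewrite /F scaler_suml.
  by apply: eq_bigr => j _; rewrite scalerA mulrC valGLK.
have Freg l : regmx (F l) by apply: regmx_sum => j _; exact: regmx_toGL.
have eq_coord (a b : 'I_s -> k) : \sum_(l < s) a l *: e l = \sum_(l < s) b l *: e l ->
    forall l, a l = b l.
  move=> E l; apply/eqP; rewrite -subr_eq0; apply/eqP; move: l; apply: efree.
  by under eq_bigr do rewrite scalerBl; rewrite sumrB E subrr.
have coord (a : k) (x y : G) : wpart lam (gact x v0) = a *: wpart lam (gact y v0) ->
    forall l, F l (val x) = a * F l (val y).
  rewrite !FE scaler_sumr => E; apply: eq_coord; rewrite E.
  by apply: eq_bigr => l _; rewrite scalerA.
have Fsemi l : right_semi lam (F l).
  move=> M b Mu bu bt; rewrite -(toGLK Mu) -(toGLK bu) -[_ *m _]/(val (toGL M * toGL b)%g).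
  have -> : tchar lam (val (toGL b)) = wchar lam (toGL b) by [].
  apply: coord; rewrite gactM (borel_char Vrat v0w dom) ?toGLK //.
  by rewrite linearZ /= (linear_funZ (wpart_is_linear k_infinite Vss lam)).
have Fleft l : left_semi lam (F l).
  move=> t M tu td Mu; rewrite -(toGLK Mu) -(toGLK tu) -[_ *m _]/(val (toGL t * toGL M)%g).
  have -> : tchar lam (val (toGL t)) = wchar lam (toGL t) by [].
  by apply: coord; rewrite gactM (wpart_act k_infinite Vss) // toGLK.
have gE (x : G) : wpart lam (gact x v0) = hook_fun i_lt hook_content 1 (val x) *:
    \sum_(l < s) F l (hook_point k 1) *: e l.
  rewrite FE scaler_sumr; apply: eq_bigr => l _.
  by rewrite (highest_unique (Freg l) (Fsemi l) (Fleft l) (valP x)) scalerA mulrC.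
rewrite gE; congr (_ *: _); have := gE 1%g; rewrite gact1 (wpart_id k_infinite Vss lam v0w) eqxx.
(* The zeros in the first column of the identity occur with exponent 0. *)
suff -> : hook_fun i_lt hook_content 1 (val (1%g : G)) = 1 by rewrite scale1r => <-.
rewrite /hook_fun big1 => [|x _].
  rewrite mul1r /hook_minor; set D := \matrix_(_, _) _; suff -> : D = 1%:M by rewrite det1.
  by apply/matrixP => a b; rewrite !mxE perm1 -!val_eqE.
rewrite invg1 perm1 /hook_content mxE; case: eqP => _; first by rewrite expr1n.
by rewrite muln0 addn0 subnn.
Qed.

(** [phi] is the coefficient of [v0] in the component of weight [lam]. The vectors whose translates
    it all kills form a submodule that misses [v0], hence 0. *)
Lemma simple_form : exists phi : {linear V -> k^o}, [/\
  forall g, phi (gact g v0) = hook_fun i_lt hook_content 1 (val g) &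
  forall v, (forall x, phi (gact x v) = 0) -> v = 0].
Proof.
have /choice[phi phiE] v : exists c : k, wpart lam v = c *: v0.
  have [l ->] := highest_span v; rewrite (linear_fun_sum (wpart_is_linear k_infinite Vss lam)).
  exists (\sum_(x <- l) x.1 * hook_fun i_lt hook_content 1 (val x.2)).
  rewrite scaler_suml; apply: eq_bigr => x _.
  by rewrite (linear_funZ (wpart_is_linear k_infinite Vss lam)) highest_part scalerA.
have v0inj (a b : k) : a *: v0 = b *: v0 -> a = b.
  move/eqP; rewrite -subr_eq0 -scalerBl scaler_eq0 (negbTE v0_neq0) orbF subr_eq0.
  by move/eqP.
have phil : linear (phi : V -> k^o).
  move=> a u v; apply: v0inj; rewrite -phiE (wpart_is_linear k_infinite Vss) !phiE.
  by rewrite scalerDl scalerA.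
pose ph : {linear V -> k^o} := HB.pack (phi : V -> k^o)
  (GRing.isLinear.Build k V k^o *:%R (phi : V -> k^o) phil).
exists ph; split=> [g|v v_eq0].
  by apply: v0inj; rewrite -phiE highest_part.
pose U : set V := [set v | forall x, ph (gact x v) = 0].
have [|U0|UT] := Vsimple.2 U.
- split.
  + by move=> x; rewrite !linear0.
  + by move=> a u w uU wU x; rewrite (gact_linear x) linearP uU wU scaler0 addr0.
  + by move=> g u uU x; rewrite -gactM.
- by have : U v by []; rewrite U0.
have : U v0 by rewrite UT.
move=> /(_ 1%g); rewrite gact1 /= => ph0; have := phiE v0.
by rewrite (wpart_id k_infinite Vss lam v0w) eqxx ph0 scale0r => /eqP; rewrite (negbTE v0_neq0).
Qed.

End HookWeight.

End Simple.

(** * Coefficients of a power of the sum of variables times a determinant *)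

Section CoefficientFormula.

(** Multilinearity in the rows: the Cauchy-Binet expansion before equal row sets are collected. *)
Lemma det_expand (R : comNzRingType) (I : finType) d (x : 'I_d -> I -> R) (y : I -> R)
    (g : I -> 'I_d -> R) :
  \det (\matrix_(a < d, b < d) \sum_r x a r * y r * g r b) =
  \sum_(h : {ffun 'I_d -> I}) (\prod_a x a (h a)) * (\prod_a y (h a)) *
    \det (\matrix_(a, b) g (h a) b).
Proof.
rewrite /determinant.
under [LHS]eq_bigr => s _.
  under eq_bigr do rewrite mxE.
  rewrite bigA_distr_bigA mulr_sumr.
over.
rewrite exchange_big; apply: eq_bigr => h _; rewrite mulr_sumr.
apply: eq_bigr => s _; rewrite !big_split /=.
under [X in _ = _ * (_ * X)]eq_bigr do rewrite mxE.
by rewrite mulrCA.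
Qed.

Variables (R : comNzRingType) (n : nat).
Implicit Types (P : {mpoly R[n]}) (e : 'X_{1..n}).

(** The partial derivative of order [e] at 0. The factorials absorb the multinomial coefficients, so
    no division is required in characteristic [p]. *)
Definition mfact_coef e P : R := (\prod_(r < n) (e r)`!)%:R * P@_e.

Lemma mfact_coef_lin e : additive (mfact_coef e).
Proof. by move=> P Q; rewrite /mfact_coef mcoeffB mulrBr. Qed.

HB.instance Definition _ e := 
  GRing.isAdditive.Build {mpoly R[n]} R (mfact_coef e) (mfact_coef_lin e).

Lemma mcoeffXU_mul P (r : 'I_n) e :
  ('X_r * P)@_e = if (0 < e r)%N then P@_(e - U_(r)) else 0.
Proof.
rewrite -commr_mpolyX; case: ifP => er.
  by rewrite -[e in LHS](submK (m := U_(r)%MM)) ?lep1mP -?lt0n // addmC mcoeffMX.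
apply/eqP; move: er; apply: contraFT; rewrite -mcoeff_msupp (perm_mem (msuppMX _ _)).
by case/mapP => e' _ ->; rewrite mnmDE mnm1E eqxx.
Qed.

Lemma mfact_coefX P (r : 'I_n) e :
  mfact_coef e ('X_r * P) = (e r)%:R * mfact_coef (e - U_(r)) P.
Proof.
rewrite /mfact_coef mcoeffXU_mul; case: posnP => [->|er].
  by rewrite mulr0 mul0r.
rewrite mulrA -natrM; congr (_%:R * _).
rewrite (bigD1 r) //= [in RHS](bigD1 r) //= mulnA mnmBE mnm1E eqxx subn1.
rewrite -{1}(prednK er) factS prednK //; congr (_ * _)%N.
by apply: eq_bigr => s sr; rewrite mnmBE mnm1E eq_sym (negbTE sr) subn0.
Qed.

Lemma mfact_coef_pow q e : mdeg e = q ->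
  mfact_coef e ((\sum_(r < n) 'X_r) ^+ q) = (q`!)%:R.
Proof.
elim: q e => [|q IH] e eq.
  move/eqP: eq; rewrite mdeg_eq0 => /eqP ->; rewrite /mfact_coef expr0 mcoeff1 eqxx mulr1.
  by rewrite big1 // => r _; rewrite mnm0E.
rewrite exprS mulr_suml raddf_sum /=.
have E r : mfact_coef e ('X_r * (\sum_(s < n) 'X_s) ^+ q) = (e r * q`!)%:R.
  rewrite mfact_coefX; case: (posnP (e r)) => [->|er]; first by rewrite mul0r mul0n.
  rewrite IH ?natrM //; have := congr1 (@mdeg n) (submK (m := U_(r)%MM) (m' := e) _).
  by rewrite lep1mP -lt0n er mdegD mdeg1 eq addn1 => /(_ isT) [].
by rewrite (eq_bigr _ (fun r _ => E r)) -natr_sum -big_distrl /= -mdegE eq -factS.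
Qed.

Lemma mfact_coef_prod (rs : seq 'I_n) P e : uniq rs ->
  mfact_coef e ((\prod_(r <- rs) 'X_r) * P) =
  (\prod_(r <- rs) e r)%:R * mfact_coef (e - \sum_(r <- rs) U_(r))%MM P.
Proof.
elim: rs e => [|r rs IH] e /=.
  by rewrite !big_nil !mul1r => _; rewrite subm0.
case/andP=> rrs urs; rewrite !big_cons -mulrA mfact_coefX IH // mulrA -natrM submDA.
congr ((_ * _)%:R * _); apply: eq_big_seq => s srs.
rewrite mnmBE mnm1E; case: eqP => [E|]; last by rewrite subn0.
by move: rrs; rewrite E srs.
Qed.

(** A selection [h] of rows with a repetition has zero minor, so only products of distinct variables
    remain. Extracting them yields the factors [e (h a)], and the power of the sum contributes [q!]
    whatever exponent is left. *)
Lemma mfact_coef_det q d (x : 'I_d -> 'I_n -> R) (g : 'I_n -> 'I_d -> R) e :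
  mdeg e = (q + d)%N ->
  mfact_coef e ((\sum_(r < n) 'X_r) ^+ q *
    \det (\matrix_(a < d, b < d) \sum_r (x a r)%:MP * 'X_r * (g r b)%:MP)) =
  (q`!)%:R * \det (\matrix_(a < d, b < d) \sum_r x a r * (e r)%:R * g r b).
Proof.
move=> eq; rewrite !det_expand !mulr_sumr raddf_sum /=; apply: eq_bigr => h _.
have -> : \det (\matrix_(a, b) (g (h a) b)%:MP) =
    (\det (\matrix_(a < d, b < d) g (h a) b))%:MP :> {mpoly R[n]}.
  by rewrite -det_map_mx; congr (\det _); apply/matrixP => a b; rewrite !mxE.
have -> : \prod_a (x a (h a))%:MP = (\prod_a x a (h a))%:MP :> {mpoly R[n]}.
  by rewrite rmorph_prod.
have mZ (c : R) P : mfact_coef e (c%:MP * P) = c * mfact_coef e P.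
  by rewrite /mfact_coef mul_mpolyC mcoeffZ mulrCA.
set X := \sum_(r < n) _; set c1 := \prod_a x _ _; set D := \det _.
have -> : X ^+ q * (c1%:MP * (\prod_a 'X_(h a)) * D%:MP) =
    (c1 * D)%:MP * ((\prod_a 'X_(h a)) * X ^+ q) by rewrite mpolyCM; ring.
rewrite mZ; case: (boolP (injectiveb h)) => [/injectiveP hi|/injectivePn[a [b ab hab]]].
  have pE (T : Type) (idx : T) (op : Monoid.com_law idx) (F : 'I_n -> T) :
      \big[op/idx]_a F (h a) = \big[op/idx]_(r <- codom h) F r.
    by rewrite big_map big_enum.
  have hu : uniq (codom h) by exact/injectiveP.
  rewrite (pE _ _ _ (fun r => 'X_r)) mfact_coef_prod //.
  rewrite (pE _ _ _ (fun r => (e r)%:R)) -natr_prod.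
  (* If an extracted exponent is 0, the truncated difference has the wrong degree, but both sides
     then carry the factor 0. *)
  case: (posnP (\prod_(r <- codom h) e r)%N) => [->|pos].
    by rewrite mul0r !mulr0 mul0r mulr0.
  rewrite mfact_coef_pow; first by ring.
  have le : (\sum_(r <- codom h) U_(r) <= e)%MM.
    apply/mnm_lepP => s; rewrite mnm_sumE.
    have [sh|sh] := boolP (s \in codom h).
      rewrite (bigD1_seq s) //= mnm1E eqxx big1 ?addn0.
        move: pos; rewrite (bigD1_seq s) //= muln_gt0.
        by case/andP.
      by move=> r rs; rewrite mnm1E (negbTE rs).
    rewrite big1_seq // => r /andP[_ rh]; rewrite mnm1E.
    by case: eqP => // E; rewrite -E rh in sh.
  apply/eqP; rewrite -(eqn_add2r d) -eq; apply/eqP.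
  rewrite -[in RHS](submK le) mdegD mdeg_sum; congr (_ + _)%N.
  under eq_bigr do rewrite mdeg1.
  by rewrite sum1_size size_codom card_ord.
rewrite /D (determinant_alternate ab) ?mulr0 ?mul0r ?mulr0 // => l.
by rewrite !mxE hab.
Qed.

End CoefficientFormula.

(** * Weight multiplicities of L at a hook *)

Section SimpleWeights.
Variable k : fieldType.
Hypothesis k_infinite : infinite_set [set: k].
Variables (m i q : nat).
Local Notation n := m.+1.
Local Notation G := (GL k n).
Local Notation wt := 'rV[int]_n.
Hypothesis i_lt : (i.+1 <= n)%N.
Local Notation wd := (widen_ord i_lt).
Variable lam : wt.
Hypotheses (lamE : hook_like i lam) (lam0 : lam 0 ord0 = q.+1%:Z).
Variables (V : gmodule k n) (v0 : V).
Hypotheses (Vrat : rational V) (v0w : weight_space (V := V) lam v0).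
Hypothesis dom : forall mu, is_weight V mu -> dominance mu lam.
Let Vss : torus_semisimple V := rational_semisimple k_infinite Vrat.
Variable phi : {linear V -> k^o}.
Hypothesis phiE : forall g, phi (gact g v0) = hook_fun i_lt (hook_content i q) 1 (val g).
Hypothesis phi_sep : forall v, (forall x, phi (gact x v) = 0) -> v = 0.
Hypothesis v0_span : forall v, exists l : seq (k * G), v = \sum_(x <- l) x.1 *: gact x.2 v0.

Let plin mu := wpart_is_linear k_infinite Vss mu.

(** As functions of [M] these coefficients are regular, of right weight [lam] and left weight [mu]:
    this is how semi-invariants control [V]. *)
Lemma matrix_coef_reg (mu : wt) (x : G) :
  regmx (fun M => phi (gact x (wpart mu (gact (toGL M) v0))) : k).
Proof.
have [r [f [w [freg fE]]]] := Vrat v0.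
rewrite (_ : (fun _ => _) = fun M =>
  \sum_(j < r) (phi (gact x (wpart mu (w j))) : k) * f j (toGL M)); last first.
  apply/funext => M; rewrite fE (linear_fun_sum (plin mu)) !linear_sum.
  apply: eq_bigr => j _; rewrite (linear_funZ (plin mu)) !linearZ /=.
  by rewrite mulrC.
by apply: regmx_sum => j _; exact: regmx_toGL.
Qed.

Lemma matrix_coef_semi (mu : wt) (x : G) :
  right_semi lam (fun M => phi (gact x (wpart mu (gact (toGL M) v0))) : k).
Proof.
move=> g b gu bu bt; rewrite toGLM // gactM.
rewrite (borel_char k_infinite Vrat v0w dom); last by rewrite toGLK.
by rewrite linearZ /= (linear_funZ (plin mu)) !linearZ /= tcharE.
Qed.

Lemma matrix_coef_left (mu : wt) (x : G) :
  left_semi mu (fun M => phi (gact x (wpart mu (gact (toGL M) v0))) : k).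
Proof.
move=> t g tu td gu; rewrite toGLM // gactM.
rewrite (wpart_act k_infinite Vss); last by rewrite toGLK.
by rewrite !linearZ /= tcharE.
Qed.

Lemma weight_part_bad (mu : wt) g :
  (exists s, mu 0 s < 0) \/ \sum_r mu 0 r != \sum_r lam 0 r -> wpart mu (gact g v0) = 0.
Proof.
move=> bad; apply: phi_sep => x; rewrite -[g]valGLK.
have Freg := matrix_coef_reg mu x; have Fs := matrix_coef_semi mu x.
have Fl := matrix_coef_left mu x.
case: bad => [[s s0]|ne]; last exact: (weight_sum k_infinite Freg Fs Fl ne (valP g)).
by apply: (weight_ge0 k_infinite lamE Freg Fs Fl _ s0 (valP g)); rewrite lam0.
Qed.

Lemma weight_space_span (mu : wt) (v : V) : weight_space (V := V) mu v ->
  exists l : seq (k * G), v = \sum_(x <- l) x.1 *: wpart mu (gact x.2 v0).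
Proof.
move=> vw; have [l vE] := v0_span v; exists l.
rewrite -[LHS](_ : wpart mu v = v); last by rewrite (wpart_id k_infinite Vss mu vw) eqxx.
rewrite vE (linear_fun_sum (plin mu)); apply: eq_bigr => x _.
by rewrite (linear_funZ (plin mu)).
Qed.

Lemma simple_weight_dim_bad (mu : wt) :
  (exists s, mu 0 s < 0) \/ \sum_r mu 0 r != \sum_r lam 0 r ->
  subspace_dim (weight_space (V := V) mu) = 0%N.
Proof.
move=> bad; rewrite -(@card0 'I_0); apply: (subspace_dimE (e := fun=> 0 : V)) => //.
move=> v /weight_space_span[l ->]; exists (fun=> 0); rewrite [RHS]big_pred0 //.
by rewrite big1 // => x _; rewrite weight_part_bad ?scaler0.
Qed.

Section GoodWeight.
Variables (mu : wt) (c : 'I_n -> nat) (r0 : 'I_n).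
Hypotheses (muE : forall r, mu 0 r = (c r)%:Z) (csum : (\sum_r c r = q.+1 + i)%N).
Hypothesis cr0 : (0 < c r0)%N.

Definition weight_vector (T : {set 'I_n}) : V :=
  wpart mu (gact (toGL (hook_point k (enum_perm i r0 T))) v0).

(** [hook_expansion] holds for every matrix coefficient, and the translates of [phi] separate
    vectors. *)
Lemma weight_part_expansion (g : G) : wpart mu (gact g v0) =
  \sum_(T in hook_index i mu r0) hook_fun i_lt c (enum_perm i r0 T) (val g) *: weight_vector T.
Proof.
apply/eqP; rewrite -subr_eq0; apply/eqP/phi_sep => x.
rewrite linearB /= linearB /=; apply/eqP; rewrite subr_eq0; apply/eqP.
rewrite !linear_sum /=.
have := hook_expansion k_infinite i_lt lamE lam0 muE csum cr0 (matrix_coef_reg mu x)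
  (matrix_coef_semi mu x) (matrix_coef_left mu x) (valP g).
rewrite valGLK => ->; apply: eq_bigr => T _.
by rewrite !linearZ /= mulrC.
Qed.

Lemma weight_space_span_vectors (v : V) : weight_space (V := V) mu v ->
  exists a : {set 'I_n} -> k, v = \sum_(T in hook_index i mu r0) a T *: weight_vector T.
Proof.
case/weight_space_span => l ->.
exists (fun T => \sum_(x <- l) x.1 * hook_fun i_lt c (enum_perm i r0 T) (val x.2)).
under eq_bigr do rewrite weight_part_expansion scaler_sumr.
rewrite exchange_big; apply: eq_bigr => T _; rewrite scaler_suml.
by apply: eq_bigr => x _; rewrite scalerA.
Qed.

Lemma weight_vector_weight T : weight_space (V := V) mu (weight_vector T).
Proof. exact: wpart_weight. Qed.

(** By density the first row of [x] has no zero; making it all ones splits off a right diagonal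
    factor, which acts on [v] by a scalar. *)
Lemma separate_row_one (v : V) : weight_space (V := V) mu v ->
  (forall x : G, (forall r, val x ord0 r = 1) -> phi (gact x v) = 0) -> v = 0.
Proof.
move=> vw H; apply: phi_sep => x; rewrite -[x]valGLK.
have Freg : regmx (fun M => phi (gact (toGL M) v) : k).
  have [r [f [w [freg fE]]]] := Vrat v.
  rewrite (_ : (fun _ => _) = fun M => \sum_(j < r) (phi (w j) : k) * f j (toGL M)).
    by apply: regmx_sum => j _; exact: regmx_toGL.
  apply/funext => M; rewrite fE linear_sum; apply: eq_bigr => j _.
  by rewrite linearZ /= mulrC.
apply: (regmx_dense k_infinite Freg _ (valP x)) => M Mu M0.
pose d : 'rV[k]_n := \row_r M ord0 r.
pose M' : 'M[k]_n := \matrix_(r, s) (M r s / M ord0 s).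
have ME : M = M' *m diag_mx d.
  by apply/matrixP => r s; rewrite mul_mx_diag !mxE divfK.
have := Mu; rewrite {1}ME unitmx_mul => /andP[M'u du].
rewrite ME toGLM // gactM vw; last by rewrite toGLK // diag_mx_is_diag.
rewrite !linearZ /= H ?scaler0 // => r.
by rewrite toGLK // mxE divff.
Qed.

(* Both sides are extracted from the matrix coefficient [phi (x t g v0)], a
   polynomial in the entries of the diagonal matrix [t]. *)
Lemma weight_part_formula (x g : G) :
  (forall r, val x ord0 r = 1) -> (forall r, val g r ord0 = 1) ->
  (\prod_r (c r)`!)%:R * phi (gact x (wpart mu (gact g v0))) =
  (q`!)%:R * \det (\matrix_(a < i.+1, b < i.+1)
     \sum_r val x (wd a) r * (c r)%:R * val g r (wd b)) :> k.
Proof.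
move=> x1 g1.
(* The sum of the variables stands for the corner entry of [x t g], because the first row of [x] and
   the first column of [g] are all ones. *)
pose P : {mpoly k[n]} := (\sum_(r < n) 'X_r) ^+ q *
  \det (\matrix_(a < i.+1, b < i.+1)
    \sum_r (val x (wd a) r)%:MP * 'X_r * (val g r (wd b))%:MP).
pose e : 'X_{1..n} := [multinom c r | r < n].
have edeg : mdeg e = (q + i.+1)%N.
  by rewrite mdegE (eq_bigr c) ?csum ?addSnnS // => r _; rewrite mnmE.
have <- : mfact_coef e P = (q`!)%:R * \det (\matrix_(a < i.+1, b < i.+1)
     \sum_r val x (wd a) r * (c r)%:R * val g r (wd b)).
  rewrite mfact_coef_det //; congr (_ * \det _); apply/matrixP => a b.
  by rewrite !mxE; apply: eq_bigr => r _; rewrite mnmE.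
rewrite /mfact_coef; congr (_%:R * _); first by apply: eq_bigr => r _; rewrite mnmE.
pose wof (e : 'X_{1..n}) : wt := \row_r (e r)%:Z.
have wof_inj : injective wof.
  move=> e1 e2 /rowP E; apply/mnmP => r; have := E r; rewrite !mxE => /eqP.
  by rewrite eqz_nat => /eqP.
have wofe : wof e = mu by apply/rowP => r; rewrite mxE mnmE muE.
have evP (t : G) : is_diag_mx (val t) ->
    phi (gact (x * t * g)%g v0) = \sum_(e' <- msupp P) P@_e' * wchar (wof e') t :> k.
  move=> td; rewrite phiE.
  transitivity (P.@[fun r => val t r r]); last first.
    rewrite mevalE; apply: eq_bigr => e' _; congr (_ * _); apply: eq_bigr => r _.
    by rewrite mxE.
  have entE a b : val (x * t * g)%g a b = \sum_r val x a r * val t r r * val g r b.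
    rewrite [LHS]mxE; apply: eq_bigr => r _; congr (_ * _).
    rewrite mxE (bigD1 r) //= big1 ?addr0 // => s sr.
    by have /is_diag_mxP -> := td; rewrite ?mulr0 // val_eqE.
  move: (val (x * t * g)%g) entE => N entE.
  rewrite /P mevalM rmorphXn raddf_sum /= /hook_fun (bigD1 ord0) //= big1 ?mulr1.
    congr (_ * _).
      rewrite invg1 perm1 /hook_content eqxx muln1 addKn; congr (_ ^+ _).
      rewrite entE; apply: eq_bigr => r _.
      by rewrite x1 g1 mul1r mulr1 mevalXU.
    rewrite -det_map_mx /hook_minor; congr (\det _); apply/matrixP => a b.
    rewrite [LHS]mxE !perm1 entE [RHS]mxE [in RHS]mxE raddf_sum; apply: eq_bigr => r _.
    by rewrite /= !mevalM !mevalC mevalXU.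
  move=> r /negbTE r0'; rewrite invg1 perm1 /hook_content r0' muln0 addn0 subnn.
  by rewrite expr0.
have [s us [gE sE]] := wpart_sum k_infinite Vss (gact g v0).
(* One combination of torus elements isolates [mu] among the weights of [g v0] and the exponents of
   [P] at once. *)
have mul : mu \notin [seq nu <- s ++ [seq wof e' | e' <- msupp P] | nu != mu].
  by rewrite mem_filter eqxx.
have [l [ld l1 l0]] := artin_dual k_infinite mul.
have dual nu : nu \in s ++ [seq wof e' | e' <- msupp P] ->
    \sum_(y <- l) y.1 * wchar nu y.2 = (nu == mu)%:R.
  move=> nus; case: (eqVneq nu mu) => [->|ne]; first by rewrite l1.
  by rewrite l0 // mem_filter ne.
transitivity (\sum_(y <- l) y.1 * phi (gact (x * y.2 * g)%g v0) : k).
  have key (y : k * G) : y \in l -> phi (gact (x * y.2 * g)%g v0) =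
      \sum_(nu <- s) wchar nu y.2 * phi (gact x (wpart nu (gact g v0))) :> k.
    move=> yl; rewrite 2!gactM [in LHS]gE !linear_sum; apply: eq_bigr => nu _.
    have /(_ y.2 (ld _ yl)) /= -> : weight_space (V := V) nu (wpart nu (gact g v0)).
      exact: wpart_weight.
    by rewrite linearZ /= linearZ.
  under [RHS]eq_big_seq => y yl.
    rewrite key // mulr_sumr.
    under eq_bigr do rewrite mulrA.
  over.
  rewrite exchange_big /=.
  under eq_big_seq => nu nus.
    rewrite -mulr_suml dual ?mem_cat ?nus //.
  over.
  have [mus|mus] := boolP (mu \in s).
    rewrite (bigD1_seq mu) //= eqxx mul1r big1 ?addr0 // => nu /negbTE ->.
    by rewrite mul0r.
  rewrite sE // !linear0 big1_seq // => nu /andP[_ nus].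
  case: eqP => [E|_]; last by rewrite mul0r.
  by move: mus; rewrite -E nus.
under eq_big_seq => y yl do rewrite evP ?ld // mulr_sumr.
rewrite exchange_big /=.
transitivity (\sum_(e' <- msupp P) P@_e' * (e' == e)%:R).
  apply: eq_big_seq => e' e's; under eq_bigr do rewrite mulrCA.
  rewrite -mulr_sumr dual ?mem_cat ?map_f ?orbT //.
  by rewrite -wofe (inj_eq wof_inj).
have [es|es] := boolP (e \in msupp P).
  rewrite (bigD1_seq e) //= eqxx mulr1 big1 ?addr0 // => e' /negbTE ->.
  by rewrite mulr0.
rewrite (memN_msupp_eq0 es) big1_seq // => e' /andP[_ e's].
case: eqP => [E|_]; last by rewrite mulr0.
by move: es; rewrite -E e's.
Qed.

Lemma card_hook_index : #|hook_index i mu r0| = 'C(#|wsupport mu|.-1, i).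
Proof.
have r0s : [set r0]%SET \subset wsupport mu.
  by rewrite finset.sub1set inE muE eqz_nat -lt0n.
rewrite -subn1 -(cards1 r0) -card_between //; apply: eq_card => T.
by rewrite !inE finset.sub1set cards1 add1n.
Qed.

Variable p : nat.
Hypotheses (p_char : p \in [pchar k]) (pE : p = (q.+1 + i)%N).

Lemma natr_neq0 d : (0 < d)%N -> (d < p)%N -> d%:R != 0 :> k.
Proof. by move=> d0 dp; rewrite -(dvdn_pcharf p_char) gtnNdvd. Qed.

Lemma fact_neq0 d : (d < p)%N -> (d`!)%:R != 0 :> k.
Proof.
elim: d => [|d IH] dp; first by rewrite oner_eq0.
rewrite factS natrM; apply: mulf_neq0; first exact: natr_neq0.
by apply: IH; exact: ltnW.
Qed.

Lemma sum_content_natr : \sum_r (c r)%:R = 0 :> k.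
Proof. by rewrite -natr_sum csum -pE; apply/eqP; rewrite -(dvdn_pcharf p_char). Qed.

Lemma hook_fun_ones w (g : 'M[k]_n) : (forall r, g r ord0 = 1) ->
  hook_fun i_lt c w g = hook_minor i_lt w g.
Proof. by move=> g1; rewrite /hook_fun big1 ?mul1r // => r _; rewrite g1 expr1n. Qed.

Section TwoRows.
Variable r1 : 'I_n.
Hypotheses (r10 : r1 != r0) (cr1 : (0 < c r1)%N).

(** Two nonzero parts of a composition of [p] make every part smaller than [p]. *)
Lemma content_lt r : (c r < p)%N.
Proof.
have [r' rr' cr'] : exists2 r', r' != r & (0 < c r')%N.
  by have [->|] := eqVneq r r0; [exists r1|exists r0; rewrite // eq_sym].
rewrite pE -csum (bigD1 r) //= (bigD1 r') //=.
by rewrite -[X in (X < _)%N]addn0 ltn_add2l addn_gt0 cr'.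
Qed.

Lemma weight_part_eq0 (g : G) : (forall r, val g r ord0 = 1) ->
  (forall b : 'I_i.+1, \sum_r (c r)%:R * val g r (wd b) = 0) ->
  wpart mu (gact g v0) = 0.
Proof.
move=> g1 g0; apply: separate_row_one; first exact: wpart_weight.
move=> x x1; have := weight_part_formula x1 g1.
set D := \det _; have -> : D = 0.
  rewrite /D (expand_det_row _ ord0) big1 // => b _; rewrite mxE.
  have wd0 : wd ord0 = ord0 by exact: val_inj.
  rewrite wd0; suff -> : \sum_r val x ord0 r * (c r)%:R * val g r (wd b) = 0.
    by rewrite mul0r.
  by rewrite -[RHS](g0 b); apply: eq_bigr => r _; rewrite x1 mul1r.
move/eqP; rewrite mulr0 mulf_eq0 natr_prod => /orP[|/eqP //].
rewrite prodf_seq_eq0 => /hasP[r _].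
by rewrite (negbTE (fact_neq0 (content_lt r))).
Qed.

(* As \sum_r mu_r = p = 0 in k, the all-ones column and the columns
   e_{w l} - (mu_{w l} / mu_{r1}) e_{r1} are orthogonal to mu, so that the first
   row of the determinant in [weight_part_formula] vanishes. *)
Lemma eliminate_row (T : {set 'I_n}) : T \in hook_index i mu r0 -> r1 \notin T ->
  exists a : {set 'I_n} -> k,
    weight_vector T = \sum_(T' in hook_index i mu r0 | r1 \in T') a T' *: weight_vector T'.
Proof.
move=> Tin r1T; have := Tin; rewrite inE => /and3P[rT _ /eqP Tc].
have [e0 eT] := enum_permP i_lt rT Tc.
set w := enum_perm i r0 T in e0 eT.
pose s := (w^-1)%g r1; have ws : w s = r1 by rewrite permKV.
have si : (i < s)%N by rewrite ltnNge -eT ws.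
have s0 : s != ord0 by rewrite -lt0n; apply: leq_ltn_trans si.
pose coef (l : 'I_n) : k := if (l != ord0) && (l <= i)%N then (c (w l))%:R / (c r1)%:R else 0.
(* From column [l], [0 < l <= i], the multiple [coef l] of column [s] is subtracted, the latter
   being the unit vector of [r1]. As [s > i], this is a lower unitriangular factor. *)
pose E : 'M[k]_n := \matrix_(a, l) ((a == l)%:R - (a == s)%:R * coef l).
have Eu : E \in unitmx.
  rewrite unitmxE det_trig.
    rewrite big1 ?unitr1 // => l _; rewrite mxE eqxx /coef.
    case: (eqVneq l s) => [->|_]; last by rewrite mul0r subr0.
    by rewrite (leqNgt s) si andbF mulr0 subr0.
  apply/is_trig_mxP => a l al; rewrite mxE; have -> : (a == l) = false.
    by apply: contraTF al => /eqP ->; rewrite ltnn.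
  case: (eqVneq a s) => [E'|_]; last by rewrite mul0r subr0.
  have il : (i < l)%N by apply: ltn_trans si _; rewrite -E'.
  by rewrite /coef (leqNgt l) il andbF mulr0 subr0.
pose g := hook_point k w *m E.
have gu : g \in unitmx by rewrite unitmx_mul hook_point_unit.
have gE r l : g r l = hook_point k w r l - (r == r1)%:R * coef l.
  rewrite mxE; under eq_bigr do rewrite [X in _ * X]mxE mulrBr.
  rewrite sumrB (bigD1 l) //= eqxx mulr1 big1 ?addr0 => [|a al]; last first.
    by rewrite (negbTE al) mulr0.
  congr (_ - _); rewrite (bigD1 s) //= eqxx mul1r big1 ?addr0 => [|a /negbTE ->].
    by rewrite mxE (negbTE s0) ws.
  by rewrite mul0r mulr0.
have g1 r : g r ord0 = 1 by rewrite gE mxE /coef !eqxx mulr0 subr0.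
have cr1' : (c r1)%:R != 0 :> k by rewrite natr_neq0 // content_lt.
have gsum (b : 'I_i.+1) : \sum_r (c r)%:R * g r (wd b) = 0.
  have [->|b0] := eqVneq b ord0.
    rewrite -[RHS]sum_content_natr; apply: eq_bigr => r _.
    by rewrite (_ : wd ord0 = ord0) ?g1 ?mulr1 //; exact: val_inj.
  have wb0 : wd b != ord0 by rewrite wd_eq0.
  under eq_bigr do rewrite gE mulrBr mxE (negbTE wb0).
  rewrite sumrB (bigD1 (w (wd b))) //= eqxx mulr1 big1 ?addr0 => [|r /negbTE ->].
    rewrite (bigD1 r1) //= eqxx mul1r big1 ?addr0 => [|r /negbTE ->].
      by rewrite /coef wb0 /= -ltnS ltn_ord mulrC divfK // subrr.
    by rewrite mul0r mulr0.
  by rewrite mulr0.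
have := @weight_part_eq0 (toGL g); rewrite toGLK // => /(_ g1 gsum).
rewrite weight_part_expansion toGLK // (bigID (fun T' : {set 'I_n} => r1 \in T')) /=.
(* Only row [r1] was modified, so minors that avoid it keep their values at the point of [T]. *)
have minE (T' : {set 'I_n}) : T' \in hook_index i mu r0 -> r1 \notin T' ->
    hook_fun i_lt c (enum_perm i r0 T') g = (T' == T)%:R.
  rewrite inE => /and3P[rT' _ /eqP Tc'] r1T'; rewrite hook_fun_ones //.
  rewrite -(hook_minor_enum k i_lt rT' Tc' rT Tc) /hook_minor; congr (\det _).
  apply/matrixP => a b; rewrite [LHS]mxE [RHS]mxE gE -/w.
  suff /negbTE -> : enum_perm i r0 T' (wd a) != r1 by rewrite mul0r subr0.
  apply: contraNneq r1T' => <-.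
  by rewrite (enum_permP i_lt rT' Tc').2 /= -ltnS.
rewrite [X in _ + X](bigD1 T) ?Tin //= [X in _ + (_ + X)]big1 ?addr0; last first.
  by move=> T' /andP[/andP[T'in r1T'] /negbTE T'T]; rewrite minE // T'T scale0r.
rewrite minE // eqxx scale1r => /eqP; rewrite addrC addr_eq0 => /eqP E'.
exists (fun T' => - hook_fun i_lt c (enum_perm i r0 T') g).
by rewrite E' -sumrN; apply: eq_bigr => T' _; rewrite scaleNr.
Qed.

Definition two_row_index : pred {set 'I_n} :=
  [pred T | (T \in hook_index i mu r0) && (r1 \in T)].

Lemma two_row_span (v : V) : weight_space (V := V) mu v ->
  exists a : {set 'I_n} -> k, v = \sum_(T in two_row_index) a T *: weight_vector T.
Proof.
case/weight_space_span_vectors => a ->.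
have /choice[b bE] T : exists b : {set 'I_n} -> k, T \in hook_index i mu r0 ->
    weight_vector T = \sum_(T' in two_row_index) b T' *: weight_vector T'.
  have [Tin|_] := boolP (T \in hook_index i mu r0); last by exists (fun=> 0).
  have [r1T|r1T] := boolP (r1 \in T).
    exists (fun T' => (T' == T)%:R) => _.
    have TA : T \in two_row_index by rewrite inE Tin.
    rewrite (bigD1 T) //= eqxx scale1r big1 ?addr0 // => T' /andP[_ /negbTE ->].
    by rewrite scale0r.
  have [b bE] := eliminate_row Tin r1T; exists b => _.
  by rewrite bE; apply: eq_bigl => T'; rewrite [in RHS]inE.
exists (fun T' => \sum_(T in hook_index i mu r0) a T * b T T').
under eq_bigr => T Tin do rewrite (bE T Tin) scaler_sumr.
rewrite exchange_big; apply: eq_bigr => T' _; rewrite scaler_suml.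
by apply: eq_bigr => T _; rewrite scalerA.
Qed.

(** The swap turns the row of [r1] into the unit vector of [r0], which is orthogonal to all columns
    of the point of [T'] but the first. This makes the pairing with the weight vectors diagonal. *)
Definition dual_point (T : {set 'I_n}) : 'M[k]_n :=
  (hook_point k (enum_perm i r0 T * tperm r0 r1)%g)^T.

Lemma gram_entry (w v : 'S_n) a b :
  \sum_r (hook_point k w)^T a r * (c r)%:R * hook_point k v r b =
  if a == ord0 then if b == ord0 then 0 else (c (v b))%:R
  else if b == ord0 then (c (w a))%:R else (w a == v b)%:R * (c (v b))%:R.
Proof.
have pick (f : 'I_n -> k) (x : 'I_n) : \sum_r f r * (r == x)%:R = f x.
  by rewrite (bigD1 x) //= eqxx mulr1 big1 ?addr0 // => r /negbTE ->; rewrite mulr0.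
under eq_bigr do rewrite !mxE.
have [a0|a0] := eqVneq a ord0; have [b0|b0] := eqVneq b ord0.
- by rewrite -[RHS]sum_content_natr; apply: eq_bigr => r _; rewrite mul1r mulr1.
- by rewrite pick mul1r.
- by under eq_bigr do rewrite mulr1 mulrC; rewrite pick.
by rewrite pick eq_sym.
Qed.

Lemma gram_neq0 (T T' : {set 'I_n}) : T \in two_row_index -> T' \in two_row_index ->
  (phi (gact (toGL (dual_point T)) (weight_vector T')) == 0 :> k) = (T != T').
Proof.
rewrite !inE => /andP[/and3P[rT Ts /eqP Tc] r1T] /andP[/and3P[rT' _ /eqP Tc'] r1T'].
have [e0 eT] := enum_permP i_lt rT Tc; have [e0' eT'] := enum_permP i_lt rT' Tc'.
have xu : dual_point T \in unitmx by rewrite unitmx_tr hook_point_unit.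
have x1 r : val (toGL (dual_point T)) ord0 r = 1 by rewrite toGLK // !mxE.
have gu := hook_point_unit k (enum_perm i r0 T').
have g1 r : val (toGL (hook_point k (enum_perm i r0 T'))) r ord0 = 1.
  by rewrite toGLK // mxE.
have := weight_part_formula x1 g1; rewrite !toGLK // -/(weight_vector T').
set w := enum_perm i r0 T in e0 eT *; set v := enum_perm i r0 T' in e0' eT' *.
set N := \matrix_(_, _) _ => fE.
have NE a b : N a b = if a == ord0 then if b == ord0 then 0 else (c (v (wd b)))%:R
  else if b == ord0 then (c (tperm r0 r1 (w (wd a))))%:R
  else (tperm r0 r1 (w (wd a)) == v (wd b))%:R * (c (v (wd b)))%:R.
  by rewrite [LHS]mxE gram_entry !wd_eq0 permM.
have facts : ((\prod_r (c r)`!)%:R != 0 :> k) && ((q`!)%:R != 0 :> k).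
  rewrite natr_prod; apply/andP; split.
    by apply/prodf_neq0 => r _; exact: fact_neq0 (content_lt r).
  by apply: fact_neq0; rewrite pE; lia.
case/andP: facts => f1 f2.
transitivity (\det N == 0).
  apply/eqP/eqP => E.
    by move: fE; rewrite E mulr0 => /esym/eqP; rewrite mulf_eq0 (negbTE f2) => /eqP.
  by move: fE; rewrite E mulr0 => /eqP; rewrite mulf_eq0 (negbTE f1) => /eqP.
have head (U : {set 'I_n}) (u : 'S_n) x : (forall l, (u l \in U) = (l <= i)%N) -> x \in U ->
    exists a : 'I_i.+1, u (wd a) = x.
  move=> uU xU; have ax : ((u^-1)%g x < i.+1)%N by rewrite ltnS -uU permKV.
  exists (Ordinal ax); rewrite (_ : wd _ = (u^-1)%g x) ?permKV //.
  exact: val_inj.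
(* Row [s] of [N], the one of [r1], has a single nonzero entry, in column 0. *)
have [s ws] := head T w r1 eT r1T.
have wd0 : wd ord0 = ord0 by exact: val_inj.
have s0 : s != ord0.
  by apply: contraNneq r10 => s0; rewrite -ws s0 wd0 e0.
have vr0 b : b != ord0 -> (r0 == v (wd b)) = false.
  by move=> b0; rewrite -e0' (inj_eq perm_inj) eq_sym wd_eq0 (negbTE b0).
have Ns b : N s b = if b == ord0 then (c r0)%:R else 0.
  rewrite NE (negbTE s0) ws tpermR; case: (eqVneq b ord0) => // b0.
  by rewrite vr0 // mul0r.
have c0 r : (0 < c r)%N -> (c r)%:R != 0 :> k.
  by move=> cr; apply: natr_neq0 => //; exact: content_lt.
have supp x : x \in T -> (0 < c x)%N.
  by move/(fintype.subsetP Ts); rewrite inE muE eqz_nat lt0n.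
case: (eqVneq T T') => [TT'|TT'].
  have vw : v = w by rewrite /v -TT'.
  (* A left kernel vector is 0 entry by entry: column [s] gives [y_0 = 0], then each other column
     [b] gives [y_b = 0], and column 0 gives [y_s = 0]. *)
  apply/negbTE/det0P => -[y y0 /rowP yN]; case/eqP: y0.
  have colE b : \sum_a y 0 a * N a b = 0 by have := yN b; rewrite !mxE.
  have y00 : y 0 ord0 = 0.
    have := colE s; rewrite (bigD1 ord0) //= big1 ?addr0 => [|a a0].
      rewrite NE eqxx (negbTE s0) vw ws => /eqP.
      by rewrite mulf_eq0 (negbTE (c0 _ cr1)) orbF => /eqP.
    rewrite NE (negbTE a0) (negbTE s0) vw ws -[in X in _ == X](tpermL r0 r1).
    rewrite (inj_eq perm_inj) eq_sym -vw vr0 // ?mul0r ?mulr0 //.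
  have yb b : b != s -> y 0 b = 0.
    move=> bs; have [->|b0] := eqVneq b ord0; first exact: y00.
    have wb0 : r0 != w (wd b) by rewrite -vw vr0.
    have wb1 : r1 != w (wd b).
      rewrite -ws (inj_eq perm_inj) eq_sym; apply: contra bs.
      by rewrite -!val_eqE.
    have := colE b; rewrite (bigD1 b) //= big1 ?addr0 => [|a ab].
      rewrite NE (negbTE b0) vw tpermD // eqxx mul1r => /eqP.
      rewrite mulf_eq0 => /orP[/eqP //|]; rewrite (negbTE (c0 _ _)) //.
      by apply: supp; rewrite eT /= -ltnS.
    have [->|a0] := eqVneq a ord0; first by rewrite y00 mul0r.
    rewrite NE (negbTE a0) (negbTE b0) vw -[in X in _ == X](tpermD wb0 wb1).
    rewrite !(inj_eq perm_inj) -val_eqE /= (_ : (val a == val b) = (a == b)) //.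
    by rewrite (negbTE ab) mul0r mulr0.
  apply/rowP => b; rewrite [RHS]mxE; have [->|/yb //] := eqVneq b s.
  have := colE ord0; rewrite (bigD1 s) //= big1 ?addr0 => [|a /yb ->]; last by rewrite mul0r.
  by rewrite Ns eqxx => /eqP; rewrite mulf_eq0 (negbTE (c0 _ cr0)) orbF => /eqP.
have [x xT xT'] : exists2 x, x \in T & x \notin T'.
  by apply/subsetPn; apply: contra TT' => sT; rewrite eqEcard sT Tc Tc' /=.
have [a wa] := head T w x eT xT.
have a0 : a != ord0 by apply: contraNneq xT' => a0; rewrite -wa a0 wd0 e0.
have xr0 : r0 != x by apply: contraNneq xT' => <-.
have xr1 : r1 != x by apply: contraNneq xT' => <-.
have Na b : N a b = if b == ord0 then (c x)%:R else 0.
  rewrite NE (negbTE a0) wa tpermD //; case: (eqVneq b ord0) => // b0.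
  rewrite (_ : (x == v (wd b)) = false) ?mul0r //; apply: contraNF xT' => /eqP ->.
  by rewrite eT' /= -ltnS.
have sa : s != a by apply: contraNneq xr1 => sa; rewrite -ws sa wa.
(* Rows [a] and [s] are both concentrated in column 0, with entries [c x] and [c r0]. *)
apply/det0P; exists (\row_b ((c r0)%:R * (b == a)%:R - (c x)%:R * (b == s)%:R)).
  apply/negP => /eqP/rowP/(_ a); rewrite !mxE eqxx eq_sym (negbTE sa) mulr1 mulr0 subr0.
  by move/eqP; rewrite (negbTE (c0 _ cr0)).
apply/rowP => b; rewrite !mxE; under eq_bigr do rewrite mxE mulrBl.
have pick z t : \sum_l z * (l == t)%:R * N l b = z * N t b.
  rewrite (bigD1 t) //= eqxx mulr1 big1 ?addr0 // => l /negbTE ->.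
  by rewrite mulr0 mul0r.
rewrite sumrB !pick.
rewrite Na Ns; case: ifP => _; last by rewrite !mulr0 subrr.
by rewrite mulrC subrr.
Qed.

Lemma two_row_dim : subspace_dim (weight_space (V := V) mu) = #|two_row_index|.
Proof.
apply: (subspace_dimE (e := weight_vector)) => [T _|v|a a0 T TA].
- exact: weight_vector_weight.
- exact: two_row_span.
have := congr1 (fun v => phi (gact (toGL (dual_point T)) v) : k) a0.
rewrite !linear0 !linear_sum (bigD1 T) //= big1 ?addr0 => [|T' /andP[T'A T'T]].
  rewrite !linearZ /= => /eqP; rewrite mulf_eq0 gram_neq0 // eqxx orbF.
  by move/eqP.
rewrite !linearZ /=; have := gram_neq0 TA T'A; rewrite (eq_sym T T') T'T => /eqP ->.
by rewrite scaler0.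
Qed.

Lemma card_two_row_index i' : i = i'.+1 -> #|two_row_index| = 'C(#|wsupport mu| - 2, i').
Proof.
move=> iE; have r01 : [set r0; r1]%SET \subset wsupport mu.
  by rewrite finset.subUset !finset.sub1set !inE !muE !eqz_nat -!lt0n cr0 cr1.
have c2 : #|[set r0; r1]%SET| = 2%N by rewrite cards2 eq_sym r10.
rewrite -c2 -card_between //; apply: eq_card => T.
rewrite !inE finset.subUset !finset.sub1set c2 iE add2n.
by case: (r0 \in T); case: (r1 \in T); rewrite /= ?andbT ?andbF.
Qed.

(** The determinant has size 1 and entry [\sum_r c r = p = 0]. Indeed L(p, 0, .., 0) is the
    Frobenius twist of the natural module, with weights [p eps_r] only. *)
Lemma two_row_dim0 : i = 0%N -> subspace_dim (weight_space (V := V) mu) = 0%N.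
Proof.
move=> i0; rewrite -(@card0 {set 'I_n}); apply: (subspace_dimE (e := weight_vector)) => //.
move=> v /weight_space_span_vectors[a ->]; exists (fun=> 0); rewrite [RHS]big_pred0 //.
rewrite big1 // => T _; rewrite /weight_vector weight_part_eq0 ?scaler0 // => [r|b].
  by rewrite toGLK ?hook_point_unit // mxE.
rewrite -[RHS]sum_content_natr; apply: eq_bigr => r _.
rewrite toGLK ?hook_point_unit // mxE wd_eq0 (_ : b == ord0) ?mulr1 //.
by have := ltn_ord b; rewrite -val_eqE /= {2}i0; case: (val b).
Qed.

End TwoRows.

(** For [i > 0] the index set is empty. For [i = 0] it has one element, whose weight vector is
    nonzero because [mu] is conjugate to [lam]. *)
Lemma one_row_dim : v0 != 0 -> wsupport mu = [set r0]%SET ->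
  subspace_dim (weight_space (V := V) mu) = (i == 0%N).
Proof.
move=> v0n supp1.
have idx1 T : T \in hook_index i mu r0 -> T = [set r0]%SET.
  rewrite inE supp1 => /and3P[rT Ts _]; apply/eqP.
  by rewrite finset.eqEsubset Ts finset.sub1set.
have := card_hook_index; rewrite supp1 finset.cards1 /= => cardA.
case: (posnP i) => [i0|i_gt0]; last first.
  rewrite -[RHS](@card0 {set 'I_n}); apply: (subspace_dimE (e := weight_vector)) => //.
  move=> v /weight_space_span_vectors[a ->]; exists a; rewrite [RHS]big_pred0 // big_pred0 // => T.
  apply: card0_eq; rewrite cardA bin0n gtn_eqF //.
transitivity #|hook_index i mu r0|; last by rewrite cardA i0.
apply: (subspace_dimE (e := weight_vector)) => [T _|v|a a0 T TA].
- exact: weight_vector_weight.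
- exact: weight_space_span_vectors.
have Tsum (b : {set 'I_n} -> k) :
    \sum_(T' in hook_index i mu r0) b T' *: weight_vector T' = b T *: weight_vector T.
  rewrite (bigD1 T) //= big1 ?addr0 // => T' /andP[/idx1 -> ].
  by rewrite (idx1 _ TA) eqxx.
move: a0; rewrite Tsum => /eqP; rewrite scaler_eq0 => /orP[/eqP //|/eqP wv0].
(* [S v0] has weight [mu] and would vanish together with the weight vector. *)
pose s := tperm ord0 r0; pose S := toGL (perm_mx s : 'M[k]_n).
have Su : (perm_mx s : 'M[k]_n) \in unitmx by exact: unitmx_perm.
suff Sw : weight_space (V := V) mu (gact S v0).
  have [b E] := weight_space_span_vectors Sw; move: v0n.
  by rewrite -[v0](gact1) -(mulVg S) gactM E Tsum wv0 scaler0 linear0 eqxx.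
move=> t td; pose t' := (S^-1 * t * S)%g.
have tS : (t * S = S * t')%g by rewrite /t' !mulgA mulgV mul1g.
have t'E r r' : val t' r r' = val t (s r) (s r').
  have : val (S * t')%g (s r) r' = val (t * S)%g (s r) r' by rewrite tS.
  have -> : val (S * t')%g = perm_mx s *m val t' by rewrite -(toGLK Su).
  have -> : val (t * S)%g = val t *m perm_mx s^-1 by rewrite tpermV -(toGLK Su).
  by rewrite -row_permE -col_permE !mxE tpermK.
have t'd : is_diag_mx (val t').
  apply/is_diag_mxP => r r' rr'; rewrite t'E; have /is_diag_mxP -> // := td.
  by rewrite val_eqE (inj_eq perm_inj).
rewrite -gactM tS gactM v0w // linearZ /=; congr (_ *: _).
rewrite /wchar [RHS](reindex_inj (@perm_inj _ s)) /=; apply: eq_bigr => r _.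
rewrite t'E; congr (_ ^ _); rewrite muE.
have mu0 r' : r' != r0 -> c r' = 0%N.
  move=> r'r0; have : r' \notin wsupport mu by rewrite supp1 inE.
  by rewrite inE muE eqz_nat negbK => /eqP.
have cr0E : c r0 = q.+1.
  by rewrite -[RHS]addn0 -{1}i0 -csum (bigD1 r0) //= big1 ?addn0.
have [->|rn0] := eqVneq r ord0; first by rewrite tpermL lam0 cr0E.
rewrite lamE // i0 leqn0; have := rn0; rewrite -val_eqE /= => /negbTE ->.
by rewrite mu0 // -(tpermL ord0 r0) (inj_eq perm_inj).
Qed.

Theorem simple_weight_dim : v0 != 0 ->
  subspace_dim (weight_space (V := V) mu) = hook_multiplicity #|wsupport mu| i.
Proof.
move=> v0n; have r0s : r0 \in wsupport mu by rewrite inE muE eqz_nat -lt0n.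
have [/existsP[r1 /andP[r10 r1s]]|/existsPn nr1] :=
  boolP [exists r1, (r1 != r0) && (r1 \in wsupport mu)].
  have cr1 : (0 < c r1)%N by move: r1s; rewrite inE muE eqz_nat lt0n.
  have s2 : (1 < #|wsupport mu|)%N.
    by rewrite (cardsD1 r0) r0s (cardsD1 r1) in_setD1 r10 r1s.
  case: (posnP i) => [i0|ip].
    by rewrite (two_row_dim0 r10 cr1 i0) i0; case: #|_| s2 => [|[]].
  rewrite (two_row_dim r10 cr1) (card_two_row_index r10 cr1 (esym (prednK ip))).
  by case: #|_| s2 => [|[|s]] //= _; rewrite !subSS subn0; case: i ip.
have supp1 : wsupport mu = [set r0]%SET.
  apply/finset.setP => r; rewrite !inE; apply/idP/eqP => [rs|->]; last first.
    by move: r0s; rewrite inE.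
  by apply/eqP; have := nr1 r; rewrite inE rs andbT negbK.
by rewrite one_row_dim // supp1 finset.cards1.
Qed.

End GoodWeight.

End SimpleWeights.

(** * Formal characters *)

Section FormalCharacter.
Variables (k : fieldType) (n : nat).

(** The finite set [A] makes the sum in [ch] a genuine one; with infinitely many nonzero terms it
    would default to 0. *)
Lemma coeff_ch (V : gmodule k n) (A : {fset 'rV[int]_n}) (mu : 'rV[int]_n) :
  (forall nu, nu \notin A -> subspace_dim (weight_space (V := V) nu) = 0%N) ->
  coeff mu (ch V) = (subspace_dim (weight_space (V := V) mu))%:Z.
Proof.
move=> A0; rewrite /ch (fsbigTE A) => [|nu /A0 ->]; last exact: freegU0.
rewrite raddf_sum /=; have [muA|muA] := boolP (mu \in A).
  rewrite (bigD1_seq mu muA (fset_uniq A)) /= coeffU eqxx mulr1 big1 ?addr0 // => nu /negbTE num.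
  by rewrite coeffU num mulr0.
rewrite (A0 _ muA) big1_seq // => nu /andP[_ nuA]; rewrite coeffU.
by case: eqP nuA muA => [->->|]; rewrite ?mulr0.
Qed.

End FormalCharacter.

(** * The finite set of possible weights *)

Section Compositions.
Variables (m p : nat).
Local Notation n := m.+1.
Implicit Types mu : 'rV[int]_n.

Definition compositions : {fset 'rV[int]_n} :=
  [fset \row_r (val ((f : {ffun 'I_n -> 'I_p.+1}) r))%:Z
    | f in [pred f : {ffun 'I_n -> 'I_p.+1} | (\sum_r f r)%N == p]]%fset.

Lemma composition_content mu : (forall r, 0 <= mu 0 r) -> \sum_r mu 0 r = p%:Z ->
  {c : 'I_n -> nat | (forall r, mu 0 r = (c r)%:Z) & (\sum_r c r)%N = p}.
Proof.
move=> ge0 sum_p; exists (fun r => absz (mu 0 r)).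
  by move=> r; rewrite gez0_abs.
apply/eqP; rewrite -eqz_nat -sum_p -natz natr_sum; apply/eqP/eq_bigr => r _.
by rewrite natz gez0_abs.
Qed.

Lemma notin_compositions mu : mu \notin compositions ->
  (exists s, mu 0 s < 0) \/ \sum_r mu 0 r != p%:Z.
Proof.
move=> muN; have [/existsP[s s0]|/existsPn ge0] := boolP [exists s, mu 0 s < 0].
  by left; exists s.
right; apply/eqP => sum_p; have [r|c muE csum] := composition_content _ sum_p.
  by have := ge0 r; lia.
move/negP: muN; apply; apply/imfsetP; rewrite /=.
have c_le r : (c r < p.+1)%N by rewrite ltnS -csum (bigD1 r) //= leq_addr.
exists [ffun r => inord (c r)]; last by apply/rowP => r; rewrite mxE ffunE inordK.
apply/eqP; rewrite -[RHS]csum.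
by apply: eq_bigr => r _; rewrite ffunE inordK.
Qed.

Lemma card_wsupport_le mu (c : 'I_n -> nat) : (forall r, mu 0 r = (c r)%:Z) ->
  (#|wsupport mu| <= \sum_r c r)%N.
Proof.
move=> muE; rewrite -sum1_card big_mkcond /=; apply: leq_sum => r _.
by rewrite inE muE eqz_nat; case: (c r).
Qed.

End Compositions.

Lemma hook_hook_like m p i : hook_like i (hook m.+1 p i).
Proof. by move=> l l0; rewrite mxE ifN. Qed.

Lemma sum_hook_like m i q (lam : 'rV[int]_m.+1) : (i.+1 <= m.+1)%N -> hook_like i lam ->
  lam 0 ord0 = q.+1%:Z -> \sum_r lam 0 r = (q.+1 + i)%:Z.
Proof.
move=> i_lt lamE lam0; rewrite big_ord_recl lam0 PoszD; congr (_ + _).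
under eq_bigr => r _ do rewrite lamE //.
rewrite -[i in RHS]card_ord -sum1_card (big_ord_widen m (fun=> 1%N)) //.
by rewrite -natz natr_sum [RHS]big_mkcond; apply: eq_bigr => r _; rewrite /bump; case: (_ < _)%N.
Qed.

(** * Comparison of the characters *)

Section HookCharacters.
Variable k : fieldType.
Hypothesis k_infinite : infinite_set [set: k].
Variables (m p : nat).
Hypothesis p_char : p \in [pchar k].
Local Notation n := m.+1.
Implicit Types mu : 'rV[int]_n.

(** The parameter [q] of the general statements is [p - 1 - i], so that [q.+1 + i = p]. *)
Lemma hook_ord0 i : (i < p)%N -> hook n p i 0 ord0 = (p.-1 - i).+1%:Z.
Proof. by move=> ip; rewrite mxE /=; lia. Qed.

Lemma hook_size i : (i < p)%N -> (p = (p.-1 - i).+1 + i)%N.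
Proof. by lia. Qed.

Lemma sum_hook i : (i <= m)%N -> (i < p)%N -> \sum_r hook n p i 0 r = p%:Z.
Proof.
move=> im ip; rewrite [in RHS](hook_size ip).
by apply: sum_hook_like (hook_ord0 ip) => //; exact: hook_hook_like.
Qed.

Lemma Delta_hook_dim i mu (c : 'I_n -> nat) r0 : (i <= m)%N -> (i < p)%N ->
  (forall r, mu 0 r = (c r)%:Z) -> (\sum_r c r)%N = p -> (0 < c r0)%N ->
  subspace_dim (weight_space (V := Delta k (hook n p i)) mu) = 'C(#|wsupport mu|.-1, i).
Proof.
move=> im ip muE csum cr0; rewrite -(card_hook_index i muE cr0).
apply: (delta_dim k_infinite _ (@hook_hook_like m p i) (hook_ord0 ip) muE _ cr0) => //.
by rewrite -hook_size.
Qed.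

Lemma Delta_hook_dim0 i mu : (i <= m)%N -> (i < p)%N -> mu \notin compositions m p ->
  subspace_dim (weight_space (V := Delta k (hook n p i)) mu) = 0%N.
Proof.
move=> im ip /notin_compositions bad.
apply: (delta_dim0 k_infinite (@hook_hook_like m p i) (hook_ord0 ip)).
by rewrite sum_hook.
Qed.

Lemma simple_hook_dims i (L : gmodule k n) : (i <= m)%N -> (i < p)%N -> is_L (hook n p i) L ->
  (forall mu, mu \notin compositions m p ->
     subspace_dim (weight_space (V := L) mu) = 0%N) /\
  forall mu (c : 'I_n -> nat) r0,
    (forall r, mu 0 r = (c r)%:Z) -> (\sum_r c r)%N = p -> (0 < c r0)%N ->
    subspace_dim (weight_space (V := L) mu) = hook_multiplicity #|wsupport mu| i.
Proof.
move=> im ip [Lrat Lsimple [[v0 v0w v0_neq0] dom]].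
have lamE := @hook_hook_like m p i; have lam0 := hook_ord0 ip.
have i_lt : (i.+1 <= n)%N by [].
have span := highest_span Lsimple v0_neq0.
have [phi [phiE sep]] := simple_form k_infinite i_lt lamE lam0 Lrat Lsimple v0_neq0 v0w dom.
split=> [mu /notin_compositions bad|mu c r0 muE csum cr0].
  apply: (simple_weight_dim_bad k_infinite lamE lam0 Lrat v0w dom sep span).
  by rewrite sum_hook.
have csum' : (\sum_r c r = (p.-1 - i).+1 + i)%N by rewrite -hook_size.
exact: (simple_weight_dim k_infinite lamE lam0 Lrat v0w dom phiE sep span muE csum' cr0
  p_char (hook_size ip) v0_neq0).
Qed.

Lemma hook_character i (L : gmodule k n) (M := minn m p.-1) : (i <= M)%N ->
  is_L (hook n p i) L ->
  ch L = \sum_(i <= j < M.+1) (-1) ^+ (j - i) *: ch (Delta k (hook n p j)).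
Proof.
move=> iM Lhook; have p_gt0 : (0 < p)%N by rewrite prime_gt0 ?(pcharf_prime p_char).
have leM j : (j < M.+1)%N -> (j <= m)%N /\ (j < p)%N by rewrite /M; lia.
have [im ip] := leM i iM; have [L0 Ldim] := simple_hook_dims im ip Lhook.
apply/eqP/freeg_eqP => mu /=; rewrite (coeff_ch _ L0) raddf_sum /=.
transitivity (\sum_(i <= j < M.+1) (-1) ^+ (j - i) *
    (subspace_dim (weight_space (V := Delta k (hook n p j)) mu))%:Z); last first.
  apply: eq_big_nat => j /andP[_ /leM[jm jp]]; rewrite coeffZ.
  by rewrite (coeff_ch _ (A := compositions m p)) // => nu; exact: Delta_hook_dim0.
have [|muN] := boolP (mu \in compositions m p); last first.
  rewrite (L0 _ muN) big_nat big1 // => j /andP[_ /leM[jm jp]].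
  by rewrite Delta_hook_dim0 ?mulr0.
case/imfsetP => f /eqP f_sum mu_f; pose c r : nat := f r.
have muE r : mu 0 r = (c r)%:Z by rewrite mu_f mxE.
have [r0 cr0] : exists r0, (0 < c r0)%N.
  apply/existsP; move: p_gt0; rewrite -f_sum lt0n sum_nat_eq0 negb_forall /=.
  by under eq_existsb do rewrite -lt0n.
have r0s : r0 \in wsupport mu by rewrite inE muE eqz_nat -lt0n.
have s_gt0 : (0 < #|wsupport mu|)%N by rewrite (cardsD1 r0) r0s.
(* The support has at most [min(n, p) = M + 1] elements, so cutting the sum at [M] drops only zero
   binomials. *)
have sM : (#|wsupport mu| <= M.+1)%N.
  have := card_wsupport_le muE; rewrite f_sum; have := max_card (wsupport mu).
  by rewrite card_ord /M; lia.
rewrite (Ldim mu c r0) // -(alternating_bin s_gt0 sM (leqW iM)).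
apply: eq_big_nat => j /andP[_ /leM[jm jp]].
by rewrite (Delta_hook_dim jm jp muE f_sum cr0).
Qed.

End HookCharacters.

Theorem corollary1 (k : fieldType) (p n : nat)
    (k_infinite : infinite_set [set: k]) (k_char : p \in [pchar k])
    (n_gt0 : (0 < n)%N) (i : nat) (i_le_m : (i <= minn n.-1 p.-1)%N)
    (L : gmodule k n) (L_simple_hook : is_L (hook n p i) L) :
  ch L = \sum_(i <= j < (minn n.-1 p.-1).+1)
           (-1) ^+ (j - i) *: ch (Delta k (hook n p j)).
Proof.
case: n n_gt0 L L_simple_hook i_le_m => // m _ L L_simple_hook i_le_m.
exact: (hook_character k_infinite k_char i_le_m L_simple_hook).
Qed.
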